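(* Let $d\ge 1$, $x_0\in\mathbb{R}^d$, and let $f\in C^0([0,1]\times\mathbb{R}^d,\mathbb{R}^d)$ be such that for some $k\ge 0$, $|f(t,x)-f(t,y)|\le k|x-y|$ for all $t\in[0,1]$ and $x,y\in\mathbb{R}^d$. Let $j:[0,1]\times\mathbb{R}^d\to\mathbb{R}$, $h:\mathbb{R}^d\to\mathbb{R}$ and $g:T\to\mathbb{R}$ be continuous. Assume that $h$ is of class $C^1$, that $j(t,\cdot)$ and $f(t,\cdot)$ are differentiable for every $t\in[0,1]$, and that $\nabla_x j$ and $D_xf$ are continuous on $[0,1]\times\mathbb{R}^d$. Let $$J(\gamma):=\int_0^1 j(t,x_\gamma(t))\,dt+h(x_\gamma(1))+\int_T g(t,s)\,d\gamma(t,s),\qquad \gamma\in\Gamma.$$ Suppose $\gamma\in\Gamma$ minimizes $J$ over $\Gamma$, write $\gamma=\nu_t\otimes\mathcal{L}^1=\nu\otimes\nu_s^*$, and let $x=x_\gamma$. Then for $\mathcal{L}^1$-a.e. $t\in[0,1]$, $$\operatorname{spt}(\nu_t)\subset\operatorname{argmax}_{s\in[0,t]}\big\{q(t)\cdot f(s,x(s))-g(t,s)\big\},$$ where $q$ is the adjoint variable, i.e. the unique solution of $$\dot q(s)=\nabla_xj(s,x(s))-D_xf(s,x(s))^T\langle q,\nu_s^*\rangle\,\nu(s),\qquad q(1)=-\nabla h(x(1)),$$ in the sense that $q\in L^1([0,1],\mathbb{R}^d)$ and, for a.e. $t\in[0,1]$, $$q(t)=-\nabla h(x(1))-\int_t^1\nabla_xj(s,x(s))\,ds+\int_{[t,1]}D_xf(s,x(s))^T\langle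 q,\nu_s^*\rangle\,d\nu(s).$$
   Context: $\mathcal{L}^1$ is the Lebesgue measure on $[0,1]$ and $T:=\{(t,s)\in[0,1]^2 : s\le t\}$. $\Gamma$ is the set of Borel probability measures $\gamma$ on $[0,1]^2$ with $\gamma(T)=1$ and first marginal ${\pi_1}_\#\gamma=\mathcal{L}^1$. Every $\gamma\in\Gamma$ disintegrates as $\gamma=\nu_t\otimes\mathcal{L}^1$, meaning $\int\varphi\,d\gamma=\int_0^1\big(\int_0^1\varphi(t,s)\,d\nu_t(s)\big)dt$ for all $\varphi\in C^0([0,1]^2)$, where $(\nu_t)_{t\in[0,1]}$ is a Borel family of probability measures on $[0,1]$ ($t\mapsto\int \phi\,d\nu_t$ is Borel for every continuous $\phi$) with $\nu_t([0,t])=1$ for every $t$. It also disintegrates as $\gamma=\nu\otimes\nu_s^*$, where $\nu:={\pi_2}_\#\gamma$ is the second marginal and $(\nu_s^* )_s$ is a Borel family of probability measures (defined for $\nu$-a.e. $s$, with $\nu_s^*([s,1])=1$) such that $\int\varphi\,d\gamma=\int_0^1\big(\int\varphi(t,s)\,d\nu_s^*(t)\big)d\nu(s)$ for $\varphi\in C^0([0,1]^2)$. For $q\in L^1([0,1],\mathbb{R}^d)$, $\langle q,\nu_s^*\rangle\,\nu$ is the $\mathbb{R}^d$-valued finite measure on $[0,1]$ defined by $\varphi\mapsto\int_{[0,1]^2}q(t)\varphi(s)\,d\gamma(t,s)=\int_0^1 q(t)\big(\int\varphi\,d\nu_t\big)dt$ for $\varphi\in C^0([0,1])$. For $\gamma=\nu_t\otimes\mathcal{L}^1\in\Gamma$,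 $x_\gamma\in C^0([0,1],\mathbb{R}^d)$ denotes the unique continuous solution of $\dot x(t)=\int_0^t f(s,x(s))\,d\nu_t(s)$, $x(0)=x_0$, understood in the integrated form $x(t)=x_0+\int_0^t\big(\int_0^\tau f(s,x(s))\,d\nu_\tau(s)\big)d\tau$ for all $t\in[0,1]$. The adjoint equation has a unique solution (up to a.e. equality) and it is a BV function. *)

(* Defs.v *)
From HB Require Import structures.
From mathcomp Require Import all_boot all_order all_algebra.
From mathcomp Require Import all_classical all_reals all_analysis.
Set Implicit Arguments.
Unset Strict Implicit.
Unset Printing Implicit Defensive.
Import Order.TTheory GRing.Theory Num.Theory.
Import numFieldNormedType.Exports.
Local Open Scope classical_set_scope.
Local Open Scope ring_scope.

(* R^d is 'rV[R]_d, with the topology of the library (that of the sup norm).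
   Measures on [0,1] and [0,1]^2 are Borel probability measures on R and R^2
   giving full mass to a subset of [0,1], resp. [0,1]^2.  Functions defined on
   [0,1], [0,1]^2, [0,1] x R^d or T are total functions whose values off that
   set are unconstrained and never used. *)

Notation borelR R := (measurableTypeR R).
Notation borelR2 R := (measurableTypeR R * measurableTypeR R)%type.

Section Vectors.
Context {R : realType} {d : nat}.

Definition dotp (u v : 'rV[R]_d) : R := \sum_(i < d) u 0 i * v 0 i.

Definition enorm (u : 'rV[R]_d) : R := Num.sqrt (dotp u u).

Definition grad (F : 'rV[R]_d -> R) (x : 'rV[R]_d) : 'rV[R]_d :=
  \row_(i < d) 'D_(delta_mx 0 i) F x.

Definition vint {dT : measure_display} {X : measurableType dT}
    (mu : {measure set X -> \bar R}) (A : set X) (F : X -> 'rV[R]_d) : 'rV[R]_d :=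
  \row_(i < d) \int[mu]_(a in A) F a 0 i.

Definition argmax_on (A : set R) (F : R -> R) : set R :=
  [set s | A s /\ forall r, A r -> F r <= F s].

Definition spt (mu : set (borelR R) -> \bar R) : set R :=
  [set s | forall U : set R, open U -> U s -> (0 < mu U)%E].

End Vectors.

Section Plans.
Context {R : realType}.

Definition I01 : set R := `[0, 1].

Definition sq01 : set (R * R) := I01 `*` I01.

Definition triangle : set (R * R) := [set p | sq01 p /\ p.2 <= p.1].

Definition marginal1 (gamma : probability (borelR2 R) R) :
    probability (borelR R) R :=
  distribution gamma (mfun_Sub (mem_set
    (measurable_fst : measurable_fun setT (@fst (borelR R) (borelR R))))).

Definition marginal2 (gamma : probability (borelR2 R) R) :
    probability (borelR R) R :=
  distribution gamma (mfun_Sub (mem_set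
    (measurable_snd : measurable_fun setT (@snd (borelR R) (borelR R))))).

Definition Gamma : set (probability (borelR2 R) R) :=
  [set gamma : probability (borelR2 R) R | gamma triangle = 1%E /\
    forall A : set (borelR R), measurable A ->
      marginal1 gamma A =
      mrestr (@lebesgue_measure R) (measurable_itv `[0, 1]) A].

Definition borel_family (nu : R -> probability (borelR R) R) : Prop :=
  forall phi : R -> R, {within I01, continuous phi} ->
    measurable_fun (I01 : set (borelR R))
      (fun t : borelR R => \int[nu t]_(s in I01) phi s : borelR R).

Definition disintegration1 (gamma : probability (borelR2 R) R)
    (nu : R -> probability (borelR R) R) : Prop :=
  [/\ borel_family nu,
      (forall t, t \in I01 -> nu t `[0, t]%classic = 1%E) &
      forall phi : R * R -> R, {within sq01, continuous phi} ->
        \int[gamma]_(p in sq01) phi p =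
        \int[@lebesgue_measure R]_(t in I01)
          \int[nu t]_(s in I01) phi (t, s)].

(* nus is total, but only its values for marginal2 gamma-a.e. s matter. *)
Definition disintegration2 (gamma : probability (borelR2 R) R)
    (nus : R -> probability (borelR R) R) : Prop :=
  [/\ borel_family nus,
      {ae marginal2 gamma, forall s, nus s `[s, 1]%classic = 1%E} &
      forall phi : R * R -> R, {within sq01, continuous phi} ->
        \int[gamma]_(p in sq01) phi p =
        \int[marginal2 gamma]_(s in I01)
          \int[nus s]_(t in I01) phi (t, s)].

End Plans.

Section Control.
Context {R : realType} {d : nat}.
Variables (f : R -> 'rV[R]_d -> 'rV[R]_d) (x0 : 'rV[R]_d).

Definition is_trajectory (gamma : probability (borelR2 R) R)
    (x : R -> 'rV[R]_d) : Prop :=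
  {within I01, continuous x} /\
  exists nu : R -> probability (borelR R) R,
    disintegration1 gamma nu /\
    forall t, t \in I01 ->
      x t = x0 + vint (@lebesgue_measure R) `[0, t]
                   (fun tau => vint (nu tau) `[0, tau] (fun s => f s (x s))).

(* x_gamma; for f continuous and Lipschitz in the state the trajectory exists
   and is unique on [0,1], and only its values there are used *)
Definition trajectory (gamma : probability (borelR2 R) R) : R -> 'rV[R]_d :=
  get (is_trajectory gamma).

Definition cost (j : R -> 'rV[R]_d -> R) (h : 'rV[R]_d -> R) (g : R -> R -> R)
    (gamma : probability (borelR2 R) R) : R :=
  \int[@lebesgue_measure R]_(t in I01) j t (trajectory gamma t) +
  h (trajectory gamma 1) +
  \int[gamma]_(p in triangle) g p.1 p.2.

(* The density <q, nu_s^*> is vint (nus s) I01 q, the integral of q against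
   nu_s^*; it is well defined for nu-a.e. s and depends only on the a.e. class
   of q, because the first marginal of gamma is the Lebesgue measure.
   In row-vector convention 'J F y has entries (i, k) |-> d_i F_k(y), so that
   w *m ('J F y)^T is the row form of (D F(y))^T w. *)
Definition is_adjoint (j : R -> 'rV[R]_d -> R) (h : 'rV[R]_d -> R)
    (gamma : probability (borelR2 R) R) (nus : R -> probability (borelR R) R)
    (x : R -> 'rV[R]_d) (q : R -> 'rV[R]_d) : Prop :=
  (forall i : 'I_d,
     (@lebesgue_measure R).-integrable I01 (fun t => (q t 0 i)%:E)) /\
  {ae (@lebesgue_measure R), forall t, t \in I01 ->
     q t = - grad h (x 1)
           - vint (@lebesgue_measure R) `[t, 1] (fun s => grad (j s) (x s))
           + vint (marginal2 gamma) `[t, 1]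
               (fun s => vint (nus s) I01 q *m ('J (f s) (x s))^T)}.

End Control.

(* Main.v *)
Require Import Defs.
From HB Require Import structures.
From mathcomp Require Import all_boot all_order all_algebra.
From mathcomp Require Import all_classical all_reals all_analysis.
From mathcomp Require Import measurable_realfun giry ring lra.
Set Implicit Arguments.
Unset Strict Implicit.
Unset Printing Implicit Defensive.
Import Order.TTheory GRing.Theory Num.Theory.
Import numFieldNormedType.Exports.
Local Open Scope classical_set_scope.
Local Open Scope ring_scope.

(* Let A be a measurable set of times contained in [s0, 1], let Theta (t, s) be
   (t, s0) if t is in A and (t, s) otherwise, and compare gamma with
   gamma_e := (1 - e) gamma + e Theta#gamma, which belongs to Gamma.  A weighted
   (Bielecki) norm gives |x_e - x| <= C e for the trajectories.  Testing the exact
   integral equation of x_e - x against the adjoint q and exchanging integrals, the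
   first-order part of the cost coming from j and h becomes
   - e \int q(t) . (f(Theta (t, s)) - f(t, s)) dgamma + o(e), f being evaluated at
   the second coordinate along x.  Hence, with H (t, s) := q(t) . f(s, x(s)) - g(t, s),
   minimality gives \int_A (H(t, s0) - \int H(t, .) dnu_t) dt <= 0.  Choosing
   A := {t >= s0 | H(t, s0) > \int H(t, .) dnu_t} shows that A is negligible.  Letting
   s0 run over the rationals, for a.e. t the mean of the continuous function H(t, .)
   under nu_t is its maximum over [0, t], so H(t, .) is maximal on spt nu_t. *)

(** * Integrals of real functions *)

Lemma ae_imp {d} {T : measurableType d} {R : realType}
    (m : {measure set T -> \bar R}) (p q : T -> Prop) : (forall z, p z -> q z) ->
  {ae m, forall z, p z} -> {ae m, forall z, q z}.
Proof. by move=> pq; apply: filterS. Qed.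

Lemma ae_imp2 {d} {T : measurableType d} {R : realType}
    (m : {measure set T -> \bar R}) (p q r : T -> Prop) :
  (forall z, p z -> q z -> r z) ->
  {ae m, forall z, p z} -> {ae m, forall z, q z} -> {ae m, forall z, r z}.
Proof. by move=> pqr; apply: filterS2. Qed.

Lemma Rintegral_probability_cst {d} {T : measurableType d} {R : realType}
    (P : probability T R) (c : R) : \int[P]_z c = c.
Proof.
by rewrite Rintegral_cst// [X in fine X](_ : _ = 1%E) ?mulr1//; exact: probability_setT.
Qed.

Lemma ae_eq0_of_Rintegral_le0 {d} {T : measurableType d} {R : realType}
    (P : probability T R) (w : T -> R) :
  P.-integrable setT (EFin \o w) -> (forall z, 0 <= w z) -> \int[P]_z w z <= 0 ->
  {ae P, forall z, w z = 0}.
Proof.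
move=> wi w0 le0; have mw := measurable_int _ wi.
have /(ae_eq_integral_abs P measurableT mw) : (\int[P]_z `|(w z)%:E| = 0)%E.
  rewrite (_ : (\int[P]_z `|(w z)%:E|)%E = (\int[P]_z (w z)%:E)%E); last first.
    by apply: eq_integral => z _; rewrite gee0_abs// lee_fin.
  apply/eqP; rewrite eq_le integral_ge0 ?andbT//; last by move=> z _; rewrite lee_fin.
  by rewrite -(fineK (integrable_fin_num measurableT wi)) lee_fin.
by apply: filterS => z /(_ I) [].
Qed.

Section RealIntegrals.
Context {d : measure_display} {T : measurableType d} {R : realType}.
Variable P : probability T R.
Implicit Types (f g : T -> R) (A : set T).

Lemma bounded_integrable f (M : R) : measurable_fun setT f ->
  (forall x, `|f x| <= M) -> P.-integrable setT (EFin \o f).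
Proof.
move=> mf fM; apply: measurable_bounded_integrable => //.
  by rewrite (le_lt_trans (probability_le1 P measurableT))// ltry.
exists M; split; rewrite ?num_real // => y My x _.
exact: le_trans (fM x) (ltW My).
Qed.

Lemma integrable_mul_bounded f g (M : R) : P.-integrable setT (EFin \o f) ->
  measurable_fun setT g -> (forall x, `|g x| <= M) ->
  P.-integrable setT (EFin \o (fun x => f x * g x)).
Proof.
move=> fi mg gM; apply: (integrableMl measurableT fi mg).
exists M; split; rewrite ?num_real // => y My x _.
exact: le_trans (gM x) (ltW My).
Qed.

Lemma integrable_le_norm f g : measurable_fun setT f ->
  P.-integrable setT (EFin \o g) -> (forall x, `|f x| <= `|g x|) ->
  P.-integrable setT (EFin \o f).
Proof.
move=> mf gi fg; apply: le_integrable gi => //; first exact/measurable_EFinP.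
by move=> x _; rewrite /= lee_fin fg.
Qed.

Lemma integrable_measurable f : P.-integrable setT (EFin \o f) ->
  measurable_fun setT f.
Proof. by move=> /measurable_int /measurable_EFinP. Qed.

Lemma ae_eq_Rintegral f g : measurable_fun setT f -> measurable_fun setT g ->
  {ae P, forall x, f x = g x} -> \int[P]_x f x = \int[P]_x g x.
Proof.
move=> mf mg fg; congr fine; apply: ae_eq_integral => //.
- exact/measurable_EFinP.
- exact/measurable_EFinP.
- by apply: filterS fg => x -> _.
Qed.

Lemma ae_full A : measurable A -> P A = 1%E -> {ae P, forall x, A x}.
Proof.
move=> mA PA; exists (~` A); split => //; first exact: measurableC.
by rewrite probability_setC// PA subee.
Qed.

Lemma full_subset A B : measurable A -> measurable B -> A `<=` B ->
  P A = 1%E -> P B = 1%E.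
Proof.
move=> mA mB AB PA; apply/eqP; rewrite eq_le probability_le1//= -PA.
by apply: le_measure => //; rewrite inE.
Qed.

Lemma Rintegral_full A f g : measurable A -> P A = 1%E -> measurable_fun setT g ->
  {in A, f =1 g} -> \int[P]_(x in A) f x = \int[P]_x g x.
Proof.
move=> mA PA mg fg; rewrite (eq_Rintegral _ fg) Rintegral_mkcond.
have mAg : measurable_fun setT (g \_ A).
  by apply/(measurable_restrictT g mA); exact: measurable_funTS.
apply: ae_eq_Rintegral => //; apply: filterS (ae_full mA PA) => x Ax.
by rewrite patchE mem_set.
Qed.

Lemma le_ae_Rintegral f g : P.-integrable setT (EFin \o f) ->
  P.-integrable setT (EFin \o g) -> {ae P, forall x, f x <= g x} ->
  \int[P]_x f x <= \int[P]_x g x.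
Proof.
move=> fi gi fg; have mf := integrable_measurable fi.
have mg := integrable_measurable gi.
have -> : \int[P]_x g x = \int[P]_x Num.max (f x) (g x).
  apply: ae_eq_Rintegral => //; first exact: measurable_maxr.
  by apply: filterS fg => x /max_r.
apply: le_Rintegral => //; last by move=> x _; rewrite le_max lexx.
apply: (@integrable_le_norm _ (fun x => `|f x| + `|g x|)).
- exact: measurable_maxr.
- have := integrableD measurableT (integrable_norm fi) (integrable_norm gi).
  by apply: eq_integrable.
- move=> x; rewrite (ger0_norm (addr_ge0 _ _))//.
  by rewrite /Num.max; case: ifP => _; rewrite ?lerDl ?lerDr normr_ge0.
Qed.

Lemma Rintegral_norm_le f (M : R) : measurable_fun setT f ->
  (forall x, `|f x| <= M) -> `|\int[P]_x f x| <= M.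
Proof.
move=> mf fM; have fi := bounded_integrable mf fM.
apply: (le_trans (le_normr_Rintegral measurableT fi)).
have -> : M = \int[P]_x (cst M x).
  by rewrite Rintegral_probability_cst.
apply: le_Rintegral => //=.
- exact: integrable_norm.
- by apply: finite_measure_integrable_cst.
Qed.

Lemma Rintegral_sum (I : Type) (r : seq I) (h : I -> T -> R) :
  (forall i, P.-integrable setT (EFin \o h i)) ->
  \int[P]_x (\sum_(i <- r) h i x) = \sum_(i <- r) \int[P]_x h i x.
Proof.
move=> hi; elim: r => [|i r IH].
  under eq_Rintegral do rewrite big_nil.
  by rewrite big_nil Rintegral_cst// mul0r.
under eq_Rintegral do rewrite big_cons.
rewrite RintegralD ?big_cons ?IH//.
rewrite (_ : EFin \o _ = (fun x => \sum_(i <- r) (h i x)%:E)%E); last first.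
  by apply/funext => x /=; rewrite sumEFin.
by apply: integrable_sum => // k _; exact: hi.
Qed.

Lemma integrable_sumR (I : Type) (r : seq I) (h : I -> T -> R) :
  (forall i, P.-integrable setT (EFin \o h i)) ->
  P.-integrable setT (EFin \o (fun x => \sum_(i <- r) h i x)).
Proof.
move=> hi; rewrite (_ : EFin \o _ = (fun x => \sum_(i <- r) (h i x)%:E)%E).
  by apply: integrable_sum => // k _; exact: hi.
by apply/funext => x /=; rewrite sumEFin.
Qed.

Lemma Rintegral_cvg (f_ : (T -> R)^nat) f g :
  (forall n, measurable_fun setT (f_ n)) -> measurable_fun setT f ->
  P.-integrable setT (EFin \o g) ->
  (forall x, f_ n x @[n --> \oo] --> f x) ->
  (forall n, {ae P, forall x, `|f_ n x| <= g x}) ->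
  \int[P]_x f_ n x @[n --> \oo] --> \int[P]_x f x.
Proof.
move=> mf_ mf gi ff fg.
have [fi _ cv] := @dominated_convergence _ _ _ P setT measurableT
  (fun n => EFin \o f_ n) (EFin \o f) (EFin \o g)
  (fun n => (measurable_EFinP _ _).2 (mf_ n)) ((measurable_EFinP _ _).2 mf)
  (ltac:(apply: aeW => x _; apply: cvg_EFin; [exact: nearW|exact: ff]))
  gi (ltac:(apply/ae_foralln => n; apply: filterS (fg n) => x h _;
     rewrite /= lee_fin; exact: h)).
apply: fine_cvg.
by move: cv; rewrite /= fineK ?integrable_fin_num.
Qed.

End RealIntegrals.

Section MeasureTransforms.
Context {d d' : measure_display} {T : measurableType d} {T' : measurableType d'}.
Context {R : realType}.

Lemma measurable_le_natr (f g : T -> R) : measurable_fun setT f ->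
  measurable_fun setT g ->
  measurable_fun setT (fun x => (f x <= g x)%R%:R : R).
Proof.
move=> mf mg; have mfg := measurable_fun_ler mf mg.
have -> : (fun x => (f x <= g x)%R%:R : R) =
    \1_((fun x => f x <= g x) @^-1` [set true]).
  apply/funext => x; rewrite indicE; congr (_%:R)%R; congr nat_of_bool.
  by apply/idP/idP => [fg|]; [exact: mem_set|rewrite inE].
apply: measurable_indic; rewrite -[X in measurable X]setTI.
exact: mfg.
Qed.

Lemma Rintegral_distribution (P : probability T R) (X : {mfun T >-> T'})
    (f : T' -> R) : measurable_fun setT f ->
  P.-integrable setT (EFin \o (f \o X)) ->
  \int[distribution P X]_y f y = \int[P]_x f (X x).
Proof.
move=> mf fi; congr fine; rewrite integral_distribution//.
exact/measurable_EFinP.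
Qed.

Section Mixture.
Variables (P Q : probability T R) (e : R) (e01 : 0 <= e <= 1).

Let e0 : 0 <= e. Proof. by case/andP: e01. Qed.

Let e1 : 0 <= 1 - e. Proof. by case/andP: e01; rewrite subr_ge0. Qed.

Definition mixture := measure_add (mscale (NngNum e1) P) (mscale (NngNum e0) Q).

HB.instance Definition _ := Measure.on mixture.

Lemma mixtureE A : mixture A = ((1 - e)%:E * P A + e%:E * Q A)%E.
Proof. by rewrite /mixture measure_addE. Qed.

Let mixture_setT : mixture setT = 1%E.
Proof.
by rewrite mixtureE !probability_setT !mule1 -EFinD subrK.
Qed.

HB.instance Definition _ :=
  Measure_isProbability.Build _ _ _ mixture mixture_setT.

Let ge0_integral_mixture (f : T -> \bar R) : measurable_fun setT f ->
  (forall x, 0 <= f x)%E ->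
  (\int[mixture]_x f x = (1 - e)%:E * \int[P]_x f x + e%:E * \int[Q]_x f x)%E.
Proof.
by move=> mf f0; rewrite ge0_integral_measure_add// !ge0_integral_mscale.
Qed.

Lemma integrable_mixture (f : T -> R) : P.-integrable setT (EFin \o f) ->
  Q.-integrable setT (EFin \o f) -> mixture.-integrable setT (EFin \o f).
Proof.
move=> /integrableP[mf fP] /integrableP[_ fQ]; apply/integrableP; split => //.
rewrite ge0_integral_mixture//; last exact: measurableT_comp.
by rewrite lte_add_pinfty// lte_mul_pinfty.
Qed.

Lemma Rintegral_mixture (f : T -> R) : P.-integrable setT (EFin \o f) ->
  Q.-integrable setT (EFin \o f) ->
  \int[mixture]_x f x = (1 - e) * \int[P]_x f x + e * \int[Q]_x f x.
Proof.
move=> fP fQ; have fS := integrable_mixture fP fQ.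
have mf := measurable_int _ fP.
have mp := measurable_funepos mf; have mn := measurable_funeneg mf.
apply: EFin_inj; rewrite EFinD !EFinM /Rintegral !fineK ?integrable_fin_num//.
rewrite integralE [in RHS]integralE [X in (_ + _ * X)%E]integralE.
rewrite !ge0_integral_mixture//.
have := integrable_pos_fin_num measurableT fP.
have := integrable_neg_fin_num measurableT fP.
have := integrable_pos_fin_num measurableT fQ.
have := integrable_neg_fin_num measurableT fQ.
do 4 (move=> /fineK <-).
rewrite -?EFinM -?EFinN -?EFinD -?EFinN -?EFinM -?EFinD; congr EFin; ring.
Qed.

End Mixture.

End MeasureTransforms.

Section FubiniThreshold.
Context {d : measure_display} {T : measurableType d} {R : realType}.
Variables (P : probability T R) (Q : probability (borelR R) R).

Lemma Fubini_threshold (pr : T -> borelR R) (r : T -> R) (w : borelR R -> R) :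
  measurable_fun setT pr -> P.-integrable setT (EFin \o r) ->
  Q.-integrable setT (EFin \o w) ->
  \int[Q]_s (w s * \int[P]_p ((pr p <= s)%R%:R * r p)) =
  \int[P]_p (r p * \int[Q]_s ((pr p <= s)%R%:R * w s)).
Proof.
move=> mpr ri wi.
have mr := integrable_measurable ri; have mw := integrable_measurable wi.
pose k (sp : borelR R * T) : R := (pr sp.2 <= sp.1)%R%:R.
have mk : measurable_fun setT k.
  by apply: measurable_le_natr => //; apply: measurableT_comp.
have k1 sp : `|k sp| <= 1 by rewrite /k; case: (pr _ <= _)%R; rewrite ?normr1 ?normr0.
pose F sp := w sp.1 * (k sp * r sp.2).
have mF : measurable_fun setT F.
  apply: measurable_funM; first exact: measurableT_comp.
  by apply: measurable_funM => //; exact: measurableT_comp.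
have kr s : P.-integrable setT (EFin \o (fun p => k (s, p) * r p)).
  apply: integrable_le_norm ri _.
    by apply: measurable_funM => //; exact: measurableT_comp mk _.
  by move=> p; rewrite normrM ler_piMl.
have kw p : Q.-integrable setT (EFin \o (fun s => k (s, p) * w s)).
  apply: integrable_le_norm wi _.
    by apply: measurable_funM => //; exact: measurableT_comp mk _.
  by move=> s; rewrite normrM ler_piMl.
have mFs s : measurable_fun setT (fun p => F (s, p)).
  exact: measurableT_comp mF _.
have Fi : (Q \x P)%E.-integrable setT (EFin \o F).
  apply/integrable12ltyP; first exact/measurable_EFinP.
  apply: (@le_lt_trans _ _ (\int[Q]_s (`|w s|%:E * \int[P]_p `|r p|%:E))%E).
    apply: ge0_le_integral => //.
    - by move=> s _; exact: integral_ge0.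
    - apply: (@measurable_fun_fubini_tonelli_F _ _ _ _ _ P (fun z => `|(EFin \o F) z|%E)) => //.
      by apply: measurableT_comp => //; exact/measurable_EFinP.
    - apply: emeasurable_funM => //; apply/measurable_EFinP.
      exact: measurableT_comp.
    - move=> s _; rewrite -ge0_integralZl//; last first.
        by apply/measurable_EFinP; exact: measurableT_comp.
      apply: ge0_le_integral => //.
      + by apply: measurableT_comp => //; exact/measurable_EFinP.
      + by apply: emeasurable_funM => //; apply/measurable_EFinP; exact: measurableT_comp.
      + move=> p _; rewrite /F /= lee_fin !normrM ler_wpM2l// ler_piMl//.
  have := integrable_abse ri; have := integrable_abse wi.
  move=> /(integrable_fin_num measurableT)/= wf /(integrable_fin_num measurableT)/= rf.
  rewrite ge0_integralZr//; last 2 first.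
    - by apply/measurable_EFinP; exact: measurableT_comp.
    - exact: integral_ge0.
  by rewrite ltey_eq fin_numM.
have := Fubini Fi; rewrite /Rintegral => E.
congr fine; transitivity (\int[Q]_x \int[P]_y (EFin \o F) (x, y))%E.
  apply: eq_integral => s _; rewrite EFinM fineK; last exact: integrable_fin_num (kr s).
  rewrite -[LHS](integralZl measurableT (kr s)).
  by apply: eq_integral => p _; rewrite /F /= EFinM.
rewrite E; apply: eq_integral => p _.
rewrite EFinM fineK; last exact: integrable_fin_num (kw p).
rewrite -[RHS](integralZl measurableT (kw p)).
apply: eq_integral => s _; rewrite /F /= -EFinM.
by congr EFin; ring.
Qed.

End FubiniThreshold.

Section Clamp.
Context {R : realType}.
Implicit Types r s t : R.

(* Composing with [clamp] and [clamp2], retractions of R onto [0,1] and of R^2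
   onto the triangle, makes continuous data given there global. *)
Definition clamp r : R := Num.max 0 (Num.min r 1).

Lemma clamp_I01 r : I01 (clamp r).
Proof.
by rewrite /I01 /= in_itv/= /clamp le_max lexx/= ge_max ler01/= ge_min lexx orbT.
Qed.

Lemma clamp_id r : I01 r -> clamp r = r.
Proof.
rewrite /I01/= in_itv/= => /andP[r0 r1].
by rewrite /clamp (min_idPl r1) (max_idPr r0).
Qed.

Lemma clampK r : clamp (clamp r) = clamp r.
Proof. exact: clamp_id (clamp_I01 r). Qed.

Lemma continuous_clamp : continuous clamp.
Proof.
move=> r; apply: (@continuous_max R R (fun=> 0) (fun r => Num.min r 1)).
  exact: cst_continuous.
by apply: (@continuous_min R R id (fun=> 1)) => //; exact: cst_continuous.
Qed.

Lemma measurable_clamp : measurable_fun setT (clamp : borelR R -> borelR R).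
Proof. by apply: continuous_measurable_fun; exact: continuous_clamp. Qed.

Definition clamp2 (p : R * R) : R * R := (clamp p.1, Num.min (clamp p.2) (clamp p.1)).

Lemma clamp2_triangle p : triangle (clamp2 p).
Proof.
have := clamp_I01 p.1; have := clamp_I01 p.2.
rewrite /triangle /sq01 /I01 /= !in_itv/= => /andP[a b] /andP[c e].
by rewrite c e le_min a c/= !ge_min b lexx !orbT.
Qed.

Lemma clamp2_id p : triangle p -> clamp2 p = p.
Proof.
case: p => t s [[/= t01 s01] st].
by rewrite /clamp2/= !clamp_id// (min_idPl st).
Qed.

Lemma continuous_clamp2 : continuous clamp2.
Proof.
move=> p; have c1 : {for p, continuous (fun p : R * R => clamp p.1)}.
  by apply: continuous_comp; [exact: cvg_fst|exact: continuous_clamp].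
have c2 : {for p, continuous (fun p : R * R => clamp p.2)}.
  by apply: continuous_comp; [exact: cvg_snd|exact: continuous_clamp].
apply: (@cvg_pair _ _ _ _ (nbhs (clamp p.1)) (nbhs (Num.min (clamp p.2) (clamp p.1))) _ _ _ _ _ c1).
exact: (@continuous_min R _ (fun p : R * R => clamp p.2) (fun p => clamp p.1)).
Qed.

End Clamp.

Lemma continuous_within_comp (X Y Z : topologicalType) (A : set Y) (f : Y -> Z)
    (r : X -> Y) : {within A, continuous f} -> (forall x, A (r x)) ->
  continuous r -> continuous (f \o r).
Proof.
move=> /subspace_continuousP cf rA cr x U fU.
have := cf _ (rA x) _ fU; rewrite /within /= => fU'.
have := cr x _ fU'; rewrite /nbhs/=.
by apply: filterS => z /= /(_ (rA z)).
Qed.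

Section ContinuousPlane.
Context {R : realType}.

Lemma open_prod_measurable (U : set (R * R)) : open U ->
  measurable (U : set (borelR2 R)).
Proof.
move=> oU.
pose B (q : rat * rat * (rat * rat)) : set (borelR2 R) :=
  `]ratr q.1.1, ratr q.1.2[%classic `*` `]ratr q.2.1, ratr q.2.2[%classic.
have -> : (U : set (borelR2 R)) = \bigcup_(q in [set q | B q `<=` U]) B q.
  apply/seteqP; split => [[t s] Uts|p [q /= + Bqp]]; last exact.
  have := (open_nbhs_nbhs (conj oU Uts)).
  move=> [[V W] /= [Vt Ws] VW].
  have {Vt}[a [b [/andP[at_ tb] abV]]] : exists a b : rat, (ratr a < t < ratr b) /\
      (`]ratr a, ratr b[%classic : set R) `<=` V.
    move: Vt => /nbhs_ballP[e /= e0 eV].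
    have [|a] := @rat_in_itvoo R (t - e) t; first by rewrite ltrBlDr ltrDl.
    have [|b] := @rat_in_itvoo R t (t + e); first by rewrite ltrDl.
    rewrite !in_itv/= => /andP[b1 b2] /andP[a1 a2].
    exists a, b; split; first by rewrite a2.
    move=> z /=; rewrite in_itv/= => /andP[z1 z2]; apply: eV.
    by rewrite /ball/= ltr_distlC; apply/andP; split; lra.
  have {Ws}[a' [b' [/andP[as_ sb] abW]]] : exists a b : rat, (ratr a < s < ratr b) /\
      (`]ratr a, ratr b[%classic : set R) `<=` W.
    move: Ws => /nbhs_ballP[e /= e0 eV].
    have [|a'] := @rat_in_itvoo R (s - e) s; first by rewrite ltrBlDr ltrDl.
    have [|b'] := @rat_in_itvoo R s (s + e); first by rewrite ltrDl.
    rewrite !in_itv/= => /andP[b1 b2] /andP[a1 a2].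
    exists a', b'; split; first by rewrite a2.
    move=> z /=; rewrite in_itv/= => /andP[z1 z2]; apply: eV.
    by rewrite /ball/= ltr_distlC; apply/andP; split; lra.
  exists ((a, b), (a', b')); last by rewrite /B; split; rewrite /= in_itv/=; apply/andP.
  by move=> [z w] [/= Bz Bw]; apply: VW; split; [exact: abV|exact: abW].
rewrite bigcup_mkcond; apply: countable_bigcupT_measurable => //.
move=> q; case: ifPn => // _; apply: measurableX; exact: measurable_itv.
Qed.

Lemma continuous_measurable_plane (F : R * R -> R) : continuous F ->
  measurable_fun setT (F : borelR2 R -> R).
Proof.
move=> /continuousP cF; apply: measurability; first exact: (RGenOpens.measurableE R).
move=> _ [_ [a [b ->] <-]]; rewrite setTI; apply: open_prod_measurable.
by apply: cF; exact: interval_open.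
Qed.

Lemma continuous_clamp_bounded (F : R -> R) : continuous F ->
  exists2 M, 0 <= M & forall r, `|F (clamp r)| <= M.
Proof.
move=> cF; have /compact_bounded[M [_ /(_ (`|M| + 1))]] : compact (F @` (@I01 R)).
  apply: continuous_compact; last exact: segment_compact.
  exact: continuous_subspaceT.
rewrite (le_lt_trans (ler_norm M)) ?ltrDl// => /(_ isT) MF.
exists (`|M| + 1); first by rewrite addr_ge0.
by move=> r; apply: MF => /=; exists (clamp r) => //; exact: clamp_I01.
Qed.

Lemma continuous_sq01_bounded (F : R * R -> R) : continuous F ->
  exists2 M, 0 <= M & forall p, sq01 p -> `|F p| <= M.
Proof.
move=> cF; have /compact_bounded[M [_ /(_ (`|M| + 1))]] : compact (F @` (@sq01 R)).
  apply: continuous_compact; last by apply: compact_setX; exact: segment_compact.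
  exact: continuous_subspaceT.
rewrite (le_lt_trans (ler_norm M)) ?ltrDl// => /(_ isT) MF.
exists (`|M| + 1); first by rewrite addr_ge0.
by move=> p p01; apply: MF => /=; exists p.
Qed.

End ContinuousPlane.

(** * Plans and their disintegrations *)

Section Marginals.
Context {R : realType}.
Local Notation mu := (@lebesgue_measure R).

Lemma measurable_I01 : measurable (@I01 R : set (borelR R)).
Proof. exact: measurable_itv. Qed.

Lemma lebesgue_I01 : (mu (@I01 R) < +oo)%E.
Proof. by rewrite lebesgue_measure_itv/= lte_fin ltr01 -EFinD ltry. Qed.

Lemma measurable_sq01 : measurable (@sq01 R : set (borelR2 R)).
Proof. by apply: measurableX; exact: measurable_I01. Qed.

Lemma measurable_triangle : measurable (@triangle R : set (borelR2 R)).
Proof.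
have -> : @triangle R = @sq01 R `&` ((fun p : borelR2 R => p.2 <= p.1) @^-1` [set true]).
  by apply/seteqP; split => p.
apply: measurableI; first exact: measurable_sq01.
rewrite -[X in measurable X]setTI.
by apply: (measurable_fun_ler (measurable_snd) (measurable_fst)).
Qed.

Lemma ge0_integral_mrestr (m : {measure set (borelR R) -> \bar R}) (D : set (borelR R))
    (mD : measurable D) (f : R -> \bar R) :
  measurable_fun setT (f : borelR R -> \bar R) -> (forall t, 0 <= f t)%E ->
  (\int[mrestr m mD]_t f t = \int[m]_(t in D) f t)%E.
Proof.
move=> mf f0; rewrite -(setUv D) ge0_integral_setU//=; last 3 first.
- exact: measurableC.
- exact: measurable_funTS.
- by apply/disj_setPS => x [].
rewrite [X in (_ + X)%E](_ : _ = 0)%E ?adde0.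
  by apply: eq_measure_integral => A mA AD; congr (m _); exact/setIidPl.
apply: null_set_integral => //; [exact: measurableC|exact: measurable_funTS|].
by change (m (~` D `&` D) = 0%E); rewrite setICl measure0.
Qed.

Lemma measurable_preimage_fst (A : set (borelR R)) : measurable A ->
  measurable ([set p | A p.1] : set (borelR2 R)).
Proof.
move=> mA; have := @measurable_fst _ _ (borelR R) (borelR R) measurableT _ mA.
by rewrite setTI.
Qed.

Lemma measurable_preimage_snd (A : set (borelR R)) : measurable A ->
  measurable ([set p | A p.2] : set (borelR2 R)).
Proof.
move=> mA; have := @measurable_snd _ _ (borelR R) (borelR R) measurableT _ mA.
by rewrite setTI.
Qed.

Variables (gamma : probability (borelR2 R) R) (gammaP : Gamma gamma).

Lemma Gamma_ae_triangle : {ae gamma, forall p, triangle p}.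
Proof. by apply: ae_full; [exact: measurable_triangle|exact: gammaP.1]. Qed.

Lemma Gamma_sq01 : gamma (@sq01 R) = 1%E.
Proof.
apply: (full_subset measurable_triangle measurable_sq01) gammaP.1.
by move=> p [].
Qed.

Lemma ge0_integral_marginal1 (f : R -> \bar R) :
  measurable_fun setT (f : borelR R -> \bar R) -> (forall t, 0 <= f t)%E ->
  (\int[gamma]_p f p.1 = \int[mu]_(t in I01) f t)%E.
Proof.
move=> mf f0.
have <- : (\int[marginal1 gamma]_t f t = \int[gamma]_p f p.1)%E.
  exact: (ge0_integral_distribution (P := gamma) _ mf f0).
rewrite -(@ge0_integral_mrestr mu _ measurable_I01)//.
by apply: eq_measure_integral => A mA _; exact: gammaP.2.
Qed.

Lemma integrable_marginal1 (a : R -> R) :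
  measurable_fun setT (a : borelR R -> R) -> mu.-integrable I01 (EFin \o a) ->
  gamma.-integrable setT (EFin \o (fun p => a p.1)).
Proof.
move=> ma /integrableP[_ ai]; apply/integrableP; split.
  by apply/measurable_EFinP; exact: measurableT_comp ma _.
rewrite (@ge0_integral_marginal1 (fun t => `|(a t)%:E|%E))//.
by apply: measurableT_comp => //; exact/measurable_EFinP.
Qed.

Lemma Rintegral_marginal1 (a : R -> R) :
  measurable_fun setT (a : borelR R -> R) ->
  \int[gamma]_p a p.1 = \int[mu]_(t in I01) a t.
Proof.
move=> ma; have mea := (measurable_EFinP setT (a : borelR R -> R)).2 ma.
congr fine; rewrite integralE [RHS]integralE.
congr (_ - _)%E.
- transitivity (\int[gamma]_p ((EFin \o a)^\+ (p : borelR2 R).1))%E.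
    by apply: eq_integral => p _; rewrite !funeposE.
  by rewrite (ge0_integral_marginal1 (measurable_funepos mea)).
- transitivity (\int[gamma]_p ((EFin \o a)^\- (p : borelR2 R).1))%E.
    by apply: eq_integral => p _; rewrite !funenegE.
  by rewrite (ge0_integral_marginal1 (measurable_funeneg mea)).
Qed.

Lemma marginal1_ae (Q : R -> Prop) : {ae mu, forall t, t \in I01 -> Q t} ->
  {ae gamma, forall p, Q p.1}.
Proof.
move=> [N [mN N0 QN]]; exists ([set p | N p.1] `|` ~` triangle); split.
- apply: measurableU; last by apply: measurableC; exact: measurable_triangle.
  exact: measurable_preimage_fst.
- apply: null_set_setU.
  + exact: measurable_preimage_fst.
  + by apply: measurableC; exact: measurable_triangle.
  + change (marginal1 gamma N = 0%E); rewrite gammaP.2//.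
    apply/eqP; rewrite -measure_le0 -N0; apply: le_measure; rewrite ?inE//.
    by apply: measurableI => //; exact: measurable_I01.
  + by have := probability_setC gamma measurable_triangle; rewrite gammaP.1 subee.
- move=> p /= nQ; have [pT|] := pselect (triangle p); last by right.
  left; apply: QN => /= /(_ (mem_set pT.1.1)); exact: nQ.
Qed.

Lemma marginal2_I01 : marginal2 gamma (@I01 R) = 1%E.
Proof.
apply: (full_subset measurable_triangle (measurable_preimage_snd measurable_I01)) gammaP.1.
by move=> p [[]].
Qed.

End Marginals.

Section Ramp.
Context {R : realType}.
Implicit Types a s : R.

Definition ramp (a : R) (n : nat) s : R := clamp (1 + n%:R * (s - a)).

Lemma continuous_ramp a n : continuous (ramp a n).
Proof.
have c : continuous (fun s : R => 1 + n%:R * (s - a)).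
  move=> s; apply: cvgD; first exact: cvg_cst.
  by apply: cvgM; [exact: cvg_cst|apply: cvgB; [exact: cvg_id|exact: cvg_cst]].
move=> s; exact: (continuous_comp (c s) (@continuous_clamp R _)).
Qed.

Lemma ramp_bounded a n s : `|ramp a n s| <= 1.
Proof.
have := clamp_I01 (1 + n%:R * (s - a)); rewrite /I01 /= in_itv/= => /andP[r0 r1].
by rewrite ger0_norm.
Qed.

Lemma ramp_cvg a s : ramp a n s @[n --> \oo] --> (\1_(`[a, +oo[) s : R).
Proof.
rewrite indicE; have [as_|sa] := leP a s.
  rewrite mem_set/= ?in_itv/= ?as_//; apply: cvg_near_cst; apply: nearW => n.
   rewrite /ramp /clamp (min_idPr _) ?max_r//.
  by rewrite lerDl mulr_ge0// subr_ge0.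
rewrite memNset/= ?in_itv/= ?andbT; last by apply/negP; rewrite -ltNge.
have [N _ NP] : \forall n \near \oo, (a - s)^-1 <= n%:R :> R by exact: nbhs_infty_ger.
apply: cvg_near_cst; exists N => // n Nn; have := NP n Nn => /= h.
rewrite /ramp /clamp (max_idPl _)// ge_min; apply/orP; left.
have as0 : 0 < a - s by rewrite subr_gt0.
have : 1 <= n%:R * (a - s) by rewrite -ler_pdivrMr// mul1r.
by rewrite mulrBr mulrBr; lra.
Qed.

End Ramp.

Section Families.
Context {R : realType}.
Variables (nu : R -> probability (borelR R) R).

Definition restr01 (t : borelR R) : set (borelR R) -> \bar R := mrestr (nu (clamp t)) measurable_I01.

HB.instance Definition _ t := Measure.on (restr01 t).

Let restr01_setT t : (restr01 t setT <= 1)%E.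
Proof.
rewrite /restr01 /mrestr setTI; apply: probability_le1; exact: measurable_I01.
Qed.

HB.instance Definition _ t :=
  Measure_isSubProbability.Build _ _ _ (restr01 t) (restr01_setT t).

Hypothesis nuB : borel_family nu.

Let measurable_fam (phi : R -> R) : continuous phi ->
  measurable_fun setT (fun t : borelR R => \int[nu (clamp t)]_(s in I01) phi s).
Proof.
move=> cphi.
have := nuB (continuous_subspaceT cphi) => mphi.
apply: (measurable_comp measurable_I01 _ mphi measurable_clamp).
by move=> _ [t _ <-]; exact: clamp_I01.
Qed.

Lemma measurable_restr01 U : measurable U -> measurable_fun setT (restr01 ^~ U).
Proof.
move=> mU.
have mE : @measurable _ (borelR R) = <<s @RGenCInfty.G R >>.
  exact: RGenCInfty.measurableE.
have fin t V : measurable V -> (restr01 t V) = (fine (restr01 t V))%:E.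
  by move=> mV; rewrite fineK//; apply: fin_num_measure.
have mT : measurable_fun setT (restr01 ^~ setT).
  rewrite (_ : restr01 ^~ setT = (fun t => (\int[nu (clamp t)]_(s in I01) cst 1 s)%:E)).
    by apply/measurable_EFinP; apply: measurable_fam => ?; exact: cvg_cst.
  apply/funext => t; rewrite Rintegral_cst ?mul1r; last exact: measurable_I01.
  by rewrite /restr01 /mrestr setTI fineK// fin_num_measure//; exact: measurable_I01.
move: (mU); rewrite mE; apply: (@dynkin_induction _ _ (@RGenCInfty.G R)
  (fun U => measurable_fun setT (restr01 ^~ U)) mE) => //.
- move=> A B [a ->] [b ->]; exists (Num.max a b).
  apply/seteqP; split => z /=; rewrite !in_itv/= !andbT ge_max.
    by case=> -> ->.
  by case/andP.
- move=> _ [a ->].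
  rewrite (_ : restr01 ^~ _ = (fun t => (fine (restr01 t `[a, +oo[%classic))%:E)); last first.
    by apply/funext => t; apply: fin; exact: measurable_itv.
  apply/measurable_EFinP.
  apply: (measurable_fun_cvg (fun n => measurable_fam (@continuous_ramp R a n))) => t _.
  rewrite (_ : fine _ = \int[nu (clamp t)]_s ((\1_(`[a, +oo[) : R -> R) \_ I01) s); last first.
    rewrite -Rintegral_mkcond /Rintegral integral_indic//; exact: measurable_I01.
  under eq_fun do rewrite Rintegral_mkcond.
  apply: (@Rintegral_cvg _ _ _ _ _ _ (cst 1)).
  + move=> n; apply/(measurable_restrictT _ measurable_I01).
    apply: measurable_funTS; apply: continuous_measurable_fun; exact: continuous_ramp.
  + apply/(measurable_restrictT _ measurable_I01).
    by apply: measurable_funTS; apply: measurable_indic; exact: measurable_itv.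
  + by apply: finite_measure_integrable_cst.
  + move=> s; rewrite patchE; under eq_fun do rewrite patchE.
    by case: ifP => _; [exact: ramp_cvg|exact: cvg_cst].
  + move=> n; apply: aeW => s; rewrite patchE; case: ifP => _; rewrite ?normr0//.
    exact: ramp_bounded.
- move=> S mS mrS.
  rewrite (_ : restr01 ^~ _ = (fun t => restr01 t setT - restr01 t S)%E); last first.
    apply/funext => t; rewrite -setTD measureD// ?setTI//.
    by rewrite ltey_eq fin_num_measure.
  exact: emeasurable_funB.
- move=> F mF tF mrF.
  rewrite (_ : restr01 ^~ _ = (fun t => \sum_(k <oo) restr01 t (F k))%E); last first.
    apply/funext => t; apply/esym/cvg_lim => //.
    exact: (@measure_sigma_additive _ _ _ (restr01 t)).
  exact: ge0_emeasurable_sum.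
Qed.

Lemma measurable_family_Rintegral (phi : R * R -> R) :
  measurable_fun setT (phi : borelR2 R -> R) ->
  measurable_fun setT
    (fun t : borelR R => \int[nu (clamp t)]_(s in I01) phi (t, s)).
Proof.
move=> mphi.
pose l0 := fun t : borelR R => (restr01 t : {measure set (borelR R) -> \bar R}).
have l1 : measure_fam_uub l0.
  exists 2 => t; apply: (@le_lt_trans _ _ 1%E); first exact: restr01_setT.
  by rewrite lte_fin ltr1n.
pose l2 : R.-ker (borelR R) ~> (borelR R) := HB.pack l0 (@isKernel.Build _ _ _ _ _ l0 measurable_restr01).
pose l : R.-fker (borelR R) ~> (borelR R) := HB.pack l0 l2 (Kernel_isFinite.Build _ _ _ _ _ l2 l1).
have mphi' := (measurable_EFinP setT (phi : borelR2 R -> R)).2 mphi.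
have H (k : borelR2 R -> \bar R) : (forall z, 0 <= k z)%E -> measurable_fun setT k ->
    measurable_fun setT (fun t : borelR R => (\int[nu (clamp t)]_(s in I01) k (t, s))%E).
  move=> k0 mk; have := measurable_fun_integral_finite_kernel _ l k0 mk.
  apply: eq_measurable_fun => t _; apply: (@ge0_integral_mrestr _ (nu (clamp t)) I01 measurable_I01 (fun s => k (t, s))) => //.
  exact: measurableT_comp mk _.
rewrite /Rintegral; apply: (measurableT_comp (@fine_measurable R setT measurableT)).
under eq_fun do rewrite integralE.
apply: emeasurable_funB.
- have := H _ (funepos_ge0 _) (measurable_funepos mphi').
  apply: eq_measurable_fun => t _; apply: eq_integral => s _.
  by rewrite !funeposE.
- have := H _ (funeneg_ge0 _) (measurable_funeneg mphi').
  apply: eq_measurable_fun => t _; apply: eq_integral => s _.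
  by rewrite !funenegE.
Qed.

End Families.

Definition fiber_mean {R : realType} (nu : R -> probability (borelR R) R)
  (phi : R * R -> R) (t : R) : R := \int[nu (clamp t)]_(s in I01) phi (t, s).

Lemma Rintegral_mul_cvg {d} {T : measurableType d} {R : realType}
    (P : probability T R) (a : T -> R) (a_ : nat -> T -> R) (b : T -> R) (M : R) :
  P.-integrable setT (EFin \o a) -> (forall n, P.-integrable setT (EFin \o a_ n)) ->
  measurable_fun setT b -> (forall x, `|b x| <= M) ->
  (\int[P]_x `|(a x - a_ n x)%:E|)%E @[n --> \oo] --> 0%E ->
  \int[P]_x (a_ n x * b x) @[n --> \oo] --> \int[P]_x (a x * b x).
Proof.
move=> ai ai_ mb bM cv.
have M0 : 0 <= M by exact: le_trans (normr_ge0 (b point)) (bM point).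
have di n : P.-integrable setT (EFin \o (fun x => a x - a_ n x)).
  by have := integrableB measurableT ai (ai_ n); apply: eq_integrable.
have cv' : (M * \int[P]_x `|a x - a_ n x|) @[n --> \oo] --> (0 : R).
  rewrite -[X in _ --> X](mulr0 M); apply: cvgMr.
  by apply: fine_cvg; exact: cv.
have bnd n : `|\int[P]_x (a x * b x) - \int[P]_x (a_ n x * b x)| <=
    M * \int[P]_x `|a x - a_ n x|.
  rewrite -RintegralB//; last 2 first.
  - exact: integrable_mul_bounded ai mb bM.
  - exact: integrable_mul_bounded (ai_ n) mb bM.
  have mi : P.-integrable setT (EFin \o (fun x => (a x - a_ n x) * b x)).
    exact: integrable_mul_bounded (di n) mb bM.
  under eq_Rintegral do rewrite -mulrBl.
  apply: (le_trans (le_normr_Rintegral measurableT mi)).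
  rewrite -RintegralZl//; last exact: integrable_norm (di n).
  apply: le_Rintegral => //; first exact: integrable_norm mi.
    have := integrableZl measurableT M (integrable_norm (di n)).
    by apply: eq_integrable.
  by move=> x _; rewrite normrM mulrC ler_wpM2r.
apply/cvgrPdist_le => e e0.
have /cvgrPdist_le/(_ e e0) := cv'; apply: filterS => n.
rewrite sub0r normrN => h; apply: le_trans (bnd n) _.
exact: le_trans (ler_norm _) h.
Qed.

Section Disintegration1.
Context {R : realType}.
Local Notation mu := (@lebesgue_measure R).
Variables (gamma : probability (borelR2 R) R) (gammaP : Gamma gamma).
Variables (nu : R -> probability (borelR R) R) (nuP : disintegration1 gamma nu).

Lemma disintegration1_I01 t : I01 t -> nu t (@I01 R) = 1%E.
Proof.
move=> It; have [_ /(_ t (mem_set It)) nut _] := nuP.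
apply: (full_subset _ measurable_I01 _ nut); first exact: measurable_itv.
move: It; rewrite /I01 => /=; rewrite in_itv/= => /andP[t0 t1] s /=.
by rewrite !in_itv/= => /andP[-> /le_trans->].
Qed.

Lemma fiber_meanE (phi : R * R -> R) t :
  measurable_fun setT (phi : borelR2 R -> R) -> I01 t ->
  fiber_mean nu phi t = \int[nu t]_s phi (t, s).
Proof.
move=> mphi It; rewrite /fiber_mean clamp_id//.
apply: Rintegral_full => //; first exact: measurable_I01.
  exact: disintegration1_I01.
exact: measurableT_comp mphi _.
Qed.

Lemma fiber_mean_bounded (phi : R * R -> R) M t :
  measurable_fun setT (phi : borelR2 R -> R) -> (forall p, `|phi p| <= M) ->
  `|fiber_mean nu phi t| <= M.
Proof.
move=> mphi phiM; rewrite /fiber_mean.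
have mphit : measurable_fun setT (fun s : borelR R => phi (t, s)).
  exact: measurableT_comp mphi _.
rewrite (Rintegral_full measurable_I01 (disintegration1_I01 (clamp_I01 t)) mphit)//.
exact: Rintegral_norm_le.
Qed.

Lemma measurable_fiber_mean (phi : R * R -> R) :
  measurable_fun setT (phi : borelR2 R -> R) ->
  measurable_fun setT (fiber_mean nu phi : borelR R -> R).
Proof. by have [nuB _ _] := nuP => mphi; exact: measurable_family_Rintegral. Qed.

Lemma Rintegral_disintegration1 (phi : R * R -> R) : continuous phi ->
  \int[gamma]_p phi p = \int[gamma]_p fiber_mean nu phi p.1.
Proof.
move=> cphi; have mphi := continuous_measurable_plane cphi.
have [_ _ /(_ _ (continuous_subspaceT cphi)) nuE] := nuP.
rewrite (Rintegral_marginal1 gammaP); last exact: measurable_fiber_mean.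
have <- := @Rintegral_full _ _ _ gamma sq01 phi phi measurable_sq01
  (Gamma_sq01 gammaP) mphi (fun _ _ => erefl).
rewrite nuE; apply: eq_Rintegral => t /set_mem It.
by rewrite /fiber_mean clamp_id.
Qed.

Lemma Rintegral_disintegration1_mul (a : R -> R) (phi : R * R -> R) M :
  measurable_fun setT (a : borelR R -> R) -> mu.-integrable I01 (EFin \o a) ->
  continuous phi -> (forall p, `|phi p| <= M) ->
  \int[gamma]_p (a p.1 * phi p) = \int[gamma]_p (a p.1 * fiber_mean nu phi p.1).
Proof.
move=> ma ai cphi phiM; have mphi := continuous_measurable_plane cphi.
have mm := measurable_fiber_mean mphi.
have mM t := fiber_mean_bounded t mphi phiM.
have mm1 : measurable_fun setT (fun p : borelR2 R => fiber_mean nu phi p.1).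
  exact: measurableT_comp mm _.
have aiG := integrable_marginal1 gammaP ma ai.
have [a_ [ca_ ai_ cv]] := approximation_continuous_integrable measurable_I01 lebesgue_I01 ai.
have ma_ n : measurable_fun setT (a_ n : borelR R -> R).
  exact: continuous_measurable_fun.
have aiG_ n := integrable_marginal1 gammaP (ma_ n) (ai_ n).
have cva : (\int[gamma]_p `|(a p.1 - a_ n p.1)%:E|)%E @[n --> \oo] --> 0%E.
  rewrite (_ : (fun n => _) = (fun n => \int[mu]_(z in I01) `|(a z - a_ n z)%:E|)%E)//.
  apply/funext => n.
  rewrite (@ge0_integral_marginal1 _ _ gammaP (fun t => `|(a t - a_ n t)%:E|%E))//.
  by apply: measurableT_comp => //; apply/measurable_EFinP; exact: measurable_funB.
have c1 := @Rintegral_mul_cvg _ _ _ gamma (fun p => a p.1) (fun n p => a_ n p.1)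
  phi M aiG aiG_ mphi phiM cva.
have c2 := @Rintegral_mul_cvg _ _ _ gamma (fun p => a p.1) (fun n p => a_ n p.1)
  (fun p => fiber_mean nu phi p.1) M aiG aiG_ mm1 (fun p => mM p.1) cva.
apply: (cvg_unique _ c1) => //; apply: cvg_trans c2.
rewrite (_ : (fun n => \int[gamma]_p (a_ n p.1 * phi p)) =
  (fun n => \int[gamma]_p (a_ n p.1 * fiber_mean nu phi p.1)))//.
apply/funext => n.
rewrite (@Rintegral_disintegration1 (fun p => a_ n p.1 * phi p)); last first.
  move=> p; apply: cvgM; last exact: cphi.
  by apply: continuous_comp; [exact: cvg_fst|exact: ca_].
apply: ae_eq_Rintegral.
- apply: measurableT_comp; last exact: measurable_fst.
  apply: measurable_fiber_mean; apply: measurable_funM => //.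
  by apply: measurableT_comp (ma_ n) _; exact: measurable_fst.
- by apply: measurable_funM => //; exact: measurableT_comp (ma_ n) _.
- apply: ae_imp (Gamma_ae_triangle gammaP) => p [[It _] _].
  rewrite !fiber_meanE//=; last first.
    by apply: measurable_funM => //; apply: measurableT_comp (ma_ n) _; exact: measurable_fst.
  rewrite RintegralZl//; apply: bounded_integrable => //.
  exact: measurableT_comp mphi _.
Qed.

End Disintegration1.

Section Disintegration2.
Context {R : realType}.
Local Notation mu := (@lebesgue_measure R).
Variables (gamma : probability (borelR2 R) R) (gammaP : Gamma gamma).
Variables (nus : R -> probability (borelR R) R) (nusP : disintegration2 gamma nus).

Lemma Rintegral_disintegration2 (phi : R * R -> R) : continuous phi ->
  \int[gamma]_p phi p =
  \int[marginal2 gamma]_s \int[nus (clamp s)]_(t in I01) phi (t, s).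
Proof.
move=> cphi; have mphi := continuous_measurable_plane cphi.
have [nusB _ /(_ _ (continuous_subspaceT cphi)) nusE] := nusP.
have <- := @Rintegral_full _ _ _ gamma sq01 phi phi measurable_sq01
  (Gamma_sq01 gammaP) mphi (fun _ _ => erefl).
rewrite nusE; apply: Rintegral_full.
- exact: measurable_I01.
- exact: marginal2_I01.
- apply: (measurable_family_Rintegral nusB (phi := fun p => phi (p.2, p.1))).
  by apply: (measurableT_comp mphi); apply: measurable_fun_pair.
- by move=> s /set_mem Is; rewrite clamp_id.
Qed.

Let kernel : borelR R -> giry (borelR R) R := fun s => restr01 nus s.

Let measurable_kernel : measurable_fun setT kernel.
Proof.
apply: measurable_giry_codensity => // B mB.
by have [nusB _ _] := nusP; exact: measurable_restr01.
Qed.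

(* A disintegration is only tested against continuous functions. Ramps
   approximating half-lines identify the mixture of the [nus s] with the first
   marginal, which makes the fibers [nus s] usable for L^1 integrands. *)
Let mix : giry (borelR R) R := giry_bind (marginal2 gamma : giry _ _) measurable_kernel.

Let mixE (h : R -> \bar R) : measurable_fun setT (h : borelR R -> \bar R) ->
  (forall t, 0 <= h t)%E ->
  (\int[mix]_t h t =
   \int[marginal2 gamma]_s \int[nus (clamp s)]_(t in I01) h t)%E.
Proof.
move=> mh h0; have := giry_int_bind (marginal2 gamma : giry _ _) measurable_kernel mh h0.
rewrite /giry_int => ->; apply: eq_integral => s _.
exact: (@ge0_integral_mrestr _ (nus (clamp s)) I01 measurable_I01).
Qed.

Let mix_itv (a : R) : mix `[a, +oo[%classic = marginal1 gamma `[a, +oo[%classic.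
Proof.
have [nusB _ _] := nusP.
have mI : measurable (`[a, +oo[%classic : set (borelR R)) by exact: measurable_itv.
have minus (phi : R -> R) : measurable_fun setT (phi : borelR R -> R) ->
    measurable_fun setT (fun s : borelR R => \int[nus (clamp s)]_(t in I01) phi t).
  move=> mphi; apply: (measurable_family_Rintegral nusB (phi := fun p => phi p.2)).
  exact: measurableT_comp mphi _.
have mramp n : measurable_fun setT (ramp a n : borelR R -> R).
  by apply: continuous_measurable_fun; exact: continuous_ramp.
have m1I : measurable_fun setT (\1_(`[a, +oo[) : borelR R -> R).
  exact: measurable_indic.
have cvs s : \int[nus (clamp s)]_(t in I01) ramp a n t @[n --> \oo] -->
             \int[nus (clamp s)]_(t in I01) (\1_(`[a, +oo[) t : R).
  rewrite Rintegral_mkcond; under eq_fun do rewrite Rintegral_mkcond.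
  apply: (@Rintegral_cvg _ _ _ _ _ _ (cst 1)).
  - move=> n; apply/(measurable_restrictT _ measurable_I01).
    exact: measurable_funTS.
  - by apply/(measurable_restrictT _ measurable_I01); exact: measurable_funTS.
  - exact: finite_measure_integrable_cst.
  - move=> t; rewrite patchE; under eq_fun do rewrite patchE.
    by case: ifP => _; [exact: ramp_cvg|exact: cvg_cst].
  - move=> n; apply: aeW => t; rewrite patchE; case: ifP => _; rewrite ?normr0//.
    exact: ramp_bounded.
have cvL : \int[gamma]_p ramp a n p.1 @[n --> \oo] -->
           \int[gamma]_p (\1_(`[a, +oo[) p.1 : R).
  apply: (@Rintegral_cvg _ _ _ _ _ _ (cst 1)).
  - by move=> n; exact: measurableT_comp (mramp n) _.
  - exact: measurableT_comp m1I _.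
  - exact: finite_measure_integrable_cst.
  - by move=> p; exact: ramp_cvg.
  - by move=> n; apply: aeW => p; exact: ramp_bounded.
have cvR : \int[marginal2 gamma]_s \int[nus (clamp s)]_(t in I01) ramp a n t
    @[n --> \oo] -->
    \int[marginal2 gamma]_s \int[nus (clamp s)]_(t in I01) (\1_(`[a, +oo[) t : R).
  apply: (@Rintegral_cvg _ _ _ _ _ _ (cst 1)).
  - by move=> n; exact: minus.
  - exact: minus.
  - exact: finite_measure_integrable_cst.
  - exact: cvs.
  - move=> n; apply: aeW => s; rewrite Rintegral_mkcond; apply: Rintegral_norm_le.
      apply/(measurable_restrictT _ measurable_I01); exact: measurable_funTS.
    by move=> t; rewrite patchE; case: ifP => _; rewrite ?normr0// ramp_bounded.
have E : \int[gamma]_p (\1_(`[a, +oo[) p.1 : R) =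
    \int[marginal2 gamma]_s \int[nus (clamp s)]_(t in I01) (\1_(`[a, +oo[) t : R).
  apply: (cvg_unique _ cvL) => //; apply: cvg_trans cvR.
  rewrite (_ : (fun n => \int[gamma]_p ramp a n p.1) = (fun n =>
    \int[marginal2 gamma]_s \int[nus (clamp s)]_(t in I01) ramp a n t))//.
  apply/funext => n.
  rewrite (@Rintegral_disintegration2 (fun p => ramp a n p.1))// => p.
  by apply: continuous_comp; [exact: cvg_fst|exact: continuous_ramp].
have inner1 s : `|\int[nus (clamp s)]_(t in I01) (\1_(`[a, +oo[) t : R)| <= 1.
  rewrite Rintegral_mkcond; apply: Rintegral_norm_le.
    apply/(measurable_restrictT _ measurable_I01); exact: measurable_funTS.
  move=> t; rewrite patchE; case: ifP => _; rewrite ?normr0//.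
  by rewrite indicE; case: (_ \in _); rewrite ?normr1 ?normr0.
have inner s : (\int[nus (clamp s)]_(t in I01) (\1_(`[a, +oo[) t : R)%:E)%E =
    (\int[nus (clamp s)]_(t in I01) (\1_(`[a, +oo[) t : R))%:E.
  rewrite /Rintegral fineK// integral_indic//; last exact: measurable_I01.
  by apply: fin_num_measure; apply: measurableI => //; exact: measurable_I01.
have -> : mix `[a, +oo[%classic =
    (\int[marginal2 gamma]_s \int[nus (clamp s)]_(t in I01) (\1_(`[a, +oo[) t : R))%:E.
  rewrite -[X in mix X]setIT -integral_indic// mixE//; last exact/measurable_EFinP.
  under eq_integral do rewrite inner.
  rewrite /Rintegral fineK//; apply: integrable_fin_num => //.
  apply: (@bounded_integrable _ _ _ _ _ 1); first exact: minus.
  exact: inner1.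
rewrite -E /Rintegral fineK.
  have -> : (\int[gamma]_p (\1_(`[a, +oo[) p.1 : R)%:E =
      \int[gamma]_p (\1_[set p : borelR2 R | `[a, +oo[%classic p.1] p)%:E)%E.
    by apply: eq_integral => p _.
  by rewrite integral_indic ?setIT//; exact: measurable_preimage_fst.
apply: integrable_fin_num => //.
apply: (@bounded_integrable _ _ _ _ _ 1); first exact: measurableT_comp m1I _.
by move=> p; rewrite indicE; case: (_ \in _); rewrite ?normr1 ?normr0.
Qed.

Let mix_marginal1 B : measurable B -> mix B = marginal1 gamma B.
Proof.
have GI : setI_closed (@RGenCInfty.G R).
  move=> A C [a ->] [b ->]; exists (Num.max a b).
  apply/seteqP; split => z /=; rewrite !in_itv/= !andbT ge_max.
    by case=> -> ->.
  by case/andP.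
have Gg i : @RGenCInfty.G R `[- i%:R, +oo[%classic by exists (- i%:R).
have Gcover : \bigcup_i `[- i%:R, +oo[%classic = [set: R].
  apply/seteqP; split => // z _; exists (Num.truncn `|z|).+1 => //=.
  rewrite in_itv/= andbT lerNl; apply: le_trans (ltW (truncnS_gt _)).
  by rewrite -normrN ler_norm.
apply: (@measure_unique _ R (borelR R) _ _ (@RGenCInfty.measurableE R) GI Gg Gcover
  mix (marginal1 gamma)) => [A [a ->]|i]; first exact: mix_itv.
suff : (marginal1 gamma `[(- i%:R)%R, +oo[%classic < +oo)%E by rewrite -mix_itv.
apply: (le_lt_trans (probability_le1 _ _)); last exact: ltry.
exact: measurable_itv.
Qed.

Let ge0_integral_fibers (h : R -> \bar R) :
  measurable_fun setT (h : borelR R -> \bar R) -> (forall t, 0 <= h t)%E ->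
  (\int[marginal2 gamma]_s \int[nus (clamp s)]_(t in I01) h t =
   \int[mu]_(t in I01) h t)%E.
Proof.
move=> mh h0; rewrite -mixE// -(ge0_integral_marginal1 gammaP)//.
rewrite (_ : (\int[gamma]_p h p.1)%E = (\int[marginal1 gamma]_t h t)%E).
  by apply: eq_measure_integral => A mA _; exact: mix_marginal1.
by apply/esym; exact: (ge0_integral_distribution (P := gamma) _ mh h0).
Qed.

Definition fiber_mean2 (a : R -> R) (s : R) := \int[nus (clamp s)]_(t in I01) a t.

Lemma measurable_fiber_mean2 (a : R -> R) :
  measurable_fun setT (a : borelR R -> R) ->
  measurable_fun setT (fiber_mean2 a : borelR R -> R).
Proof.
have [nusB _ _] := nusP => ma.
apply: (measurable_family_Rintegral nusB (phi := fun p => a p.2)).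
exact: measurableT_comp ma _.
Qed.

Let norm_fiber_mean2 (a : R -> R) s : measurable_fun setT (a : borelR R -> R) ->
  (`|(fiber_mean2 a s)%:E| <= \int[nus (clamp s)]_(t in I01) `|(a t)%:E|)%E.
Proof.
move=> ma; rewrite /fiber_mean2 /Rintegral.
apply: (@le_trans _ _ (`|\int[nus (clamp s)]_(t in I01) (a t)%:E|)%E).
  by case: (\int[_]_(_ in _) _)%E => [r||]//=; rewrite ?normr0 ?leey.
apply: le_abse_integral; first exact: measurable_I01.
by apply/measurable_EFinP; exact: measurable_funTS.
Qed.

Let measurable_inner (a : R -> R) : measurable_fun setT (a : borelR R -> R) ->
  measurable_fun setT (fun s : borelR R => \int[nus (clamp s)]_(t in I01) `|(a t)%:E|)%E.
Proof.
move=> ma.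
have ma' : measurable_fun setT (fun t : borelR R => `|(a t)%:E|)%E.
  by apply: measurableT_comp => //; exact/measurable_EFinP.
have := measurableT_comp (measurable_giry_int ma' (fun t => abse_ge0 _)) measurable_kernel.
apply: eq_measurable_fun => s _ /=; rewrite /giry_int.
exact: (@ge0_integral_mrestr _ (nus (clamp s)) I01 measurable_I01 (fun t => `|(a t)%:E|)%E).
Qed.

Lemma integrable_fiber_mean2 (a : R -> R) :
  measurable_fun setT (a : borelR R -> R) -> mu.-integrable I01 (EFin \o a) ->
  (marginal2 gamma).-integrable setT (EFin \o fiber_mean2 a).
Proof.
move=> ma /integrableP[_ ai]; have mm := measurable_fiber_mean2 ma.
apply/integrableP; split; first exact/measurable_EFinP.
apply: le_lt_trans ai; rewrite -ge0_integral_fibers//; last first.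
  by apply: measurableT_comp => //; exact/measurable_EFinP.
apply: ge0_le_integral => //.
- by apply: measurableT_comp => //; exact/measurable_EFinP.
- exact: measurable_inner.
- by move=> s _; exact: norm_fiber_mean2.
Qed.

Lemma fiber_mean2B (a b : R -> R) :
  measurable_fun setT (a : borelR R -> R) -> mu.-integrable I01 (EFin \o a) ->
  measurable_fun setT (b : borelR R -> R) -> mu.-integrable I01 (EFin \o b) ->
  {ae marginal2 gamma, forall s,
    fiber_mean2 (fun t => a t - b t) s = fiber_mean2 a s - fiber_mean2 b s}.
Proof.
move=> ma ai mb bi.
have H (c : R -> R) : measurable_fun setT (c : borelR R -> R) ->
    mu.-integrable I01 (EFin \o c) ->
    {ae marginal2 gamma, forall s, (nus (clamp s)).-integrable I01 (EFin \o c)}.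
  move=> mc /integrableP[_ ci].
  have ii : (marginal2 gamma).-integrable setT
      (fun s => \int[nus (clamp s)]_(t in I01) `|(c t)%:E|)%E.
    apply/integrableP; split; first exact: measurable_inner.
    under eq_integral do rewrite gee0_abs ?integral_ge0//.
    rewrite ge0_integral_fibers//.
    by apply: measurableT_comp => //; exact/measurable_EFinP.
  apply: ae_imp (integrable_ae measurableT ii) => s /(_ I) h.
  apply/integrableP; split.
    by apply/measurable_EFinP; exact: measurable_funTS.
  by move: h; rewrite ge0_fin_numE// integral_ge0.
apply: ae_imp2 (H _ ma ai) (H _ mb bi) => s sa sb.
by rewrite /fiber_mean2 RintegralB//; exact: measurable_I01.
Qed.

Lemma Rintegral_disintegration2_mul (a b : R -> R) M :
  measurable_fun setT (a : borelR R -> R) -> mu.-integrable I01 (EFin \o a) ->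
  continuous b -> (forall s, `|b s| <= M) ->
  \int[gamma]_p (a p.1 * b p.2) = \int[marginal2 gamma]_s (fiber_mean2 a s * b s).
Proof.
move=> ma ai cb bM.
have mb : measurable_fun setT (b : borelR R -> R) by exact: continuous_measurable_fun.
have mb2 : measurable_fun setT (fun p : borelR2 R => b p.2).
  exact: measurableT_comp mb _.
have aiG := integrable_marginal1 gammaP ma ai.
have [a_ [ca_ ai_ cv]] := approximation_continuous_integrable measurable_I01 lebesgue_I01 ai.
have ma_ n : measurable_fun setT (a_ n : borelR R -> R).
  exact: continuous_measurable_fun.
have aiG_ n := integrable_marginal1 gammaP (ma_ n) (ai_ n).
have cva : (\int[gamma]_p `|(a p.1 - a_ n p.1)%:E|)%E @[n --> \oo] --> 0%E.
  rewrite (_ : (fun n => _) = (fun n => \int[mu]_(z in I01) `|(a z - a_ n z)%:E|)%E)//.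
  apply/funext => n.
  rewrite (@ge0_integral_marginal1 _ _ gammaP (fun t => `|(a t - a_ n t)%:E|%E))//.
  by apply: measurableT_comp => //; apply/measurable_EFinP; exact: measurable_funB.
have mab n : measurable_fun setT ((fun t => a t - a_ n t) : borelR R -> R).
  exact: measurable_funB.
have fai := integrable_fiber_mean2 ma ai.
have fai_ n := integrable_fiber_mean2 (ma_ n) (ai_ n).
have cvf : (\int[marginal2 gamma]_s
    `|(fiber_mean2 a s - fiber_mean2 (a_ n) s)%:E|)%E @[n --> \oo] --> 0%E.
  apply: (squeeze_cvge _ (cvg_cst 0%E) cv); apply: nearW => n.
  rewrite integral_ge0//= -ge0_integral_fibers//; last first.
    by apply/measurable_EFinP; exact: measurableT_comp.
  apply: (@le_trans _ _ (\int[marginal2 gamma]_s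
    `|(fiber_mean2 (fun t => a t - a_ n t) s)%:E|)%E).
    rewrite le_eqVlt; apply/orP; left; apply/eqP; apply: ae_eq_integral => //.
    - apply/measurable_EFinP; apply: measurableT_comp => //.
      by apply: measurable_funB; exact: measurable_fiber_mean2.
    - apply/measurable_EFinP; apply: measurableT_comp => //.
      exact: measurable_fiber_mean2.
    - by apply: ae_imp (fiber_mean2B ma ai (ma_ n) (ai_ n)) => s -> _.
  apply: ge0_le_integral => //.
  - apply/measurable_EFinP; apply: measurableT_comp => //.
    exact: measurable_fiber_mean2.
  - exact: measurable_inner.
  - by move=> s _; exact: norm_fiber_mean2.
have c1 := @Rintegral_mul_cvg _ _ _ gamma (fun p => a p.1) (fun n p => a_ n p.1)
  (fun p => b p.2) M aiG aiG_ mb2 (fun p => bM p.2) cva.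
have c2 := @Rintegral_mul_cvg _ _ _ (marginal2 gamma) (fiber_mean2 a)
  (fun n => fiber_mean2 (a_ n)) b M fai fai_ mb bM cvf.
apply: (cvg_unique _ c1) => //; apply: cvg_trans c2.
rewrite (_ : (fun n => \int[gamma]_p (a_ n p.1 * b p.2)) =
  (fun n => \int[marginal2 gamma]_s (fiber_mean2 (a_ n) s * b s)))//.
apply/funext => n.
rewrite (@Rintegral_disintegration2 (fun p => a_ n p.1 * b p.2)); last first.
  move=> p; apply: cvgM; apply: continuous_comp; [exact: cvg_fst|exact: ca_|
    exact: cvg_snd|exact: cb].
apply: eq_Rintegral => s _; rewrite /fiber_mean2/= RintegralZr//.
  exact: measurable_I01.
apply: measurable_bounded_integrable.
- exact: measurable_I01.
- by apply: (le_lt_trans (probability_le1 _ measurable_I01)); exact: ltry.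
- exact: measurable_funTS.
- have [N _ NP] := continuous_clamp_bounded (ca_ n).
  exists N; split; rewrite ?num_real// => y Ny t It.
  by apply: le_trans (ltW Ny); rewrite -(clamp_id It); exact: NP.
Qed.

End Disintegration2.

(** * Trajectories *)

Section RowVectors.
Context {R : realType} {d : nat}.
Implicit Types u v : 'rV[R]_d.

Lemma ler_coord_norm u i : `|u 0 i| <= `|u|.
Proof.
rewrite /Num.norm/= mx_normE; apply: (@le_bigmax _ _ _ _ (fun i => `|u i.1 i.2|%:nng) (0, i)).
Qed.

Lemma rV_norm_le u c : 0 <= c -> (forall i, `|u 0 i| <= c) -> `|u| <= c.
Proof.
move=> c0 uc; rewrite /Num.norm/=; have [->//|] := eqVneq (mx_norm u) 0.
by move=> /mx_norm_neq0[[k i] ->] /=; rewrite (ord1 k).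
Qed.

Lemma dotp_ge0 u : 0 <= dotp u u.
Proof. by apply: sumr_ge0 => i _; rewrite -expr2 sqr_ge0. Qed.

Lemma ler_norm_enorm u : `|u| <= enorm u.
Proof.
apply: rV_norm_le; first exact: sqrtr_ge0.
move=> i; rewrite -sqrtr_sqr ler_sqrt ?dotp_ge0// expr2.
rewrite /dotp (bigD1 i)//= lerDl; apply: sumr_ge0 => k _.
by rewrite -expr2 sqr_ge0.
Qed.

Lemma enorm_le u : enorm u <= Num.sqrt d%:R * `|u|.
Proof.
rewrite -[X in _ * X]ger0_norm// -sqrtr_sqr -sqrtrM// ler_sqrt; last first.
  by rewrite mulr_ge0// sqr_ge0.
have -> : d%:R * `|u| ^+ 2 = \sum_(i < d) `|u| ^+ 2.
  by rewrite sumr_const card_ord mulr_natl.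
apply: ler_sum => i _; rewrite -expr2 -[X in X <= _]ger0_norm ?sqr_ge0// normrX.
by rewrite lerXn2r ?nnegrE// ler_coord_norm.
Qed.

Lemma continuous_coord (T : topologicalType) (y : T -> 'rV[R]_d) :
  continuous y -> forall i, continuous (fun t => y t 0 i).
Proof.
by move=> cy i t; exact: (continuous_comp (cy t) (@coord_continuous _ _ _ 0 i _)).
Qed.

Lemma lipschitz_continuous (y : R -> 'rV[R]_d) (M : R) : 0 <= M ->
  (forall s t, `|y s - y t| <= M * `|s - t|) -> continuous y.
Proof.
move=> M0 My s; apply/cvgrPdist_le => e e0.
have M1 : 0 < M + 1 by rewrite ltr_wpDl.
have /cvgrPdist_le/(_ (e / (M + 1))) : t @[t --> s] --> s by exact: cvg_id.
rewrite divr_gt0// => /(_ isT); apply: filterS => t st.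
apply: (le_trans (My _ _)); apply: (@le_trans _ _ ((M + 1) * `|s - t|)).
  by rewrite ler_wpM2r// lerDl.
by rewrite -ler_pdivlMl// mulrC.
Qed.

Lemma geometric_cvg (u : nat -> 'rV[R]_d) (K : R) :
  (forall n, `|u n.+1 - u n| <= K / 2 ^+ n) ->
  exists l, forall n, `|l - u n| <= 2 * K / 2 ^+ n.
Proof.
move=> uK.
have K0 : 0 <= K by have := le_trans (normr_ge0 _) (uK 0%N); rewrite expr0 divr1.
have tail n k : `|u (n + k)%N - u n| <= 2 * K / 2 ^+ n.
  suff : `|u (n + k)%N - u n| <= 2 * K / 2 ^+ n - 2 * K / 2 ^+ (n + k).
    by move=> /le_trans; apply; rewrite gerBl divr_ge0 ?mulr_ge0// exprn_ge0.
  elim: k => [|k IH]; first by rewrite addn0 !subrr normr0.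
  rewrite -(subrKA (u (n + k)%N)); apply: (le_trans (ler_normD _ _)).
  rewrite addnS; apply: (le_trans (lerD (uK _) IH)).
  have e0 : 2 ^+ (n + k) != 0 :> R by rewrite expf_neq0.
  have -> : 2 * K / 2 ^+ (n + k).+1 = K / 2 ^+ (n + k) by rewrite exprS; field; rewrite expf_neq0.
  have -> : 2 * K / 2 ^+ (n + k) = K / 2 ^+ (n + k) + K / 2 ^+ (n + k) by field; rewrite expf_neq0.
  lra.
have to0 : (2 * K / 2 ^+ n) @[n --> \oo] --> (0 : R).
  rewrite -[X in _ --> X](mulr0 (2 * K)); apply: cvgMr.
  under eq_fun do rewrite -exprVn.
  by apply: cvg_expr; rewrite ger0_norm ?invr_ge0// invf_lt1// ltr1n.
have /cauchy_cvgP cu : cauchy (u n @[n --> \oo]).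
  apply/cauchy_ballP => e e0.
  have /cvgrPdist_lt/(_ (e / 2)) := to0; rewrite divr_gt0// => /(_ isT)[N _ NP].
  have {}NP k : `|u (N + k)%N - u N| < e / 2.
    apply: (le_lt_trans (tail _ _)).
    by have := NP N (leqnn N); rewrite sub0r normrN ger0_norm// divr_ge0 ?mulr_ge0// exprn_ge0.
  exists ([set u (N + k)%N | k in setT], [set u (N + k)%N | k in setT]) => /=.
    by split; exists N => // n /= Nn; exists (n - N)%N => //; rewrite subnKC.
  move=> [_ _] [/= [k _ <-] [l _ <-]]; rewrite -ball_normE/=.
  rewrite -(subrKA (u N)) (le_lt_trans (ler_normD _ _))//.
  by rewrite [X in _ < X](splitr e) ltrD// -opprB normrN.
exists (lim (u n @[n --> \oo])) => n.
have cv : `|u m - u n| @[m --> \oo] --> `|lim (u m @[m --> \oo]) - u n|.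
  by apply: cvg_norm; apply: cvgB => //; exact: cvg_cst.
apply: (cvgr_to_le cv); exists n => // m /= nm.
by have := tail n (m - n)%N; rewrite subnKC.
Qed.

End RowVectors.

Section Bielecki.
Context {R : realType}.
Local Notation mu := (@lebesgue_measure R).

Lemma Rintegral_expR (lam t : R) : 0 < lam -> 0 <= t ->
  \int[mu]_(s in `[0, t]) expR (lam * s) = (expR (lam * t) - 1) / lam.
Proof.
move=> l0; rewrite le_eqVlt => /predU1P[<-|t0].
  by rewrite set_itv1 Rintegral_set1 mulr0 expR0 subrr mul0r.
pose F s := expR (lam * s) / lam.
have dF s : is_derive s (1 : R) F (expR (lam * s)).
  rewrite /F; apply: is_derive_eq.
  by rewrite /GRing.scale/= mulr0 add0r mulr1; field; rewrite gt_eqF.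
have cF : continuous F by move=> s; apply/differentiable_continuous/derivable1_diffP.
rewrite /Rintegral (@continuous_FTC2 _ _ F)//.
- by rewrite /F mulr0 expR0 /= -mulrBl.
- apply: continuous_subspaceT => s; apply: continuous_comp; last exact: continuous_expR.
  by apply: cvgM; [exact: cvg_cst|exact: cvg_id].
- split.
  + by move=> s _; apply: ex_derive.
  + by apply: cvg_at_right_filter; exact: cF.
  + by apply: cvg_at_left_filter; exact: cF.
- by move=> s _; rewrite derive1E; exact: derive_val.
Qed.

Lemma bielecki_halving (u : R -> R) (lam B : R) : 0 <= B -> 0 <= lam ->
  (exists K, forall t, I01 t -> u t <= K) ->
  (forall C, 0 <= C -> (forall t, I01 t -> u t <= C * expR (lam * t)) ->
     forall t, I01 t -> u t <= C / 2 * expR (lam * t) + B) ->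
  forall t, I01 t -> u t <= 2 * B * expR (lam * t).
Proof.
move=> B0 l0 [K uK] half.
have e1 t : I01 t -> 1 <= expR (lam * t).
  rewrite /I01/= in_itv/= => /andP[t0 _].
  by rewrite -expR0 ler_expR mulr_ge0.
have H n t : I01 t -> u t <= (2 * B + `|K| / 2 ^+ n) * expR (lam * t).
  elim: n t => [|n IH] t It.
    rewrite expr0 divr1; apply: (le_trans (uK t It)).
    apply: (le_trans (ler_norm K)); rewrite -[X in X <= _]mulr1.
    by apply: ler_pM; rewrite ?e1// lerDr mulr_ge0.
  apply: (le_trans (half _ _ IH t It)).
    by rewrite addr_ge0 ?mulr_ge0// divr_ge0// exprn_ge0.
  rewrite exprS invfM mulrDl.
  have := ler_wpM2l B0 (e1 t It); set E := expR _ => h.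
  set k := `|K|; set x := (2 ^+ n)^-1.
  have -> : (2 * B / 2 + k * x / 2) * E + B = (B + B) * E + (B - B * E) + k * (2^-1 * x) * E by field.
  lra.
move=> t It.
have cv : ((2 * B + `|K| / 2 ^+ n) * expR (lam * t)) @[n --> \oo] --> 2 * B * expR (lam * t).
  apply: cvgMl; rewrite -[X in _ --> X]addr0; apply: cvgD; first exact: cvg_cst.
  rewrite -[X in _ --> X](mulr0 `|K|); apply: cvgMr.
  under eq_fun do rewrite -exprVn.
  by apply: cvg_expr; rewrite ger0_norm ?invr_ge0// invf_lt1// ltr1n.
by apply: cvgr_to_ge cv _; apply: nearW => n; exact: H.
Qed.

Variables (gamma : probability (borelR2 R) R) (gammaP : Gamma gamma).

(* With weight [expR (2 L t)] and [s <= t] on the triangle, the retarded integral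
   operator with Lipschitz constant [L] contracts by [1/2]. *)
Lemma bielecki_integral (phi : R * R -> R) (L C t : R) :
  measurable_fun setT (phi : borelR2 R -> R) -> 0 < L -> 0 <= C -> I01 t ->
  (forall p, I01 p.2 -> `|phi p| <= L * (C * expR (2 * L * p.2))) ->
  gamma.-integrable setT (EFin \o (phi : borelR2 R -> R)) ->
  `|\int[gamma]_p ((p.1 <= t)%R%:R * phi p)| <= C / 2 * expR (2 * L * t).
Proof.
move=> mphi L0 C0 It phiL phii.
have mk : measurable_fun setT (fun p : borelR2 R => (p.1 <= t)%R%:R : R).
  apply: measurable_le_natr; first exact: measurable_fst.
  exact: measurable_cst.
have k1 (p : borelR2 R) : `|(p.1 <= t)%R%:R : R| <= 1.
  by case: (p.1 <= t)%R; rewrite ?normr1 ?normr0.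
have mkphi := measurable_funM mk mphi.
have kphii : gamma.-integrable setT (EFin \o (fun p => (p.1 <= t)%R%:R * phi p)).
  apply: integrable_le_norm phii _ => // p; rewrite normrM ler_piMl//.
apply: (le_trans (le_normr_Rintegral measurableT kphii)).
pose w (s : R) : R := (s <= t)%R%:R * (L * (C * expR (2 * L * clamp s))).
have mw : measurable_fun setT (w : borelR R -> R).
  apply: measurable_funM.
    by apply: measurable_le_natr; [exact: measurable_id|exact: measurable_cst].
  do 2 apply: measurable_funM => //.
  apply: measurableT_comp => //; apply: measurable_funM => //; exact: measurable_clamp.
have wb s : `|w s| <= L * (C * expR (2 * L)).
  have := clamp_I01 s; rewrite /I01/= in_itv/= => /andP[c0 c1].
  rewrite /w normrM ger0_norm//; apply: (@le_trans _ _ (`|L * (C * expR (2 * L * clamp s))|)).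
    by rewrite ler_piMl//; case: (s <= t)%R.
  rewrite ger0_norm ?mulr_ge0 ?expR_ge0 ?(ltW L0)// ler_pM2l// ler_wpM2l// ler_expR.
  by rewrite ler_piMr// mulr_ge0// ltW.
have wi : gamma.-integrable setT (EFin \o (fun p => w p.1)).
  apply: (@bounded_integrable _ _ _ _ _ (L * (C * expR (2 * L)))).
    exact: measurableT_comp mw _.
  by move=> p; exact: wb.
apply: (@le_trans _ _ (\int[gamma]_p w p.1)).
  apply: le_ae_Rintegral => //; first exact: integrable_norm.
  apply: ae_imp (Gamma_ae_triangle gammaP) => p [[p1 p2] p21].
  rewrite /w normrM ger0_norm//; apply: ler_wpM2l => //.
  rewrite (clamp_id p1); apply: (le_trans (phiL _ p2)).
  by rewrite ler_pM2l// ler_wpM2l// ler_expR ler_pM2l// mulr_gt0.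
rewrite (Rintegral_marginal1 gammaP mw).
move: (It); rewrite /I01/= in_itv/= => /andP[t0 t1].
have -> : \int[mu]_(s in I01) w s =
    \int[mu]_(s in `[0, t]) (L * C * expR (2 * L * s)).
  have -> : `[0, t]%classic = @I01 R `&` `[0, t]%classic.
    apply/seteqP; split => s /=; rewrite /I01/= !in_itv/=; last by case.
    by move=> /andP[-> st]; rewrite (le_trans st t1).
  rewrite Rintegral_mkcondr; apply: eq_Rintegral => s /set_mem Is.
  rewrite patchE /w clamp_id//; move: (Is); rewrite /I01/= in_itv/= => /andP[s0 _].
  have [st|st] := leP s t.
    by rewrite mem_set/= ?in_itv/= ?s0// mul1r mulrA.
  by rewrite memNset/= ?mul0r// in_itv/= s0/= leNgt st.
rewrite RintegralZl//; last first.
  apply: continuous_compact_integrable; first exact: segment_compact.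
  apply: continuous_subspaceT => s; apply: continuous_comp; last exact: continuous_expR.
  by apply: cvgM; [exact: cvg_cst|exact: cvg_id].
rewrite Rintegral_expR// ?mulr_gt0//.
have -> : L * C * ((expR (2 * L * t) - 1) / (2 * L)) = C / 2 * expR (2 * L * t) - C / 2.
  by field; rewrite gt_eqF.
by rewrite gerBl divr_ge0.
Qed.

End Bielecki.

Section Trajectories.
Context {R : realType} {d : nat}.
Local Notation mu := (@lebesgue_measure R).
Variables (f : R -> 'rV[R]_d -> 'rV[R]_d) (x0 : 'rV[R]_d) (L : R).
Hypothesis f_cont : {within I01 `*` setT,
  continuous (fun p : R * 'rV[R]_d => f p.1 p.2)}.
Hypothesis L0 : 0 < L.
Hypothesis f_lip : forall t y z, I01 t -> `|f t y - f t z| <= L * `|y - z|.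
Implicit Types y z : R -> 'rV[R]_d.

Definition field y (s : R) := f (clamp s) (y (clamp s)).

Lemma continuous_field y : {within I01, continuous y} -> continuous (field y).
Proof.
move=> cy.
have cyc := continuous_within_comp cy (@clamp_I01 R) (@continuous_clamp R).
apply: (@continuous_within_comp _ _ _ _ (fun p : R * 'rV[R]_d => f p.1 p.2)
  (fun s => (clamp s, y (clamp s))) f_cont).
  by move=> s; split => //=; exact: clamp_I01.
move=> s; apply: (@cvg_pair _ _ _ _ (nbhs (clamp s)) (nbhs (y (clamp s)))).
  exact: continuous_clamp.
exact: cyc.
Qed.

Lemma measurable_field y i : {within I01, continuous y} ->
  measurable_fun setT ((fun s => field y s 0 i) : borelR R -> R).
Proof.
move=> cy; apply: continuous_measurable_fun.
exact: continuous_coord (continuous_field cy) i.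
Qed.

Lemma field_bounded y : {within I01, continuous y} ->
  exists2 M, 0 <= M & forall s, `|field y s| <= M.
Proof.
move=> cy; have cF : continuous (fun s => `|field y s|).
  by move=> s; apply: cvg_norm; exact: (continuous_field cy).
have [M M0 FM] := continuous_clamp_bounded cF.
exists M => // s; have := FM s; rewrite normr_id.
by rewrite /field clampK.
Qed.

Lemma field_lip y z s : `|field y s - field z s| <= L * `|y (clamp s) - z (clamp s)|.
Proof. by apply: f_lip; exact: clamp_I01. Qed.

Section Plan.
Variables (gamma : probability (borelR2 R) R) (gammaP : Gamma gamma).

Lemma measurable_before t : measurable_fun setT (fun p : borelR2 R => (p.1 <= t)%R%:R : R).
Proof.
by apply: measurable_le_natr; [exact: measurable_fst|exact: measurable_cst].
Qed.

Lemma integrable_before (phi : R * R -> R) t :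
  gamma.-integrable setT (EFin \o (phi : borelR2 R -> R)) ->
  gamma.-integrable setT (EFin \o (fun p : borelR2 R => (p.1 <= t)%R%:R * phi p)).
Proof.
move=> phii; have mphi := integrable_measurable phii.
apply: integrable_le_norm phii _ => [|p].
  by apply: measurable_funM => //; exact: measurable_before.
by rewrite normrM ler_piMl//; case: (p.1 <= t)%R; rewrite ?normr1 ?normr0.
Qed.

Lemma integrable_field y i : {within I01, continuous y} ->
  gamma.-integrable setT (EFin \o (fun p : borelR2 R => field y p.2 0 i)).
Proof.
move=> cy; have [M _ FM] := field_bounded cy.
apply: (@bounded_integrable _ _ _ _ _ M).
  exact: measurableT_comp (measurable_field i cy) _.
by move=> p; exact: le_trans (ler_coord_norm _ _) (FM _).
Qed.

Definition flow_coord y (i : 'I_d) (t : R) : R :=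
  \int[gamma]_p ((p.1 <= t)%R%:R * field y p.2 0 i).

Definition flow y (t : R) : 'rV[R]_d := x0 + \row_i flow_coord y i t.

Lemma Gamma_strip_le s t : s <= t ->
  `|\int[gamma]_p ((p.1 <= t)%R%:R - (p.1 <= s)%R%:R : R)| <= t - s.
Proof.
move=> st; pose w (r : R) : R := (r <= t)%R%:R - (r <= s)%R%:R.
have mw : measurable_fun setT (w : borelR R -> R).
  by apply: measurable_funB; apply: measurable_le_natr; first exact: measurable_id.
rewrite (Rintegral_marginal1 gammaP mw).
have wE r : w r = \1_(`]s, t]) r.
  rewrite /w indicE; have [rs|rs] := leP r s.
    by rewrite (le_trans rs st) memNset/= ?subrr// in_itv/= ltNge rs.
  have [rt|rt] := leP r t; first by rewrite mem_set/= ?subr0// in_itv/= rs.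
  by rewrite memNset/= ?subrr// in_itv/= rs/= leNgt rt.
under eq_Rintegral do rewrite wE.
have mI : measurable (`]s, t]%classic : set (borelR R)) by exact: measurable_itv.
rewrite /Rintegral integral_indic//; last exact: measurable_I01.
rewrite ger0_norm ?fine_ge0//.
have -> : t - s = fine (mu `]s, t]%classic).
  rewrite lebesgue_measure_itv/= lte_fin.
  by move: st; rewrite le_eqVlt => /predU1P[->|->//]; rewrite ltxx subrr.
have fin : (mu `]s, t]%classic \is a fin_num).
  by rewrite lebesgue_measure_itv/=; case: ifP => _; rewrite -?EFinD.
have le1 : (mu (`]s, t]%classic `&` I01) <= mu `]s, t]%classic)%E.
  apply: le_measure => [||r []//]; rewrite inE//.
  by apply: measurableI => //; exact: measurable_I01.
apply: fine_le => //; rewrite ge0_fin_numE//.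
by apply: (le_lt_trans le1); rewrite -ge0_fin_numE.
Qed.

Lemma flow_lipschitz y : {within I01, continuous y} ->
  exists2 M, 0 <= M & forall s t, `|flow y s - flow y t| <= M * `|s - t|.
Proof.
move=> cy; have [M M0 FM] := field_bounded cy; exists M => //.
have main s t i : s <= t -> `|flow_coord y i s - flow_coord y i t| <= M * (t - s).
  move=> st; rewrite distrC /flow_coord.
  rewrite -RintegralB//; do ?[by apply: integrable_before; exact: integrable_field].
  under eq_Rintegral do rewrite -mulrBl.
  have wi : gamma.-integrable setT (EFin \o
      (fun p : borelR2 R => (p.1 <= t)%R%:R - (p.1 <= s)%R%:R : R)).
    apply: (@bounded_integrable _ _ _ _ _ 1).
      by apply: measurable_funB; exact: measurable_before.
    move=> p; case: (p.1 <= t)%R; case: (p.1 <= s)%R => /=;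
      by rewrite ?subrr ?subr0 ?sub0r ?normrN ?normr1 ?normr0.
  have w0 (p : borelR2 R) : 0 <= (p.1 <= t)%R%:R - (p.1 <= s)%R%:R :> R.
    have [ps|ps] := leP p.1 s; first by rewrite (le_trans ps st) subrr.
    by rewrite subr0.
  have bi : gamma.-integrable setT (EFin \o
      (fun p : borelR2 R => ((p.1 <= t)%R%:R - (p.1 <= s)%R%:R) * field y p.2 0 i)).
    apply: (integrable_mul_bounded (M := M) wi).
      exact: measurableT_comp (measurable_field i cy) _.
    by move=> p; exact: le_trans (ler_coord_norm _ _) (FM _).
  apply: (le_trans (le_normr_Rintegral measurableT bi)).
  apply: (@le_trans _ _ (M * \int[gamma]_p ((p.1 <= t)%R%:R - (p.1 <= s)%R%:R : R))).
    rewrite -RintegralZl//; apply: le_Rintegral => //; first exact: integrable_norm.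
      by have := integrableZl measurableT M wi; apply: eq_integrable.
    move=> p _; rewrite normrM mulrC (ger0_norm (w0 p)); apply: ler_wpM2r => //.
    exact: le_trans (ler_coord_norm _ _) (FM _).
  apply: ler_wpM2l => //; exact: le_trans (ler_norm _) (Gamma_strip_le st).
move=> s t; rewrite /flow opprD addrACA subrr add0r.
apply: rV_norm_le; first exact: mulr_ge0.
move=> i; rewrite !mxE; have [st|ts] := leP s t.
  by rewrite distrC [`|s - t|]distrC (ger0_norm (x := t - s)) ?subr_ge0// distrC; exact: main.
by rewrite (ger0_norm (x := s - t)) ?subr_ge0 ?(ltW ts)// distrC; apply: main; exact: ltW.
Qed.

Lemma flow_contraction y z C : {within I01, continuous y} -> {within I01, continuous z} ->
  0 <= C -> (forall s, I01 s -> `|y s - z s| <= C * expR (2 * L * s)) ->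
  forall t, I01 t -> `|flow y t - flow z t| <= C / 2 * expR (2 * L * t).
Proof.
move=> cy cz C0 yz t It; rewrite /flow opprD addrACA subrr add0r.
apply: rV_norm_le; first by rewrite mulr_ge0 ?expR_ge0// divr_ge0.
move=> i; rewrite !mxE /flow_coord.
rewrite -RintegralB//; do ?[by apply: integrable_before; exact: integrable_field].
under eq_Rintegral do rewrite -mulrBr.
have di : gamma.-integrable setT (EFin \o
    (fun p : borelR2 R => field y p.2 0 i - field z p.2 0 i)).
  have := integrableB measurableT (integrable_field i cy) (integrable_field i cz).
  by apply: eq_integrable.
apply: (bielecki_integral gammaP (phi := fun p => field y p.2 0 i - field z p.2 0 i)) => //.
  exact: integrable_measurable di.
move=> p Ip; have -> : field y p.2 0 i - field z p.2 0 i = (field y p.2 - field z p.2) 0 i.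
  by rewrite !mxE.
apply: (le_trans (ler_coord_norm _ _)); apply: (le_trans (field_lip _ _ _)).
by rewrite ler_pM2l// clamp_id// yz.
Qed.

Lemma flow_fixpoint : exists2 y, continuous y & forall t, I01 t -> y t = flow y t.
Proof.
pose u n := iter n (fun y s => flow y (clamp s)) (fun=> x0).
have cu n : continuous (u n).
  case: n => [|n]; first by move=> s; exact: cvg_cst.
  elim: n => [|n IH].
    have [|M M0 Ml] := @flow_lipschitz (u 0%N).
      by apply: continuous_subspaceT => s; exact: cvg_cst.
    move=> s; apply: (@continuous_comp _ _ _ (@clamp R) (flow (u 0%N))).
      exact: continuous_clamp.
    exact: (lipschitz_continuous M0 Ml).
  have [|M M0 Ml] := @flow_lipschitz (u n.+1); first exact: continuous_subspaceT.
  move=> s; apply: (@continuous_comp _ _ _ (@clamp R) (flow (u n.+1))).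
    exact: continuous_clamp.
  exact: (lipschitz_continuous M0 Ml).
have cuw n : {within I01, continuous (u n)} by exact: continuous_subspaceT.
have uc n s : u n (clamp s) = u n s by case: n => //= n; rewrite clampK.
have [C C0 u1] : exists2 C, 0 <= C & forall s, `|u 1%N s - u 0%N s| <= C.
  have [|C C0 uC] := @continuous_clamp_bounded R (fun s => `|u 1%N s - u 0%N s|).
    by move=> s; apply: cvg_norm; apply: cvgB; exact: cu.
  by exists C => // s; have := uC s; rewrite normr_id !uc.
have e1 t : I01 t -> 1 <= expR (2 * L * t).
  rewrite /I01/= in_itv/= => /andP[t0 _].
  by rewrite -expR0 ler_expR !mulr_ge0// ltW.
have un n t : I01 t -> `|u n.+1 t - u n t| <= C / 2 ^+ n * expR (2 * L * t).
  elim: n t => [|n IH] t It.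
    by rewrite expr0 divr1; apply: (le_trans (u1 t)); rewrite ler_peMr// e1.
  have -> : u n.+2 t - u n.+1 t = flow (u n.+1) t - flow (u n) t by rewrite /= clamp_id.
  rewrite exprS invfM [2^-1 / _]mulrC mulrA.
  have := @flow_contraction (u n.+1) (u n) (C / 2 ^+ n) (cuw _) (cuw _) _ IH t It.
  by apply; rewrite divr_ge0// exprn_ge0.
pose K := C * expR (2 * L).
have K0 : 0 <= K by rewrite mulr_ge0// expR_ge0.
have unK n s : `|u n.+1 s - u n s| <= K / 2 ^+ n.
  rewrite -!(uc _ s); apply: (le_trans (un _ _ (clamp_I01 s))).
  rewrite /K -!mulrA ler_wpM2l// mulrC ler_wpM2r ?invr_ge0 ?exprn_ge0// ler_expR.
  have := clamp_I01 s; rewrite /I01/= in_itv/= => /andP[_ c1].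
  by rewrite mulrA ler_piMr// mulr_ge0// ltW.
have /choice[y yP] s := geometric_cvg (fun n => unK n s).
have to0 : (2 * K / 2 ^+ n) @[n --> \oo] --> (0 : R).
  rewrite -[X in _ --> X](mulr0 (2 * K)); apply: cvgMr.
  under eq_fun do rewrite -exprVn.
  by apply: cvg_expr; rewrite ger0_norm ?invr_ge0// invf_lt1// ltr1n.
have cy : continuous y.
  move=> s; apply/cvgrPdist_le => e e0.
  have /cvgrPdist_le/(_ (e / 3)) := to0; rewrite divr_gt0// => /(_ isT)[N _ /(_ N (leqnn N))].
  rewrite sub0r normrN => hN; have {}hN := le_trans (ler_norm _) hN.
  have /cvgrPdist_le/(_ (e / 3)) := cu N s; rewrite divr_gt0// => /(_ isT).
  apply: filterS => t st.
  have -> : y s - y t = (y s - u N s) + (u N s - u N t) + (u N t - y t).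
    by rewrite !subrKA.
  apply: (le_trans (ler_normD _ _)); rewrite (_ : e = e / 3 + e / 3 + e / 3); last by field.
  apply: lerD; last by rewrite distrC; exact: le_trans (yP _ _) hN.
  by apply: (le_trans (ler_normD _ _)); apply: lerD => //; exact: le_trans (yP _ _) hN.
exists y => // t It; apply/eqP; rewrite -subr_eq0 -normr_le0.
have bnd n : `|y t - flow y t| <= (1 + expR (2 * L)) * (2 * K / 2 ^+ n).
  rewrite -(subrKA (u n.+1 t)); apply: (le_trans (ler_normD _ _)).
  rewrite mulrDl mul1r; apply: lerD.
    apply: (le_trans (yP t n.+1)); rewrite ler_wpM2l ?mulr_ge0//.
    by rewrite lef_pV2 ?posrE ?exprn_gt0// exprS ler_peMl ?exprn_ge0// ler1n.
  have -> : u n.+1 t = flow (u n) t by rewrite /= clamp_id.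
  have c0 : 0 <= 2 * K / 2 ^+ n by rewrite divr_ge0 ?mulr_ge0// exprn_ge0.
  rewrite distrC; apply: (@le_trans _ _ (2 * K / 2 ^+ n / 2 * expR (2 * L * t))).
    apply: flow_contraction => //; first exact: continuous_subspaceT.
    by move=> s Is; apply: (le_trans (yP s n)); rewrite ler_peMr// e1.
  have c2 : 0 <= 2 * K / 2 ^+ n / 2 by rewrite divr_ge0.
  rewrite mulrC; apply: ler_pM => //.
    rewrite ler_expR; move: It; rewrite /I01/= in_itv/= => /andP[_ t1].
    by rewrite ler_piMr// mulr_ge0// ltW.
  by rewrite ler_pdivrMr// ler_peMr// ler1n.
have cv0 : (1 + expR (2 * L)) * (2 * K / 2 ^+ n) @[n --> \oo] --> (0 : R).
  by rewrite -[X in _ --> X](mulr0 (1 + expR (2 * L))); apply: cvgMr.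
by apply: cvgr_to_ge cv0 _; exact: nearW.
Qed.

Lemma flow_disintegration1 (nu : R -> probability (borelR R) R) y t :
  disintegration1 gamma nu -> {within I01, continuous y} -> I01 t ->
  x0 + vint mu `[0, t] (fun tau => vint (nu tau) `[0, tau] (fun s => f s (y s))) =
  flow y t.
Proof.
move=> nuP cy It; rewrite /flow; congr (_ + _); apply/rowP => i; rewrite !mxE.
have cF : continuous (fun p : R * R => field y p.2 0 i).
  move=> p; apply: (@continuous_comp _ _ _ snd (fun s => field y s 0 i)).
    exact: cvg_snd.
  exact: continuous_coord (continuous_field cy) i _.
have [M M0 FM] := field_bounded cy.
have mF := continuous_measurable_plane cF.
have mF1 := measurable_fiber_mean nuP mF.
pose a (r : R) : R := (r <= t)%R%:R.
have ma : measurable_fun setT (a : borelR R -> R).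
  by apply: measurable_le_natr; first exact: measurable_id.
have ai : mu.-integrable I01 (EFin \o a).
  apply: measurable_bounded_integrable.
  - exact: measurable_I01.
  - exact: lebesgue_I01.
  - exact: measurable_funTS.
  - exists 1; split; rewrite ?num_real// => r r1 z _.
    by apply: le_trans (ltW r1); rewrite /a; case: (z <= t)%R; rewrite ?normr1 ?normr0.
rewrite /flow_coord.
rewrite (Rintegral_disintegration1_mul gammaP nuP ma ai cF (M := M)); last first.
  by move=> p; exact: le_trans (ler_coord_norm _ _) (FM _).
rewrite (Rintegral_marginal1 gammaP (a := fun r => a r * fiber_mean nu (fun p => field y p.2 0 i) r)); last first.
  exact: measurable_funM.
move: (It); rewrite /I01/= in_itv/= => /andP[t0 t1].
have -> : `[0, t]%classic = @I01 R `&` `[0, t]%classic.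
  apply/seteqP; split => s /=; rewrite /I01/= !in_itv/=; last by case.
  by move=> /andP[-> st]; rewrite (le_trans st t1).
rewrite Rintegral_mkcondr; apply: eq_Rintegral => r /set_mem Ir.
rewrite patchE /a; move: (Ir); rewrite /I01/= in_itv/= => /andP[r0 r1].
have [rt|rt] := leP r t; last by rewrite memNset/= ?mul0r// in_itv/= r0/= leNgt rt.
rewrite mem_set/= ?in_itv/= ?r0// mul1r mxE (fiber_meanE nuP)//.
have [_ /(_ r (mem_set Ir)) nur _] := nuP.
have mi : measurable (`[0, r]%classic : set (borelR R)) by exact: measurable_itv.
apply: (Rintegral_full mi nur (measurable_field i cy)).
move=> s /set_mem; rewrite /= in_itv/= => /andP[s0 sr].
by rewrite /field clamp_id// /I01/= in_itv/= s0 (le_trans sr).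
Qed.

Lemma trajectoryP : (exists nu, disintegration1 gamma nu) ->
  {within I01, continuous (trajectory f x0 gamma)} /\
  forall t, I01 t -> trajectory f x0 gamma t = flow (trajectory f x0 gamma) t.
Proof.
move=> [nu nuP].
have : is_trajectory f x0 gamma (trajectory f x0 gamma).
  apply: getPex; have [y cy yP] := flow_fixpoint.
  exists y; split; first exact: continuous_subspaceT.
  exists nu; split => // t /set_mem It.
  by rewrite (flow_disintegration1 nuP)// ?yP//; exact: continuous_subspaceT.
move=> [cx [nu' [nu'P xP]]]; split => // t It.
by rewrite [LHS]xP ?inE// (flow_disintegration1 nu'P).
Qed.

End Plan.

End Trajectories.
(** * Needle perturbations *)

Section Needle.
Context {R : realType}.
Local Notation mu := (@lebesgue_measure R).
Variables (A : set (borelR R)) (s0 : R).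
Hypothesis mA : measurable A.
Hypothesis A_s0 : forall t, A t -> s0 <= t.
Hypothesis s0_I01 : I01 s0.

Definition needle (p : borelR2 R) : borelR2 R := (p.1, if p.1 \in A then s0 else p.2).

Lemma measurable_needle : measurable_fun setT needle.
Proof.
apply: measurable_fun_pair; first exact: measurable_fst.
apply: measurable_fun_ifT => //.
apply: (measurable_fun_bool true); rewrite setTI.
rewrite (_ : _ @^-1` _ = [set p | A p.1]); first exact: measurable_preimage_fst.
by apply/seteqP; split => p /= h; [exact: set_mem|exact: mem_set].
Qed.

Lemma needle_triangle p : triangle p -> triangle (needle p).
Proof.
move=> [[p1 p2] p21]; rewrite /needle; have [pA|//] := boolP (p.1 \in A).
by split => //=; apply: A_s0; exact: set_mem.
Qed.

Lemma needleE (phi : R * R -> R) p :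
  phi (needle p) = phi p + \1_A p.1 * (phi (p.1, s0) - phi p).
Proof.
rewrite /needle indicE; case: ifP => _; rewrite ?mul1r ?mul0r ?addr0.
  by rewrite addrC subrK.
by case: p.
Qed.

Variables (gamma : probability (borelR2 R) R) (gammaP : Gamma gamma).
Variables (nu : R -> probability (borelR R) R) (nuP : disintegration1 gamma nu).
Variables (e : R) (e01 : 0 <= e <= 1).

Definition needle_plan : probability (borelR2 R) R :=
  distribution gamma (mfun_Sub (mem_set measurable_needle)).

Definition perturbed_plan : probability (borelR2 R) R :=
  mixture gamma needle_plan e01.

Lemma perturbed_plan_Gamma : Gamma perturbed_plan.
Proof.
split.
  have : perturbed_plan triangle = ((1 - e)%:E * gamma triangle + e%:E * needle_plan triangle)%E.
    exact: mixtureE.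
  move=> ->; rewrite gammaP.1 (_ : needle_plan triangle = 1%E) ?mule1 -?EFinD ?subrK//.
  apply: (full_subset measurable_triangle _ _ gammaP.1).
    rewrite -[X in measurable X]setTI.
    by apply: measurable_needle => //; exact: measurable_triangle.
  exact: needle_triangle.
move=> B mB; rewrite -(gammaP.2 B mB).
have -> : marginal1 perturbed_plan B =
    ((1 - e)%:E * marginal1 gamma B + e%:E * marginal1 gamma B)%E.
  exact: mixtureE.
by rewrite -ge0_muleDl ?lee_fin ?subr_ge0; case/andP: e01 => // _ _; rewrite -EFinD subrK mul1e.
Qed.

Lemma Rintegral_perturbed_plan (phi : R * R -> R) M :
  measurable_fun setT (phi : borelR2 R -> R) -> (forall p, `|phi p| <= M) ->
  \int[perturbed_plan]_p phi p =
  \int[gamma]_p phi p + e * \int[gamma]_p (phi (needle p) - phi p).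
Proof.
move=> mphi phiM.
have mn : measurable_fun setT (fun p : borelR2 R => phi (needle p)).
  exact: measurableT_comp mphi measurable_needle.
have ni : gamma.-integrable setT (EFin \o (fun p : borelR2 R => phi (needle p))).
  exact: bounded_integrable mn _.
have phii : gamma.-integrable setT (EFin \o phi) by exact: bounded_integrable mphi _.
have ki : needle_plan.-integrable setT (EFin \o phi) by exact: bounded_integrable mphi _.
rewrite (@Rintegral_mixture _ _ _ gamma needle_plan e e01 phi phii ki) (@Rintegral_distribution _ _ _ _ _ gamma
  (mfun_Sub (mem_set measurable_needle)) phi mphi ni) RintegralB//.
by rewrite mulrBl mul1r mulrBr addrAC addrA.
Qed.

Let point_mass : probability (borelR R) R := @dirac _ (borelR R) s0 R.

Let mixed t : probability (borelR R) R := mixture (nu t) point_mass e01.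

Let point_massE B : B s0 -> point_mass B = 1%E.
Proof. by move=> Bs; change (\d_s0 B = 1%E :> \bar R); rewrite diracE mem_set. Qed.

Let mixed1 t B : nu t B = 1%E -> B s0 -> mixed t B = 1%E.
Proof.
move=> nut Bs; have -> : mixed t B = ((1 - e)%:E * nu t B + e%:E * point_mass B)%E.
  exact: mixtureE.
by rewrite nut point_massE// !mule1 -EFinD subrK.
Qed.

Definition perturbed_family (t : R) : probability (borelR R) R :=
  if t \in A then mixed t else nu t.

Lemma Rintegral_perturbed_family (phi : R -> R) M t : I01 t ->
  measurable_fun setT (phi : borelR R -> R) -> (forall s, `|phi s| <= M) ->
  \int[perturbed_family t]_(s in I01) phi s =
  \int[nu t]_(s in I01) phi s + e * (\1_A t * (phi s0 - \int[nu t]_(s in I01) phi s)).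
Proof.
move=> It mphi phiM; rewrite indicE /perturbed_family.
have nut := disintegration1_I01 nuP It.
case: ifP => _; last by rewrite mul0r mulr0 addr0.
have mixt : mixed t (@I01 R) = 1%E.
  exact: mixed1.
rewrite (Rintegral_full measurable_I01 mixt mphi)// (Rintegral_full measurable_I01 nut mphi)//.
rewrite (@Rintegral_mixture _ _ _ (nu t) point_mass e e01 phi); try exact: bounded_integrable mphi phiM.
have -> : \int[point_mass]_s phi s = phi s0.
  rewrite /Rintegral integral_dirac ?diracT ?mul1e//.
  exact/measurable_EFinP.
rewrite mul1r; ring.
Qed.

Lemma perturbed_disintegration1 : disintegration1 perturbed_plan perturbed_family.
Proof.
have mind : measurable_fun setT (\1_A : borelR R -> R) by exact: measurable_indic.
split.
- move=> phi cphi.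
  have cphi' : continuous (phi \o clamp).
    exact: continuous_within_comp cphi (@clamp_I01 R) (@continuous_clamp R).
  have [M M0 phiM] := continuous_clamp_bounded cphi'.
  have [nuB _ _] := nuP; have mnu := nuB phi cphi.
  apply: (eq_measurable_fun (fun t => \int[nu t]_(s in I01) phi s +
      e * (\1_A t * (phi s0 - \int[nu t]_(s in I01) phi s)))).
    move=> t /set_mem It.
    have E1 (m : probability (borelR R) R) :
        \int[m]_(s in I01) phi s = \int[m]_(s in I01) (phi \o clamp) s.
      by apply: eq_Rintegral => s /set_mem Is /=; rewrite clamp_id.
    rewrite !E1 (@Rintegral_perturbed_family _ M)//.
    + by rewrite /= (clamp_id s0_I01).
    + exact: continuous_measurable_fun.
    + by move=> s; have := phiM s; rewrite /= clampK.
  apply: measurable_funD => //; apply: measurable_funM => //.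
  by apply: measurable_funM; [exact: measurable_funTS|exact: measurable_funB].
- move=> t /set_mem It; rewrite /perturbed_family.
  have [_ /(_ t (mem_set It)) nut _] := nuP.
  have [tA|//] := boolP (t \in A).
  apply: mixed1 => //=; rewrite in_itv/= (A_s0 (set_mem tA)) andbT.
  by move: s0_I01; rewrite /I01/= in_itv/= => /andP[].
- move=> phi0 cphi0.
  pose phi (p : R * R) := phi0 (clamp p.1, clamp p.2).
  have cphi : continuous phi.
    apply: (@continuous_within_comp _ _ _ sq01 phi0 (fun p : R * R => (clamp p.1, clamp p.2))) => //.
      by move=> p; split; exact: clamp_I01.
    move=> p; apply: (@cvg_pair _ _ _ _ (nbhs (clamp p.1)) (nbhs (clamp p.2))).
      by apply: continuous_comp; [exact: cvg_fst|exact: continuous_clamp].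
    by apply: continuous_comp; [exact: cvg_snd|exact: continuous_clamp].
  have mphi := continuous_measurable_plane cphi.
  have [M M0 phiM0] := continuous_sq01_bounded cphi.
  have phiM p : `|phi p| <= M.
    have -> : phi p = phi (clamp p.1, clamp p.2) by rewrite /phi/= !clampK.
    by apply: phiM0; split; exact: clamp_I01.
  have fullsq := Gamma_sq01 perturbed_plan_Gamma.
  rewrite (Rintegral_full measurable_sq01 fullsq mphi); last first.
    by move=> [t s] /set_mem[/= It Is]; rewrite /phi/= !clamp_id.
  rewrite (Rintegral_perturbed_plan mphi phiM).
  pose m := fiber_mean nu phi.
  have mm : measurable_fun setT (m : borelR R -> R) by exact: (measurable_fiber_mean nuP).
  have mM t : `|m t| <= M by exact: (fiber_mean_bounded nuP).
  have ms0 : measurable_fun setT (fun t : borelR R => phi (t, s0)).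
    apply: measurableT_comp mphi _; exact: measurable_fun_pair.
  have ai : mu.-integrable I01 (EFin \o (\1_A : R -> R)).
    apply: measurable_bounded_integrable.
    + exact: measurable_I01.
    + exact: lebesgue_I01.
    + exact: measurable_funTS.
    + exists 1; split; rewrite ?num_real// => r r1 z _.
      by apply: le_trans (ltW r1); rewrite indicE; case: (z \in A); rewrite ?normr1 ?normr0.
  have mindp : measurable_fun setT (fun p : borelR2 R => \1_A p.1 : R).
    exact: measurableT_comp mind _.
  have indi : gamma.-integrable setT (EFin \o (fun p : borelR2 R => \1_A p.1 : R)).
    exact: (integrable_marginal1 gammaP mind ai).
  have i1 : gamma.-integrable setT (EFin \o (fun p : borelR2 R => \1_A p.1 * phi (p.1, s0))).
    by apply: (integrable_mul_bounded (M := M) indi) => //; exact: measurableT_comp ms0 _.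
  have i2 : gamma.-integrable setT (EFin \o (fun p : borelR2 R => \1_A p.1 * phi p)).
    exact: (integrable_mul_bounded (M := M) indi).
  have i3 : gamma.-integrable setT (EFin \o (fun p : borelR2 R => \1_A p.1 * m p.1)).
    by apply: (integrable_mul_bounded (M := M) indi) => //; exact: measurableT_comp mm _.
  have i4 : gamma.-integrable setT (EFin \o (fun p : borelR2 R => m p.1)).
    by apply: (@bounded_integrable _ _ _ _ _ M) => //; exact: measurableT_comp mm _.
  have -> : \int[gamma]_p (phi (needle p) - phi p) =
      \int[gamma]_p (\1_A p.1 * phi (p.1, s0)) - \int[gamma]_p (\1_A p.1 * phi p).
    rewrite -RintegralB//; apply: eq_Rintegral => p _.
    by rewrite needleE addrAC subrr add0r mulrBr.
  have -> : \int[mu]_(t in I01) \int[perturbed_family t]_(s in I01) phi0 (t, s) =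
      \int[mu]_(t in I01) (m t + e * (\1_A t * (phi (t, s0) - m t))).
    apply: eq_Rintegral => t /set_mem It.
    transitivity (\int[perturbed_family t]_(s in I01) phi (t, s)).
      by apply: eq_Rintegral => s /set_mem Is; rewrite /phi/= !clamp_id.
    rewrite (@Rintegral_perturbed_family (fun s => phi (t, s)) M)//.
      by rewrite /m /fiber_mean clamp_id.
    exact: measurableT_comp mphi _.
  rewrite -(Rintegral_marginal1 gammaP (a := fun t => m t + e * (\1_A t * (phi (t, s0) - m t)))); last first.
    apply: measurable_funD => //; apply: measurable_funM => //.
    by apply: measurable_funM => //; exact: measurable_funB.
  rewrite (Rintegral_disintegration1 gammaP nuP cphi) -/m.
  rewrite (Rintegral_disintegration1_mul gammaP nuP mind ai cphi phiM) -/m.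
  rewrite -RintegralB// -RintegralZl//; last first.
    by have := integrableB measurableT i1 i3; apply: eq_integrable.
  rewrite -RintegralD//; last first.
    have := integrableZl measurableT e (integrableB measurableT i1 i3).
    by apply: eq_integrable.
  by apply: eq_Rintegral => p _; congr (_ + e * _); rewrite mulrBr.
Qed.

End Needle.

(** * Duality with the adjoint equation *)

Section Calculus.
Context {R : realType} {d : nat}.

Lemma diff_grad (h : 'rV[R]_d -> R) x v : differentiable h x ->
  'd h x v = dotp (grad h x) v.
Proof.
move=> dh; rewrite {1}(row_sum_delta v) linear_sum/=.
apply: eq_bigr => i _; rewrite linearZ/= -deriveE// /grad mxE.
by rewrite /GRing.scale/= mulrC.
Qed.

Lemma diff_jacobian (f : 'rV[R]_d -> 'rV[R]_d) x v :
  'd f x v = v *m 'J f x.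
Proof. by rewrite /jacobian mul_rV_lin1. Qed.

Lemma differentiable_sequence (V : normedModType R) (G : 'rV[R]_d -> V) x
    (y : nat -> 'rV[R]_d) (e : nat -> R) (C : R) :
  differentiable G x -> (forall n, 0 < e n) -> e n @[n --> \oo] --> (0 : R) ->
  (forall n, `|y n - x| <= C * e n) ->
  (e n)^-1 *: (G (y n) - G x - 'd G x (y n - x)) @[n --> \oo] --> (0 : V).
Proof.
move=> dG e0 ecv yC.
have C0 : 0 <= C.
  by rewrite -(pmulr_lge0 _ (e0 0%N)); exact: le_trans (normr_ge0 _) (yC 0%N).
have /diff_locallyP[_ /eqaddoP oG] := dG.
have ycv : y n - x @[n --> \oo] --> (0 : 'rV[R]_d).
  apply/cvgr0Pnorm_le => eps eps0.
  have : C * e n @[n --> \oo] --> (0 : R) by rewrite -[X in _ --> X](mulr0 C); exact: cvgMr.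
  move=> /cvgr0Pnorm_le/(_ eps eps0); apply: filterS => n.
  by move=> h; apply: (le_trans (yC n)); exact: le_trans (ler_norm _) h.
apply/cvgr0Pnorm_le => eps eps0.
have C1 : 0 < C + 1 by rewrite ltr_wpDl.
have := oG _ (divr_gt0 eps0 C1) => /ycv; rewrite /nbhs/=; apply: filterS => n /=.
have -> : (G \o shift x - (cst (G x) + 'd G x)) (y n - x) =
    G (y n) - G x - 'd G x (y n - x).
  by rewrite -[LHS]/(G (y n - x + x) - (G x + 'd G x (y n - x))) subrK opprD addrA.
move=> h; have en0 := ltW (e0 n).
rewrite normrZ (@ger0_norm _ (e n)^-1) ?invr_ge0// ler_pdivrMl// mulrC.
apply: (le_trans h); rewrite -mulrA; apply: ler_wpM2l; first exact: ltW.
rewrite ler_pdivrMl//; apply: (le_trans (yC n)); by rewrite ler_wpM2r// lerDl.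
Qed.

Lemma dotp_le (u v : 'rV[R]_d) : `|dotp u v| <= d%:R * (`|u| * `|v|).
Proof.
apply: (le_trans (ler_norm_sum _ _ _)).
have -> : d%:R * (`|u| * `|v|) = \sum_(i < d) `|u| * `|v|.
  by rewrite sumr_const card_ord mulr_natl.
by apply: ler_sum => i _; rewrite normrM ler_pM// ler_coord_norm.
Qed.

Lemma compact_normed_ball (r : R) : compact [set v : 'rV[R]_d | `|v| <= r].
Proof.
apply: bounded_closed_compact.
  by exists r; split; rewrite ?num_real// => M rM v /= vr; exact: le_trans vr (ltW rM).
apply: (@closed_comp _ _ (fun v : 'rV[R]_d => `|v|) [set z | z <= r]).
  by move=> v _; exact: norm_continuous.
exact: closed_le.
Qed.

Lemma locally_lipschitz (j : R -> 'rV[R]_d -> R) (r : R) :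
  (forall t x, I01 t -> differentiable (j t) x) ->
  {within I01 `*` setT, continuous (fun p : R * 'rV[R]_d => grad (j p.1) p.2)} ->
  exists2 K, 0 <= K & forall t x y, I01 t -> `|x| <= r -> `|y| <= r ->
    `|j t y - j t x| <= K * `|y - x|.
Proof.
move=> dj cj.
pose B := @I01 R `*` [set v : 'rV[R]_d | `|v| <= r].
have cB : compact ((fun p : R * 'rV[R]_d => grad (j p.1) p.2) @` B).
  apply: continuous_compact.
    by apply: continuous_subspaceW cj => p [].
  by apply: compact_setX; [exact: segment_compact|exact: compact_normed_ball].
have [M [_ /(_ (`|M| + 1))]] := compact_bounded cB.
rewrite (le_lt_trans (ler_norm M)) ?ltrDl// => /(_ isT) MB.
exists (d%:R * (`|M| + 1)); first by rewrite mulr_ge0// addr_ge0.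
move=> t x y It xr yr.
pose phi (a : R) := j t (x + a *: (y - x)).
have dphi (a : R) : is_derive a (1 : R) phi (dotp (grad (j t) (x + a *: (y - x))) (y - x)).
  set z := x + a *: (y - x); have dz := dj t z It.
  have E : (fun h : R => h^-1 *: ((phi \o shift a) (h *: (1 : R)) - phi a)) =
      (fun h : R => h^-1 *: ((j t \o shift z) (h *: (y - x)) - j t z)).
    apply/funext => h; rewrite /phi /= -/z; congr (_ *: (j t _ - _)).
    by rewrite /z [h *: 1]mulr1 scalerDl addrCA.
  apply: DeriveDef; first by rewrite /derivable E; exact: diff_derivable.
  rewrite /derive E -(diff_grad _ dz) -deriveE//.
have [|c c01] := @MVT_segment R phi (fun a => dotp (grad (j t) (x + a *: (y - x))) (y - x)) 0 1 ler01 (fun a _ => dphi a).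
  by apply: derivable_within_continuous => a _; exact: ex_derive.
rewrite /phi scale1r scale0r addr0 (_ : x + (y - x) = y); last by rewrite addrC subrK.
rewrite subr0 mulr1 => ->.
apply: (le_trans (dotp_le _ _)); rewrite mulrA; apply: ler_wpM2r => //.
rewrite ler_wpM2l//; apply: MB => /=; exists (t, x + c *: (y - x)) => //; split => //=.
move: c01; rewrite in_itv/= => /andP[c0 c1].
have -> : x + c *: (y - x) = (1 - c) *: x + c *: y.
  by rewrite scalerBl scale1r scalerBr addrA addrAC.
apply: (le_trans (ler_normD _ _)); rewrite !normrZ !ger0_norm ?subr_ge0//.
have -> : r = (1 - c) * r + c * r by rewrite mulrBl mul1r subrK.
by apply: lerD; rewrite ler_wpM2l// subr_ge0.
Qed.

End Calculus.

Lemma measurable_Rintegral_param {d1 d2} {X : measurableType d1}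
    {Y : measurableType d2} {R : realType} (Q : probability Y R) (G : X * Y -> R) :
  measurable_fun setT G -> measurable_fun setT (fun x => \int[Q]_y G (x, y)).
Proof.
move=> mG; have meG := (measurable_EFinP _ _).2 mG.
rewrite /Rintegral; apply: (measurableT_comp (@fine_measurable R setT measurableT)).
under eq_fun do rewrite integralE.
apply: emeasurable_funB.
- have := @measurable_fun_fubini_tonelli_F _ _ X Y R Q _
    (measurable_funepos meG) (funepos_ge0 _).
  by apply: eq_measurable_fun => x _; apply: eq_integral => y _; rewrite !funeposE.
- have := @measurable_fun_fubini_tonelli_F _ _ X Y R Q _
    (measurable_funeneg meG) (funeneg_ge0 _).
  by apply: eq_measurable_fun => x _; apply: eq_integral => y _; rewrite !funenegE.
Qed.

Section Threshold.
Context {dsp : measure_display} {T : measurableType dsp} {R : realType}.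
Variable Q : probability (borelR R) R.
Variables (pr : T -> borelR R) (w : borelR R -> R).
Hypothesis mpr : measurable_fun setT pr.
Hypothesis wi : Q.-integrable setT (EFin \o w).

Let mw : measurable_fun setT w. Proof. exact: integrable_measurable wi. Qed.

Let mk : measurable_fun setT
  (fun ps : T * borelR R => (pr ps.1 <= ps.2)%R%:R * w ps.2).
Proof.
apply: measurable_funM; last exact: measurableT_comp mw _.
by apply: measurable_le_natr => //; exact: measurableT_comp.
Qed.

Let ki p : Q.-integrable setT (EFin \o (fun s => (pr p <= s)%R%:R * w s)).
Proof.
apply: integrable_le_norm wi _.
  by apply: measurable_funM => //; apply: measurable_le_natr => //; exact: measurable_cst.
by move=> s; rewrite normrM ler_piMl//; case: (pr p <= s)%R; rewrite ?normr1 ?normr0.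
Qed.

Lemma measurable_threshold :
  measurable_fun setT (fun p => \int[Q]_s ((pr p <= s)%R%:R * w s)).
Proof. exact: measurable_Rintegral_param mk. Qed.

Lemma threshold_bounded p :
  `|\int[Q]_s ((pr p <= s)%R%:R * w s)| <= \int[Q]_s `|w s|.
Proof.
apply: (le_trans (le_normr_Rintegral measurableT (ki p))).
apply: le_Rintegral; [exact: measurableT|exact: integrable_norm (ki p)|exact: integrable_norm wi|].
by move=> s _; rewrite normrM ler_piMl//; case: (pr p <= s)%R; rewrite ?normr1 ?normr0.
Qed.

End Threshold.

Lemma continuous_sum {T : topologicalType} {R : realType} (n : nat)
    (F : 'I_n -> T -> R) : (forall i, continuous (F i)) ->
  continuous (fun t => \sum_i F i t).
Proof.
move=> cF; elim: (index_enum _) => [|i r IH].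
  by under eq_fun do rewrite big_nil; move=> t; exact: cvg_cst.
under eq_fun do rewrite big_cons.
by move=> t; apply: cvgD; [exact: cF|exact: IH].
Qed.

Section Duality.
Context {R : realType} {d : nat}.
Variables (gamma : probability (borelR2 R) R) (gammaP : Gamma gamma).
Variables (nus : R -> probability (borelR R) R) (nusP : disintegration2 gamma nus).
Variables (q : 'I_d -> R -> R) (a : 'I_d -> R) (b : 'I_d -> R -> R).
Variables (jac : 'I_d -> 'I_d -> R -> R) (rho : 'I_d -> R * R -> R).
Variables (delta : 'I_d -> R -> R) (M : R).
Hypothesis mq : forall i, measurable_fun setT (q i : borelR R -> R).
Hypothesis qi : forall i, (@lebesgue_measure R).-integrable I01 (EFin \o q i).
Hypothesis cb : forall i, continuous (b i).
Hypothesis bM : forall i s, `|b i s| <= M.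
Hypothesis cjac : forall i k, continuous (jac i k).
Hypothesis jacM : forall i k s, `|jac i k s| <= M.
Hypothesis mrho : forall i, measurable_fun setT (rho i : borelR2 R -> R).
Hypothesis rhoM : forall i p, `|rho i p| <= M.
Hypothesis cdelta : forall i, continuous (delta i).
Hypothesis deltaM : forall i s, `|delta i s| <= M.
Hypothesis deltaE : forall i s, I01 s ->
  delta i s = \int[gamma]_p ((p.1 <= s)%R%:R * rho i p).

Let P1 := marginal1 gamma.
Let P2 := marginal2 gamma.

Let V i s := \sum_k fiber_mean2 nus (q k) s * jac i k s.

Hypothesis qE : {ae gamma, forall p, forall i, q i p.1 =
  - a i - \int[P1]_s ((p.1 <= s)%R%:R * b i s) + \int[P2]_s ((p.1 <= s)%R%:R * V i s)}.

Let Vi i : P2.-integrable setT (EFin \o V i).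
Proof.
apply: integrable_sumR => k; apply: (integrable_mul_bounded (M := M)) => //.
- exact: integrable_fiber_mean2.
- exact: continuous_measurable_fun.
Qed.

Let bi i : P1.-integrable setT (EFin \o b i).
Proof.
by apply: (@bounded_integrable _ _ _ _ _ M) => //; exact: continuous_measurable_fun.
Qed.

Let rhoi i : gamma.-integrable setT (EFin \o (rho i : borelR2 R -> R)).
Proof. exact: bounded_integrable. Qed.

Let P1_I01 : {ae P1, forall s, I01 s}.
Proof.
apply: ae_full; first exact: measurable_I01.
apply: (full_subset measurable_triangle (measurable_preimage_fst measurable_I01)) gammaP.1.
by move=> p [[]].
Qed.

Let P2_I01 : {ae P2, forall s, I01 s}.
Proof. by apply: ae_full; [exact: measurable_I01|exact: marginal2_I01]. Qed.

Let fubini (P : probability (borelR R) R) (w : R -> R) i :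
  {ae P, forall s, I01 s} -> P.-integrable setT (EFin \o w) ->
  \int[gamma]_p (rho i p * \int[P]_s ((p.1 <= s)%R%:R * w s)) =
  \int[P]_s (w s * delta i s).
Proof.
move=> PI wi; have mw := integrable_measurable wi.
rewrite -(@Fubini_threshold _ _ _ gamma P fst (rho i) w)//.
have mdelta : measurable_fun setT (delta i : borelR R -> R).
  exact: continuous_measurable_fun.
apply: ae_eq_Rintegral; last by apply: ae_imp PI => s Is; rewrite deltaE.
- apply: measurable_funM => //.
  apply: (@measurable_Rintegral_param _ _ (borelR R) (borelR2 R) R gamma
    (fun sp => (sp.2.1 <= sp.1)%R%:R * rho i sp.2)).
  apply: measurable_funM; last exact: measurableT_comp (mrho i) _.
  apply: measurable_le_natr => //.
  by apply: (@measurableT_comp _ _ _ _ _ _ fst) => //; exact: measurable_fst.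
- exact: measurable_funM.
Qed.

Lemma duality :
  \sum_i a i * delta i 1 + \int[P1]_s (\sum_i b i s * delta i s) =
  \sum_k \int[gamma]_p (q k p.1 * (\sum_i delta i p.2 * jac i k p.2 - rho k p)).
Proof.
have md i : measurable_fun setT (delta i : borelR R -> R) by exact: continuous_measurable_fun.
have mj i k : measurable_fun setT (jac i k : borelR R -> R) by exact: continuous_measurable_fun.
have qgi k := integrable_marginal1 gammaP (mq k) (qi k).
have M0 : 0 <= M * M by exact: sqr_ge0 M.
pose dj k s := \sum_i delta i s * jac i k s.
have cdj k : continuous (dj k).
  by apply: continuous_sum => i s; apply: cvgM; [exact: cdelta|exact: cjac].
have djM k s : `|dj k s| <= \sum_(i < d) M * M.
  apply: (le_trans (ler_norm_sum _ _ _)); apply: ler_sum => i _.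
  by rewrite normrM ler_pM.
have mdj k : measurable_fun setT (dj k : borelR R -> R) by exact: continuous_measurable_fun.
have mdj2 k : measurable_fun setT (fun p : borelR2 R => dj k p.2).
  exact: measurableT_comp (mdj k) _.
have rhoq i : \int[gamma]_p (q i p.1 * rho i p) =
    - (a i * delta i 1) - \int[P1]_s (b i s * delta i s) + \int[P2]_s (V i s * delta i s).
  rewrite -(fubini i P1_I01 (bi i)) -(fubini i P2_I01 (Vi i)).
  have mfst : measurable_fun setT (fst : borelR2 R -> borelR R) by exact: measurable_fst.
  have mB := measurable_threshold mfst (bi i).
  have mU := measurable_threshold mfst (Vi i).
  have iB := integrable_mul_bounded (rhoi i) mB
    (fun p => ltac:(apply: threshold_bounded => //; exact: bi)).
  have iU := integrable_mul_bounded (rhoi i) mU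
    (fun p => ltac:(apply: threshold_bounded => //; exact: Vi)).
  have -> : delta i 1 = \int[gamma]_p rho i p.
    rewrite deltaE ?/I01/= ?in_itv/= ?ler01 ?lexx//.
    apply: ae_eq_Rintegral => //.
      by apply: measurable_funM => //; exact: measurable_before.
    apply: ae_imp (Gamma_ae_triangle gammaP) => p [[+ _] _].
    by rewrite /I01/= in_itv/= => /andP[_ ->]; rewrite mul1r.
  transitivity (\int[gamma]_p (- a i * rho i p - rho i p * \int[P1]_s ((p.1 <= s)%R%:R * b i s)
     + rho i p * \int[P2]_s ((p.1 <= s)%R%:R * V i s))).
    apply: ae_eq_Rintegral.
    - by apply: measurable_funM => //; exact: measurableT_comp (mq i) _.
    - apply: measurable_funD; first apply: measurable_funB.
      + exact: measurable_funM.
      + exact: measurable_funM.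
      + exact: measurable_funM.
    - apply: ae_imp qE => p ->; ring.
  have iA : gamma.-integrable setT (EFin \o (fun p => - a i * rho i p)).
    by have := integrableZl measurableT (- a i) (rhoi i); apply: eq_integrable.
  rewrite RintegralD//; last first.
    by have := integrableB measurableT iA iB; apply: eq_integrable.
  by rewrite RintegralB// RintegralZl// mulNr.
have dji k : gamma.-integrable setT (EFin \o (fun p : borelR2 R => q k p.1 * dj k p.2)).
  exact: integrable_mul_bounded (qgi k) (mdj2 k) (fun p => djM k p.2).
have rqi k : gamma.-integrable setT (EFin \o (fun p : borelR2 R => q k p.1 * rho k p)).
  exact: integrable_mul_bounded (qgi k) (mrho k) (rhoM k).
have -> : \sum_k \int[gamma]_p (q k p.1 * (\sum_i delta i p.2 * jac i k p.2 - rho k p)) =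
    \sum_k \int[P2]_s (fiber_mean2 nus (q k) s * dj k s) -
    \sum_k \int[gamma]_p (q k p.1 * rho k p).
  rewrite -sumrB; apply: eq_bigr => k _.
  rewrite -(Rintegral_disintegration2_mul gammaP nusP (mq k) (qi k) (cdj k) (djM k)).
  by rewrite -RintegralB//; apply: eq_Rintegral => p _; rewrite mulrBr.
have fdi k : P2.-integrable setT (EFin \o (fun s => fiber_mean2 nus (q k) s * dj k s)).
  apply: (integrable_mul_bounded _ (mdj k) (djM k)).
  exact: integrable_fiber_mean2.
have Vdi i : P2.-integrable setT (EFin \o (fun s => V i s * delta i s)).
  exact: integrable_mul_bounded (Vi i) (md i) (deltaM i).
have bdi i : P1.-integrable setT (EFin \o (fun s => b i s * delta i s)).
  exact: integrable_mul_bounded (bi i) (md i) (deltaM i).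
have -> : \sum_k \int[P2]_s (fiber_mean2 nus (q k) s * dj k s) =
    \sum_i \int[P2]_s (V i s * delta i s).
  rewrite -Rintegral_sum// -Rintegral_sum//; apply: eq_Rintegral => s _.
  under eq_bigr do rewrite /dj mulr_sumr.
  rewrite exchange_big/=; apply: eq_bigr => i _.
  by rewrite /V mulr_suml; apply: eq_bigr => k _; ring.
rewrite Rintegral_sum// -sumrB -big_split/=; apply: eq_bigr => i _.
by rewrite rhoq; ring.
Qed.

End Duality.

Section PerturbedTrajectory.
Context {R : realType} {d : nat}.
Local Notation mu := (@lebesgue_measure R).
Variables (f : R -> 'rV[R]_d -> 'rV[R]_d) (x0 : 'rV[R]_d) (L : R).
Hypothesis f_cont : {within I01 `*` setT,
  continuous (fun p : R * 'rV[R]_d => f p.1 p.2)}.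
Hypothesis L0 : 0 < L.
Hypothesis f_lip : forall t y z, I01 t -> `|f t y - f t z| <= L * `|y - z|.
Variables (gamma : probability (borelR2 R) R) (gammaP : Gamma gamma).
Variables (nu : R -> probability (borelR R) R) (nuP : disintegration1 gamma nu).
Variables (A : set (borelR R)) (s0 : R) (mA : measurable A).
Hypothesis A_s0 : forall t, A t -> s0 <= t.
Hypothesis s0_I01 : I01 s0.

Lemma trajectory_perturbation (e : R) (e01 : 0 <= e <= 1) (M : R) :
  (forall s, `|field f (trajectory f x0 gamma) s| <= M) ->
  forall t, I01 t ->
  `|trajectory f x0 (perturbed_plan s0 mA gamma e01) t - trajectory f x0 gamma t| <=
    4 * M * expR (2 * L) * e.
Proof.
set x := trajectory f x0 gamma; set ge := perturbed_plan _ _ _ _.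
set xe := trajectory f x0 ge => FM t It.
have M0 : 0 <= M by exact: le_trans (normr_ge0 _) (FM 0).
have /andP[e0 e1] := e01.
have geP : Gamma ge by exact: perturbed_plan_Gamma.
have [cx xE] := trajectoryP x0 f_cont L0 f_lip gammaP (ex_intro _ nu nuP).
have [cxe xeE] := trajectoryP x0 f_cont L0 f_lip geP
  (ex_intro _ _ (perturbed_disintegration1 mA A_s0 s0_I01 gammaP nuP e01)).
have shift t' : I01 t' -> `|flow f x0 ge x t' - flow f x0 gamma x t'| <= e * (M + M).
  move=> It'; rewrite /flow opprD addrACA subrr add0r.
  apply: rV_norm_le; first by rewrite mulr_ge0// addr_ge0.
  move=> i; rewrite !mxE /flow_coord.
  pose phi (p : R * R) := (p.1 <= t')%R%:R * field f x p.2 0 i.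
  have mphi : measurable_fun setT (phi : borelR2 R -> R).
    apply: measurable_funM; first exact: measurable_before.
    exact: measurableT_comp (measurable_field f_cont i cx) _.
  have Fi s : `|field f x s 0 i| <= M by exact: le_trans (ler_coord_norm _ _) (FM s).
  have phiM p : `|phi p| <= M.
    rewrite /phi normrM; apply: le_trans (Fi p.2); rewrite ler_piMl//.
    by case: (p.1 <= t')%R; rewrite ?normr1 ?normr0.
  rewrite (Rintegral_perturbed_plan s0 mA gamma e01 mphi phiM) addrAC subrr add0r.
  rewrite normrM (ger0_norm e0) ler_wpM2l//; apply: Rintegral_norm_le.
    apply: measurable_funB => //; apply: measurableT_comp mphi _.
    exact: measurable_needle.
  by move=> p; rewrite (le_trans (ler_normB _ _))// lerD.
have cdiff : continuous (fun s => `|xe (clamp s) - x (clamp s)|).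
  move=> s; apply: cvg_norm; apply: cvgB.
    exact: (continuous_within_comp cxe (@clamp_I01 R) (@continuous_clamp R)).
  exact: (continuous_within_comp cx (@clamp_I01 R) (@continuous_clamp R)).
have [K K0 KP] := continuous_clamp_bounded cdiff.
have := @bielecki_halving R (fun t => `|xe t - x t|) (2 * L) (e * (M + M)) _ _ _ _ t It.
rewrite (_ : 4 * M * expR (2 * L) * e = 2 * (e * (M + M)) * expR (2 * L)); last by ring.
move=> h; apply: le_trans (h _ _ _ _) _.
- by rewrite mulr_ge0// addr_ge0.
- by rewrite mulr_ge0// ltW.
- exists K => t' It'; have := KP t'.
  by rewrite !clampK !clamp_id// normr_id.
- move=> C C0 hC t' It';
  have -> : xe t' = flow f x0 ge xe t' by exact: xeE.
  have -> : x t' = flow f x0 gamma x t' by exact: xE.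
  rewrite -(subrKA (flow f x0 ge x t')).
  apply: (le_trans (ler_normD _ _)); apply: lerD; last exact: shift.
  exact: (flow_contraction x0 f_cont L0 f_lip geP cxe cx C0 hC It').
- apply: ler_wpM2l; first by rewrite !mulr_ge0// addr_ge0.
  rewrite ler_expR; move: It; rewrite /I01/= in_itv/= => /andP[_ t1].
  by rewrite ler_piMr// mulr_ge0// ltW.
Qed.

End PerturbedTrajectory.

Section AdjointEquation.
Context {R : realType} {d : nat}.
Local Notation mu := (@lebesgue_measure R).
Variables (gamma : probability (borelR2 R) R) (gammaP : Gamma gamma).

Lemma Rintegral_marginal1_lebesgue (w : R -> R) :
  measurable_fun setT (w : borelR R -> R) -> mu.-integrable I01 (EFin \o w) ->
  \int[marginal1 gamma]_s w s = \int[mu]_(s in I01) w s.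
Proof.
move=> mw wi; rewrite -(Rintegral_marginal1 gammaP mw).
by apply: Rintegral_distribution => //; exact: (integrable_marginal1 gammaP mw wi).
Qed.

Lemma bounded_integrable_I01 (w : R -> R) M :
  measurable_fun setT (w : borelR R -> R) -> (forall s, `|w s| <= M) ->
  mu.-integrable I01 (EFin \o w).
Proof.
move=> mw wM; apply: measurable_bounded_integrable.
- exact: measurable_I01.
- exact: lebesgue_I01.
- exact: measurable_funTS.
- by exists M; split; rewrite ?num_real// => y My s _; exact: le_trans (wM s) (ltW My).
Qed.

Lemma Rintegral_tail (P : probability (borelR R) R) (w : R -> R) t :
  {ae P, forall s, I01 s} -> measurable_fun setT (w : borelR R -> R) ->
  \int[P]_(s in `[t, 1]) w s = \int[P]_s ((t <= s)%R%:R * w s).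
Proof.
move=> PI mw; rewrite Rintegral_mkcond.
have mI : measurable (`[t, 1]%classic : set (borelR R)) by exact: measurable_itv.
apply: ae_eq_Rintegral.
- by apply/(measurable_restrictT _ mI); exact: measurable_funTS.
- apply: measurable_funM => //; apply: measurable_le_natr; first exact: measurable_cst.
  exact: measurable_id.
- apply: ae_imp PI => s; rewrite /I01/= in_itv/= => /andP[_ s1]; rewrite patchE.
  have [ts|st] := leP t s; first by rewrite mem_set/= ?mul1r// in_itv/= ts.
  by rewrite memNset/= ?mul0r// in_itv/= leNgt st.
Qed.

Variables (f : R -> 'rV[R]_d -> 'rV[R]_d) (j : R -> 'rV[R]_d -> R) (h : 'rV[R]_d -> R).
Variables (nus : R -> probability (borelR R) R) (nusP : disintegration2 gamma nus).
Variables (x q : R -> 'rV[R]_d).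
Hypothesis qP : is_adjoint f j h gamma nus x q.

Definition adjoint_coord (k : 'I_d) (t : R) := q (clamp t) 0 k.
Definition cost_grad (i : 'I_d) (s : R) := grad (j (clamp s)) (x (clamp s)) 0 i.
Definition field_jac (i k : 'I_d) (s : R) := ('J (f (clamp s)) (x (clamp s))) i k.

Lemma measurable_adjoint_coord k : measurable_fun setT (adjoint_coord k : borelR R -> R).
Proof.
have /measurable_int/measurable_EFinP mq := qP.1 k.
apply: (measurable_comp measurable_I01 _ mq measurable_clamp).
by move=> _ [t _ <-]; exact: clamp_I01.
Qed.

Lemma integrable_adjoint_coord k : mu.-integrable I01 (EFin \o adjoint_coord k).
Proof.
apply: eq_integrable (qP.1 k); first exact: measurable_I01.
by move=> t /set_mem It; rewrite /adjoint_coord /= clamp_id.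
Qed.

Variable M : R.
Hypothesis cb : forall i, continuous (cost_grad i).
Hypothesis bM : forall i s, `|cost_grad i s| <= M.
Hypothesis cjac : forall i k, continuous (field_jac i k).

Lemma adjoint_equation : {ae gamma, forall p, forall i, adjoint_coord i p.1 =
  - grad h (x 1) 0 i
  - \int[marginal1 gamma]_s ((p.1 <= s)%R%:R * cost_grad i s)
  + \int[marginal2 gamma]_s ((p.1 <= s)%R%:R *
      \sum_k fiber_mean2 nus (adjoint_coord k) s * field_jac i k s)}.
Proof.
have qE := marginal1_ae gammaP qP.2.
apply: ae_imp2 (Gamma_ae_triangle gammaP) qE => p [[Ip _] _] qp i.
rewrite /adjoint_coord (clamp_id Ip) qp !mxE; congr (_ - _ + _).
- have mb : measurable_fun setT (cost_grad i : borelR R -> R).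
    exact: continuous_measurable_fun.
  have mk : measurable_fun setT (fun s : borelR R => (p.1 <= s)%R%:R * cost_grad i s).
    apply: measurable_funM => //; apply: measurable_le_natr; first exact: measurable_cst.
    exact: measurable_id.
  rewrite Rintegral_marginal1_lebesgue//; last first.
    apply: (bounded_integrable_I01 (M := M)) => // s; rewrite normrM.
    by apply: le_trans (bM i s); rewrite ler_piMl//; case: (p.1 <= s)%R; rewrite ?normr1 ?normr0.
  have -> : `[p.1, 1]%classic = @I01 R `&` `[p.1, 1]%classic.
    apply/seteqP; split => s /=; rewrite /I01/= !in_itv/=; last by case.
    move: Ip; rewrite /I01/= in_itv/= => /andP[p0 _] /andP[ps s1].
    by rewrite ps s1 (le_trans p0 ps).
  rewrite Rintegral_mkcondr; apply: eq_Rintegral => s /set_mem Is.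
  rewrite patchE /cost_grad (clamp_id Is).
  move: Is; rewrite /I01/= in_itv/= => /andP[s0 s1].
  have [ps|sp] := leP p.1 s; first by rewrite mem_set/= ?mul1r// in_itv/= ps.
  by rewrite memNset/= ?mul0r// in_itv/= leNgt sp.
- rewrite -Rintegral_tail; last 2 first.
  + by apply: ae_full; [exact: measurable_I01|exact: marginal2_I01].
  + have mq := measurable_adjoint_coord.
    apply: measurable_sum => k; apply: measurable_funM.
      exact: (measurable_fiber_mean2 nusP (mq k)).
    exact: continuous_measurable_fun.
  apply: eq_Rintegral => s /set_mem/=; rewrite in_itv/= => /andP[ps s1].
  have Is : I01 s.
    move: Ip; rewrite /I01/= !in_itv/= => /andP[p0 _].
    by rewrite s1 (le_trans p0 ps).
  rewrite mxE; apply: eq_bigr => k _.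
  rewrite [X in X * _]mxE [X in _ * X]mxE /field_jac /fiber_mean2 (clamp_id Is).
  congr (_ * _); apply: eq_Rintegral => t /set_mem It.
  by rewrite /adjoint_coord (clamp_id It).
Qed.

End AdjointEquation.

(** * The first variation of the cost *)

Section FirstVariation.
Context {R : realType} {d : nat}.
Local Notation mu := (@lebesgue_measure R).
Variables (f : R -> 'rV[R]_d -> 'rV[R]_d) (x0 : 'rV[R]_d) (L : R).
Variables (j : R -> 'rV[R]_d -> R) (h : 'rV[R]_d -> R) (g : R -> R -> R).
Hypothesis f_cont : {within I01 `*` setT,
  continuous (fun p : R * 'rV[R]_d => f p.1 p.2)}.
Hypothesis L0 : 0 < L.
Hypothesis f_lip : forall t y z, I01 t -> `|f t y - f t z| <= L * `|y - z|.
Hypothesis j_cont : {within I01 `*` setT,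
  continuous (fun p : R * 'rV[R]_d => j p.1 p.2)}.
Hypothesis g_cont : {within triangle, continuous (fun p : R * R => g p.1 p.2)}.
Hypothesis h_diff : forall y, differentiable h y.
Hypothesis j_diff : forall t y, I01 t -> differentiable (j t) y.
Hypothesis f_diff : forall t y, I01 t -> differentiable (f t) y.
Hypothesis j_C1 : {within I01 `*` setT,
  continuous (fun p : R * 'rV[R]_d => grad (j p.1) p.2)}.
Hypothesis f_C1 : {within I01 `*` setT,
  continuous (fun p : R * 'rV[R]_d => 'J (f p.1) p.2)}.
Variables (gamma : probability (borelR2 R) R) (gammaP : Gamma gamma).
Hypothesis gamma_min : forall gamma', Gamma gamma' ->
  cost f x0 j h g gamma <= cost f x0 j h g gamma'.
Variables (nu nus : R -> probability (borelR R) R).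
Hypotheses (nuP : disintegration1 gamma nu) (nusP : disintegration2 gamma nus).
Variable q : R -> 'rV[R]_d.
Let x := trajectory f x0 gamma.
Hypothesis qP : is_adjoint f j h gamma nus x q.
Variables (A : set (borelR R)) (s0 : R) (mA : measurable A).
Hypothesis A_s0 : forall t, A t -> s0 <= t.
Hypothesis s0_I01 : I01 s0.

Definition gext (p : R * R) : R := g (clamp2 p).1 (clamp2 p).2.

Lemma continuous_gext : continuous gext.
Proof.
exact: (continuous_within_comp g_cont (@clamp2_triangle R) (@continuous_clamp2 R)).
Qed.

Lemma gext_bounded : exists2 M, 0 <= M & forall p, `|gext p| <= M.
Proof.
have [M M0 gM] := continuous_sq01_bounded continuous_gext.
exists M => // p; have -> : gext p = gext (clamp2 p).
  by rewrite /gext (clamp2_id (clamp2_triangle p)).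
by apply: gM; case: (clamp2_triangle p).
Qed.

Lemma Rintegral_gext (P : probability (borelR2 R) R) : Gamma P ->
  \int[P]_(p in triangle) g p.1 p.2 = \int[P]_p gext p.
Proof.
move=> PP; apply: Rintegral_full.
- exact: measurable_triangle.
- exact: PP.1.
- exact: continuous_measurable_plane continuous_gext.
- by move=> p /set_mem pT; rewrite /gext clamp2_id.
Qed.

Let cx : {within I01, continuous x}.
Proof. by have [] := trajectoryP x0 f_cont L0 f_lip gammaP (ex_intro _ nu nuP). Qed.

Let continuous_along (Y : topologicalType) (F : R -> 'rV[R]_d -> Y) (y : R -> 'rV[R]_d) :
  {within I01 `*` setT, continuous (fun p : R * 'rV[R]_d => F p.1 p.2)} ->
  {within I01, continuous y} -> continuous (fun s => F (clamp s) (y (clamp s))).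
Proof.
move=> cF cy.
have cyc := continuous_within_comp cy (@clamp_I01 R) (@continuous_clamp R).
apply: (@continuous_within_comp _ _ _ _ (fun p : R * 'rV[R]_d => F p.1 p.2)
  (fun s => (clamp s, y (clamp s))) cF).
  by move=> s; split => //=; exact: clamp_I01.
move=> s; apply: (@cvg_pair _ _ _ _ (nbhs (clamp s)) (nbhs (y (clamp s)))).
  exact: continuous_clamp.
exact: cyc.
Qed.

Let e (n : nat) : R := n.+1%:R^-1.

Let e_gt0 n : 0 < e n. Proof. by rewrite invr_gt0. Qed.

Let e01 n : 0 <= e n <= 1.
Proof. by rewrite ltW//= invf_le1// ler1n. Qed.

Let e_cvg : e n @[n --> \oo] --> (0 : R).
Proof. exact: cvg_harmonic. Qed.

Let gam n := perturbed_plan s0 mA gamma (e01 n).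
Let xn n := trajectory f x0 (gam n).

Let gamP n : Gamma (gam n). Proof. exact: perturbed_plan_Gamma. Qed.

Let cxn n : {within I01, continuous (xn n)}.
Proof.
have := trajectoryP x0 f_cont L0 f_lip (gamP n)
  (ex_intro _ _ (perturbed_disintegration1 mA A_s0 s0_I01 gammaP nuP (e01 n))).
by case.
Qed.

Let xE t : I01 t -> x t = flow f x0 gamma x t.
Proof. by have [_] := trajectoryP x0 f_cont L0 f_lip gammaP (ex_intro _ nu nuP); apply. Qed.

Let xnE n t : I01 t -> xn n t = flow f x0 (gam n) (xn n) t.
Proof.
have := trajectoryP x0 f_cont L0 f_lip (gamP n)
  (ex_intro _ _ (perturbed_disintegration1 mA A_s0 s0_I01 gammaP nuP (e01 n))).
by case=> _; apply.
Qed.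

Let delta n s := xn n (clamp s) - x (clamp s).

Let cdelta n : continuous (delta n).
Proof.
have c1 : continuous (fun s => xn n (clamp s)).
  exact: (continuous_within_comp (@cxn n) (@clamp_I01 R) (@continuous_clamp R)).
have c2 : continuous (fun s => x (clamp s)).
  exact: (continuous_within_comp cx (@clamp_I01 R) (@continuous_clamp R)).
by move=> s; apply: cvgB; [exact: c1|exact: c2].
Qed.

Let delta_le : exists2 C, 0 <= C & forall n s, `|delta n s| <= C * e n.
Proof.
have [M M0 FM] := field_bounded f_cont cx.
exists (4 * M * expR (2 * L)); first by rewrite !mulr_ge0// expR_ge0.
by move=> n s; apply: (trajectory_perturbation f_cont L0 f_lip gammaP nuP); last exact: clamp_I01.
Qed.

Let rho n i (p : R * R) := (field f (xn n) p.2 0 i - field f x p.2 0 i) +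
  e n * (field f (xn n) (needle A s0 p).2 0 i - field f (xn n) p.2 0 i).

Let mfield_snd (y : R -> 'rV[R]_d) i : {within I01, continuous y} ->
  measurable_fun setT (fun p : borelR2 R => field f y p.2 0 i).
Proof. by move=> cy; exact: measurableT_comp (measurable_field f_cont i cy) _. Qed.

Let mfield_needle (y : R -> 'rV[R]_d) i : {within I01, continuous y} ->
  measurable_fun setT (fun p : borelR2 R => field f y (needle A s0 p).2 0 i).
Proof.
move=> cy; apply: (measurableT_comp (measurable_field f_cont i cy)).
by apply: (measurableT_comp measurable_snd); exact: measurable_needle.
Qed.

Let mrho n i : measurable_fun setT (rho n i : borelR2 R -> R).
Proof.
have m1 := measurable_funB (mfield_snd i (@cxn n)) (mfield_snd i cx).
have m2 := measurable_funB (mfield_needle i (@cxn n)) (mfield_snd i (@cxn n)).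
exact: (measurable_funD m1 (measurable_funM (measurable_cst (e n)) m2)).
Qed.

Let deltaE n i t : I01 t ->
  delta n t 0 i = \int[gamma]_p ((p.1 <= t)%R%:R * rho n i p).
Proof.
have fl P y : (flow f x0 P y t) 0 i = x0 0 i + flow_coord f P y i t.
  by rewrite /flow !mxE.
move=> It; rewrite /delta (clamp_id It) mxE [X in _ + X]mxE xnE// xE// !fl.
rewrite opprD addrACA subrr add0r /flow_coord.
have [M M0 FM] := field_bounded f_cont (@cxn n).
pose phi (p : R * R) := (p.1 <= t)%R%:R * field f (xn n) p.2 0 i.
have mphi : measurable_fun setT (phi : borelR2 R -> R).
  exact: (measurable_funM (measurable_before t) (mfield_snd i (@cxn n))).
have phiM p : `|phi p| <= M.
  rewrite /phi normrM; apply: le_trans (le_trans (ler_coord_norm _ i) (FM p.2)).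
  by rewrite ler_piMl//; case: (p.1 <= t)%R; rewrite ?normr1 ?normr0.
rewrite (Rintegral_perturbed_plan s0 mA gamma (e01 n) mphi phiM).
have iphi : gamma.-integrable setT (EFin \o (phi : borelR2 R -> R)).
  exact: bounded_integrable mphi phiM.
have ix : gamma.-integrable setT (EFin \o
    (fun p : borelR2 R => (p.1 <= t)%R%:R * field f x p.2 0 i)).
  by apply: integrable_before; exact: (integrable_field f_cont gamma i cx).
have iN : gamma.-integrable setT (EFin \o (fun p : borelR2 R => phi (needle A s0 p) - phi p)).
  apply: (@bounded_integrable _ _ _ _ _ (M + M)).
    apply: measurable_funB => //; apply: measurableT_comp mphi _; exact: measurable_needle.
  by move=> p; rewrite (le_trans (ler_normB _ _))// lerD.
have ieN : gamma.-integrable setT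
    (EFin \o (fun p : borelR2 R => e n * (phi (needle A s0 p) - phi p))).
  by have := integrableZl measurableT (e n) iN; apply: eq_integrable.
rewrite addrAC -RintegralB// -RintegralZl// -RintegralD//; last first.
  by have := integrableB measurableT iphi ix; apply: eq_integrable.
by apply: eq_Rintegral => p _; rewrite /phi /rho /needle/=; ring.
Qed.

Let F (k : 'I_d) s := field f x s 0 k.

Let Delta n := \sum_i grad h (x 1) 0 i * delta n 1 0 i +
  \int[marginal1 gamma]_s (\sum_i cost_grad j x i s * delta n s 0 i).

Let Phi n (k : 'I_d) p :=
  \sum_i delta n p.2 0 i * field_jac f x i k p.2 - rho n k p.

Let M1 : exists2 M, 0 <= M & [/\ forall i s, `|cost_grad j x i s| <= M,
  forall i k s, `|field_jac f x i k s| <= M & forall s, `|field f x s| <= M].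
Proof.
have [M M0 FM] := field_bounded f_cont cx.
have cb : continuous (fun s => `|grad (j (clamp s)) (x (clamp s))|).
  move=> s; apply: cvg_norm; exact: (continuous_along (F := fun t => grad (j t)) j_C1 cx).
have [Mb Mb0 bM] := continuous_clamp_bounded cb.
have cJ : continuous (fun s => `|'J (f (clamp s)) (x (clamp s))|).
  move=> s; apply: cvg_norm; exact: (continuous_along (F := fun t => jacobian (f t)) f_C1 cx).
have [MJ MJ0 JM] := continuous_clamp_bounded cJ.
exists (M + Mb + MJ); first by rewrite !addr_ge0.
split=> [i s|i k s|s].
- apply: (le_trans (ler_coord_norm _ _)); have := bM s; rewrite clampK normr_id => bs.
  by rewrite (le_trans bs)// addrAC lerDr addr_ge0.
- have := JM s; rewrite clampK normr_id => Js; apply: (@le_trans _ _ MJ).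
    apply: le_trans Js; rewrite /field_jac /Num.norm/= mx_normE.
    exact: (@le_bigmax _ _ _ _ (fun ik => `|'J (f (clamp s)) (x (clamp s)) ik.1 ik.2|%:nng) (i, k)).
  by rewrite lerDr addr_ge0.
- by rewrite (le_trans (FM s))// -addrA lerDl addr_ge0.
Qed.

Let cb i : continuous (cost_grad j x i).
Proof. exact: continuous_coord (continuous_along (F := fun t => grad (j t)) j_C1 cx) i. Qed.

Let cjac i k : continuous (field_jac f x i k).
Proof.
have cJ := continuous_along (F := fun t => jacobian (f t)) f_C1 cx.
move=> s; exact: (continuous_comp (cJ s) (@coord_continuous _ _ _ i k _)).
Qed.

Let rho_le : exists2 B, 0 <= B & forall n k p, `|rho n k p| <= B * e n.
Proof.
have [M M0 [_ _ FM]] := M1; have [C C0 dC] := delta_le.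
exists (L * C + (M + L * C + (M + L * C))); first by rewrite !(addr_ge0, mulr_ge0)// ltW.
have e1 n : e n <= 1 by case/andP: (e01 n).
have d1 n k s : `|field f (xn n) s 0 k - field f x s 0 k| <= L * C * e n.
  have -> : field f (xn n) s 0 k - field f x s 0 k = (field f (xn n) s - field f x s) 0 k.
    by rewrite !mxE.
  apply: (le_trans (ler_coord_norm _ _)); apply: (le_trans (field_lip f_lip _ _ _)).
  by rewrite -mulrA ler_pM2l//; exact: dC.
have FnM n k s : `|field f (xn n) s 0 k| <= M + L * C.
  rewrite -(subrK (field f x s 0 k) (field f (xn n) s 0 k)) addrC.
  apply: (le_trans (ler_normD _ _)); apply: lerD.
    exact: le_trans (ler_coord_norm _ _) (FM s).
  apply: (le_trans (d1 n k s)); by rewrite ler_piMr// mulr_ge0// ltW.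
move=> n k p; rewrite /rho mulrDl; apply: (le_trans (ler_normD _ _)); apply: lerD => //.
rewrite normrM (ger0_norm (ltW (e_gt0 n))) mulrC; apply: ler_wpM2r; first exact: ltW.
by rewrite (le_trans (ler_normB _ _))// lerD.
Qed.

Let variation_identity n : Delta n =
  \sum_k \int[gamma]_p (adjoint_coord q k p.1 * Phi n k p).
Proof.
have [M M0 [bM jM FM]] := M1; have [C C0 dC] := delta_le; have [B B0 rB] := rho_le.
have e1 : e n <= 1 by case/andP: (e01 n).
have qE := adjoint_equation gammaP nusP qP cb bM cjac.
apply: (@duality _ _ gamma gammaP nus nusP (adjoint_coord q) (fun i => grad h (x 1) 0 i)
  (cost_grad j x) (field_jac f x) (rho n) (fun i s => delta n s 0 i) (M + C + B)) => //.
- by move=> k; exact: (measurable_adjoint_coord qP).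
- by move=> k; exact: (integrable_adjoint_coord qP).
- by move=> i s; rewrite (le_trans (bM i s))// -addrA lerDl addr_ge0.
- by move=> i k s; rewrite (le_trans (jM i k s))// -addrA lerDl addr_ge0.
- move=> i p; rewrite (le_trans (rB n i p))// (@le_trans _ _ B)//; last by rewrite lerDr addr_ge0.
  by rewrite ler_piMr.
- by move=> i; exact: continuous_coord (@cdelta n) i.
- move=> i s; apply: (le_trans (ler_coord_norm _ _)); rewrite (le_trans (dC n s))//.
  rewrite (@le_trans _ _ C)//; first by rewrite ler_piMr.
  by rewrite addrAC lerDr addr_ge0.
- by move=> i s; exact: deltaE.
Qed.

Let Phi_cvg k p : (e n)^-1 * Phi n k p @[n --> \oo] -->
  - (F k (needle A s0 p).2 - F k p.2).
Proof.
have [C C0 dC] := delta_le.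
have Fcvg s : field f (xn n) s 0 k @[n --> \oo] --> F k s.
  apply/cvgrPdist_le => eps eps0.
  have : L * C * e n @[n --> \oo] --> (0 : R) by rewrite -[X in _ --> X](mulr0 (L * C)); exact: cvgMr.
  move=> /cvgr0Pnorm_le/(_ eps eps0); apply: filterS => n hn.
  apply: le_trans (le_trans (ler_norm _) hn).
  rewrite distrC /F.
  have -> : field f (xn n) s 0 k - field f x s 0 k = (field f (xn n) s - field f x s) 0 k.
    by rewrite !mxE.
  apply: (le_trans (ler_coord_norm _ _)); apply: (le_trans (field_lip f_lip _ _ _)).
  by rewrite -mulrA ler_pM2l//; exact: dC.
have D0 := differentiable_sequence (f_diff (x (clamp p.2)) (clamp_I01 p.2)) e_gt0 e_cvg
  (fun n => dC n p.2).
have D1 : ((e n)^-1 *: (f (clamp p.2) (xn n (clamp p.2)) - f (clamp p.2) (x (clamp p.2)) -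
    'd (f (clamp p.2)) (x (clamp p.2)) (delta n p.2))) 0 k @[n --> \oo] --> (0 : R).
  have := cvg_comp _ _ D0 (@coord_continuous _ _ _ 0 k _).
  by rewrite mxE.
rewrite (_ : (fun n => _) = (fun n =>
  - ((e n)^-1 *: (f (clamp p.2) (xn n (clamp p.2)) - f (clamp p.2) (x (clamp p.2)) -
    'd (f (clamp p.2)) (x (clamp p.2)) (delta n p.2))) 0 k
  - (field f (xn n) (needle A s0 p).2 0 k - field f (xn n) p.2 0 k))); last first.
  apply/funext => n; rewrite diff_jacobian.
  have -> : ((e n)^-1 *: (f (clamp p.2) (xn n (clamp p.2)) - f (clamp p.2) (x (clamp p.2)) -
      delta n p.2 *m 'J (f (clamp p.2)) (x (clamp p.2)))) 0 k =
      (e n)^-1 * (field f (xn n) p.2 0 k - field f x p.2 0 k -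
      \sum_i delta n p.2 0 i * field_jac f x i k p.2).
    rewrite mxE; congr (_ * _); rewrite mxE [X in _ + X]mxE; congr (_ - _).
      by rewrite mxE [X in _ + X]mxE.
    by rewrite mxE.
  rewrite /Phi /rho; field; rewrite gt_eqF//.
rewrite [X in _ --> X](_ : _ = - 0 - (F k (needle A s0 p).2 - F k p.2)); last first.
  by rewrite oppr0 add0r.
apply: cvgB; first exact: cvgN.
by apply: cvgB; exact: Fcvg.
Qed.

Let Phi_le : exists2 K, 0 <= K & forall n k p, `|(e n)^-1 * Phi n k p| <= K.
Proof.
have [M M0 [bM jM FM]] := M1; have [C C0 dC] := delta_le; have [B B0 rB] := rho_le.
exists (d%:R * (C * M) + B); first by rewrite addr_ge0// !mulr_ge0.
move=> n k p; have en := e_gt0 n; rewrite normrM ger0_norm ?invr_ge0 ?(ltW en)//.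
rewrite ler_pdivrMl// mulrC mulrDl /Phi.
apply: (le_trans (ler_normB _ _)); apply: lerD => //.
apply: (le_trans (ler_norm_sum _ _ _)).
have -> : d%:R * (C * M) * e n = \sum_(i < d) C * e n * M.
  by rewrite sumr_const card_ord -mulr_natl; ring.
apply: ler_sum => i _; rewrite normrM; apply: ler_pM => //.
exact: le_trans (ler_coord_norm _ _) (dC n p.2).
Qed.

Let mF k : measurable_fun setT (fun p : borelR2 R => F k (needle A s0 p).2 - F k p.2).
Proof. exact: (measurable_funB (mfield_needle k cx) (mfield_snd k cx)). Qed.

Let mPhi n k : measurable_fun setT (Phi n k : borelR2 R -> R).
Proof.
apply: measurable_funB; last exact: mrho.
have c : continuous (fun s => \sum_i delta n s 0 i * field_jac f x i k s).
  apply: continuous_sum => i s; apply: cvgM; last exact: cjac.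
  exact: continuous_coord (@cdelta n) i s.
exact: measurableT_comp (continuous_measurable_fun c) _.
Qed.

Let qint k := integrable_marginal1 gammaP (measurable_adjoint_coord qP k) (integrable_adjoint_coord qP k).

Let Delta_cvg : (e n)^-1 * Delta n @[n --> \oo] -->
  \sum_k \int[gamma]_p (adjoint_coord q k p.1 * - (F k (needle A s0 p).2 - F k p.2)).
Proof.
have [K K0 PK] := Phi_le.
rewrite (_ : (fun n => _) = (fun n =>
  \sum_k \int[gamma]_p (adjoint_coord q k p.1 * ((e n)^-1 * Phi n k p)))); last first.
  apply/funext => n; rewrite variation_identity mulr_sumr; apply: eq_bigr => k _.
  have en : e n != 0 by rewrite gt_eqF.
  have i1 : gamma.-integrable setT (EFin \o
      (fun p : borelR2 R => adjoint_coord q k p.1 * Phi n k p)).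
    apply: (integrable_mul_bounded (M := K * e n) (@qint k) (@mPhi n k)) => p.
    have := PK n k p; rewrite normrM ger0_norm ?invr_ge0 ?(ltW (e_gt0 n))//.
    by rewrite ler_pdivrMl// mulrC.
  by rewrite -RintegralZl//; apply: eq_Rintegral => p _; rewrite mulrCA.
apply: cvg_big => //; first exact: add_continuous.
move=> k _; have mq := measurable_adjoint_coord qP k.
have mq1 : measurable_fun setT (fun p : borelR2 R => adjoint_coord q k p.1).
  exact: measurableT_comp mq _.
apply: (@Rintegral_cvg _ _ _ gamma
  (fun n p => adjoint_coord q k p.1 * ((e n)^-1 * Phi n k p))
  (fun p => adjoint_coord q k p.1 * - (F k (needle A s0 p).2 - F k p.2))
  (fun p => `|adjoint_coord q k p.1| * K)).
- move=> n; apply: measurable_funM => //; apply: measurable_funM; last exact: mPhi.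
  exact: measurable_cst.
- by apply: measurable_funM => //; apply: measurable_funN; exact: mF.
- apply: (@integrable_mul_bounded _ _ _ _ _ _ K).
  + exact: integrable_norm (@qint k).
  + exact: measurable_cst.
  + by move=> p; rewrite ger0_norm.
- by move=> p; apply: cvgMr; exact: Phi_cvg.
- by move=> n; apply: aeW => p; rewrite normrM ler_wpM2l.
Qed.

Let terminal_cvg : (e n)^-1 * (h (xn n 1) - h (x 1) -
    \sum_i grad h (x 1) 0 i * delta n 1 0 i) @[n --> \oo] --> (0 : R).
Proof.
have [C C0 dC] := delta_le.
have I1 : I01 (1 : R) by rewrite /I01/= in_itv/= ler01 lexx.
have dC1 n : `|xn n 1 - x 1| <= C * e n by have := dC n 1; rewrite /delta clamp_id.
have := differentiable_sequence (V := R) (h_diff (x 1)) e_gt0 e_cvg dC1.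
rewrite (_ : (fun n => _ *: _) = (fun n => (e n)^-1 * (h (xn n 1) - h (x 1) -
    \sum_i grad h (x 1) 0 i * delta n 1 0 i)))//.
by apply/funext => n; rewrite diff_grad// /delta clamp_id.
Qed.

Let jc (y : R -> 'rV[R]_d) s := j (clamp s) (y (clamp s)).

Let cjc y : {within I01, continuous y} -> continuous (jc y).
Proof. exact: continuous_along. Qed.

Let mbd n : continuous (fun s => \sum_i cost_grad j x i s * delta n s 0 i).
Proof.
apply: continuous_sum => i s; apply: cvgM; first exact: cb.
exact: continuous_coord (@cdelta n) i s.
Qed.

Let running_cvg : \int[marginal1 gamma]_s ((e n)^-1 * (jc (xn n) s - jc x s -
    \sum_i cost_grad j x i s * delta n s 0 i)) @[n --> \oo] --> (0 : R).
Proof.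
have [M M0 [bM jM FM]] := M1; have [C C0 dC] := delta_le.
have cX : continuous (fun s => `|x (clamp s)|).
  move=> s; apply: cvg_norm.
  exact: (continuous_within_comp cx (@clamp_I01 R) (@continuous_clamp R)).
have [r r0 xr] := continuous_clamp_bounded cX.
have {}xr s : `|x (clamp s)| <= r by have := xr s; rewrite clampK normr_id.
have [K K0 KP] := @locally_lipschitz R d j (r + C) j_diff j_C1.
have xnr n s : `|xn n (clamp s)| <= r + C.
  rewrite -(subrK (x (clamp s)) (xn n (clamp s))) addrC.
  apply: (le_trans (ler_normD _ _)); apply: lerD => //.
  by apply: (le_trans (dC n s)); rewrite ler_piMr//; case/andP: (e01 n).
rewrite -[X in _ --> X](_ : \int[marginal1 gamma]_s (0 : R) = 0); last first.
  by rewrite Rintegral_cst// mul0r.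
apply: (@Rintegral_cvg _ _ _ _ _ _ (cst (K * C + d%:R * (M * C)))).
- move=> n; apply: measurable_funM; first exact: measurable_cst.
  apply: measurable_funB; last exact: (continuous_measurable_fun (@mbd n)).
  apply: measurable_funB; [exact: (continuous_measurable_fun (cjc (@cxn n)))|
    exact: (continuous_measurable_fun (cjc cx))].
- exact: measurable_cst.
- exact: finite_measure_integrable_cst.
- move=> s; have := differentiable_sequence (V := R)
    (j_diff (x (clamp s)) (clamp_I01 s)) e_gt0 e_cvg (fun n => dC n s).
  rewrite (_ : (fun n => _ *: _) = (fun n => (e n)^-1 * (jc (xn n) s - jc x s -
    \sum_i cost_grad j x i s * delta n s 0 i)))//.
  by apply/funext => n; rewrite diff_grad//; apply: j_diff; exact: clamp_I01.
- move=> n; apply: aeW => s; have en := e_gt0 n.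
  rewrite normrM ger0_norm ?invr_ge0 ?(ltW en)// ler_pdivrMl// mulrC mulrDl.
  apply: (le_trans (ler_normB _ _)); apply: lerD.
    apply: (le_trans (KP _ _ _ (clamp_I01 s) _ (xnr n s))).
      by rewrite (le_trans (xr s))// lerDl.
    by rewrite -mulrA ler_wpM2l//; exact: dC.
  apply: (le_trans (ler_norm_sum _ _ _)).
  have -> : d%:R * (M * C) * e n = \sum_(i < d) M * (C * e n).
    by rewrite sumr_const card_ord -mulr_natl; ring.
  apply: ler_sum => i _; rewrite normrM; apply: ler_pM => //.
  exact: le_trans (ler_coord_norm _ _) (dC n s).
Qed.

Let cost_diff n : cost f x0 j h g (gam n) - cost f x0 j h g gamma =
  \int[marginal1 gamma]_s (jc (xn n) s - jc x s) + (h (xn n 1) - h (x 1)) +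
  e n * \int[gamma]_p (gext (needle A s0 p) - gext p).
Proof.
have run y : {within I01, continuous y} ->
    \int[mu]_(t in I01) j t (y t) = \int[marginal1 gamma]_s jc y s.
  move=> cy; have cjy := cjc cy; have [M M0 jM] := continuous_clamp_bounded cjy.
  rewrite Rintegral_marginal1_lebesgue//.
  - by apply: eq_Rintegral => t /set_mem It; rewrite /jc clamp_id.
  - exact: continuous_measurable_fun.
  - apply: (bounded_integrable_I01 (M := M)); first exact: continuous_measurable_fun.
    by move=> s; have := jM s; rewrite /jc clampK.
have int y : {within I01, continuous y} ->
    (marginal1 gamma).-integrable setT (EFin \o (jc y : borelR R -> R)).
  move=> cy; have cjy := cjc cy; have [M M0 jM] := continuous_clamp_bounded cjy.
  apply: (@bounded_integrable _ _ _ _ _ M); first exact: continuous_measurable_fun.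
  by move=> s; have := jM s; rewrite /jc clampK.
have costE P : Gamma P -> {within I01, continuous (trajectory f x0 P)} ->
    cost f x0 j h g P = \int[marginal1 gamma]_s jc (trajectory f x0 P) s +
      h (trajectory f x0 P 1) + \int[P]_p gext p.
  by move=> PP cP; rewrite /cost (run _ cP) Rintegral_gext.
have [M M0 gM] := gext_bounded.
have gE := Rintegral_perturbed_plan s0 mA gamma (e01 n)
  (continuous_measurable_plane continuous_gext) gM.
have jE := RintegralB measurableT (int _ (@cxn n)) (int _ cx).
have E (a b c w u v r : R) :
    (a + u + (c + r * w)) - (b + v + c) = (a - b) + (u - v) + r * w by ring.
by rewrite (costE _ (gamP n) (@cxn n)) (costE _ gammaP cx) gE jE; exact: E.
Qed.

Lemma first_variation :
  \sum_k \int[gamma]_p (adjoint_coord q k p.1 *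
    (field f x (needle A s0 p).2 0 k - field f x p.2 0 k)) <=
  \int[gamma]_p (gext (needle A s0 p) - gext p).
Proof.
set G := (X in _ <= X).
have cv : \int[marginal1 gamma]_s ((e n)^-1 * (jc (xn n) s - jc x s -
    \sum_i cost_grad j x i s * delta n s 0 i)) +
  (e n)^-1 * (h (xn n 1) - h (x 1) - \sum_i grad h (x 1) 0 i * delta n 1 0 i) +
  (e n)^-1 * Delta n + G @[n --> \oo] -->
  0 + 0 + \sum_k \int[gamma]_p (adjoint_coord q k p.1 *
    - (F k (needle A s0 p).2 - F k p.2)) + G.
  apply: cvgD; last exact: cvg_cst.
  apply: cvgD; last exact: Delta_cvg.
  by apply: cvgD; [exact: running_cvg|exact: terminal_cvg].
rewrite !add0r in cv; rewrite -subr_ge0.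
have -> : G - \sum_k \int[gamma]_p (adjoint_coord q k p.1 *
    (field f x (needle A s0 p).2 0 k - field f x p.2 0 k)) =
    \sum_k \int[gamma]_p (adjoint_coord q k p.1 *
    - (F k (needle A s0 p).2 - F k p.2)) + G.
  rewrite addrC -sumrN; congr (_ + _); apply: eq_bigr => k _.
  have [M M0 [_ _ FM]] := M1.
  rewrite -mulN1r -RintegralZl//.
    by apply: eq_Rintegral => p _; rewrite mulN1r mulrN.
  apply: (integrable_mul_bounded (M := M + M) (@qint k) (@mF k)) => p.
  by rewrite (le_trans (ler_normB _ _))// lerD// (le_trans (ler_coord_norm _ _)).
apply: cvgr_to_ge cv _; apply: nearW => n.
have en : e n != 0 by rewrite gt_eqF.
have en1 : 0 <= (e n)^-1 by rewrite invr_ge0 ltW.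
have [M M0 [bM jM FM]] := M1; have [C C0 dC] := delta_le.
have int1 : (marginal1 gamma).-integrable setT
    (EFin \o (fun s : borelR R => jc (xn n) s - jc x s)).
  have c1 : continuous (fun s => jc (xn n) s - jc x s).
    by move=> s; apply: cvgB; [exact: (cjc (@cxn n))|exact: (cjc cx)].
  have [B B0 cB] := continuous_clamp_bounded c1.
  apply: (@bounded_integrable _ _ _ _ _ B); first exact: continuous_measurable_fun.
  by move=> s; have := cB s; rewrite /jc !clampK.
have int2 : (marginal1 gamma).-integrable setT
    (EFin \o (fun s : borelR R => \sum_i cost_grad j x i s * delta n s 0 i)).
  have [B B0 cB] := continuous_clamp_bounded (@mbd n).
  apply: (@bounded_integrable _ _ _ _ _ B); first exact: (continuous_measurable_fun (@mbd n)).
  by move=> s; have := cB s; rewrite /cost_grad /delta !clampK.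
have int12 : (marginal1 gamma).-integrable setT (EFin \o
    (fun s : borelR R => jc (xn n) s - jc x s - \sum_i cost_grad j x i s * delta n s 0 i)).
  by have := integrableB measurableT int1 int2; apply: eq_integrable.
rewrite RintegralZl// RintegralB//.
have := gamma_min (gamP n); rewrite -subr_ge0 cost_diff -/G => /(mulr_ge0 en1).
rewrite /Delta; set a := \int[_]_s _; set b := \int[_]_s _.
by move=> /le_trans; apply; rewrite le_eqVlt; apply/orP; left; apply/eqP; field.
Qed.

End FirstVariation.

(** * The maximum condition *)

Section Maximality.
Context {R : realType} {d : nat}.
Local Notation mu := (@lebesgue_measure R).
Variables (gamma : probability (borelR2 R) R) (gammaP : Gamma gamma).
Variables (nu : R -> probability (borelR R) R) (nuP : disintegration1 gamma nu).
Variables (a F : 'I_d -> R -> R) (G : R * R -> R) (M : R).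
Hypothesis ma : forall k, measurable_fun setT (a k : borelR R -> R).
Hypothesis ai : forall k, mu.-integrable I01 (EFin \o a k).
Hypothesis cF : forall k, continuous (F k).
Hypothesis FM : forall k s, `|F k s| <= M.
Hypothesis cG : continuous G.
Hypothesis GM : forall p, `|G p| <= M.

Definition reward (t s : R) : R := \sum_k a k t * F k s - G (t, s).

Definition mean_reward (t : R) : R :=
  \sum_k a k t * fiber_mean nu (fun p => F k p.2) t - fiber_mean nu G t.

Lemma fiber_mean_cstB (c : R -> R) (phi : R * R -> R) (B t : R) :
  measurable_fun setT (phi : borelR2 R -> R) -> (forall p, `|phi p| <= B) ->
  fiber_mean nu (fun p => c p.1 - phi p) t = c t - fiber_mean nu phi t.
Proof.
move=> mphi phiB; rewrite /fiber_mean.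
have mt : measurable_fun setT (fun s : borelR R => phi (t, s)).
  exact: measurableT_comp mphi _.
have mct : measurable_fun setT (fun s : borelR R => c t - phi (t, s)).
  by apply: measurable_funB mt; exact: measurable_cst.
have PI := disintegration1_I01 nuP (clamp_I01 t).
rewrite (@Rintegral_full _ _ _ (nu (clamp t)) _ (fun s => c t - phi (t, s)) _ measurable_I01 PI mct)//.
rewrite (@Rintegral_full _ _ _ (nu (clamp t)) _ (fun s => phi (t, s)) _ measurable_I01 PI mt)//.
rewrite RintegralB//; last 2 first.
- exact: finite_measure_integrable_cst.
- exact: bounded_integrable mt (fun s => phiB (t, s)).
by rewrite Rintegral_probability_cst.
Qed.

Let cF2 k : continuous (fun p : R * R => F k p.2).
Proof. by move=> p; apply: continuous_comp; [exact: cvg_snd|exact: cF]. Qed.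

Let mF2 k : measurable_fun setT (fun p : borelR2 R => F k p.2).
Proof. exact: continuous_measurable_plane (@cF2 k). Qed.

Let mG : measurable_fun setT (G : borelR2 R -> R).
Proof. exact: continuous_measurable_plane. Qed.

Let cGs s0 : continuous (fun t : R => G (t, s0)).
Proof.
move=> t; apply: (@continuous_comp _ _ _ (fun t => (t, s0)) G); last exact: cG.
by apply: (@cvg_pair _ _ _ _ (nbhs t) (nbhs s0)); [exact: cvg_id|exact: cvg_cst].
Qed.

Let cGt t : continuous (fun s : R => G (t, s)).
Proof.
move=> s; apply: (@continuous_comp _ _ _ (fun s => (t, s)) G); last exact: cG.
by apply: (@cvg_pair _ _ _ _ (nbhs t) (nbhs s)); [exact: cvg_cst|exact: cvg_id].
Qed.

Let mreward s0 : measurable_fun setT ((fun t => reward t s0 - mean_reward t) : borelR R -> R).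
Proof.
apply: measurable_funB; apply: measurable_funB.
- apply: measurable_sum => k; apply: measurable_funM => //; exact: measurable_cst.
- exact: continuous_measurable_fun.
- apply: measurable_sum => k; apply: measurable_funM => //.
  exact: (measurable_fiber_mean nuP (@mF2 k)).
- exact: (measurable_fiber_mean nuP mG).
Qed.

Section Threshold.
Variables (A : set (borelR R)) (s0 : R) (mA : measurable A).

Let mF' k : measurable_fun setT ((fun t => F k s0 - fiber_mean nu (fun p => F k p.2) t) : borelR R -> R).
Proof.
apply: measurable_funB; first exact: measurable_cst.
exact: (measurable_fiber_mean nuP (@mF2 k)).
Qed.

Let mG' : measurable_fun setT ((fun t => G (t, s0) - fiber_mean nu G t) : borelR R -> R).
Proof.
apply: measurable_funB; first exact: continuous_measurable_fun.
exact: (measurable_fiber_mean nuP mG).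
Qed.

Let FM' k t : `|F k s0 - fiber_mean nu (fun p => F k p.2) t| <= M + M.
Proof.
rewrite (le_trans (ler_normB _ _))// lerD//.
by apply: (fiber_mean_bounded nuP); [exact: mF2|move=> p; exact: FM].
Qed.

Let GM' t : `|G (t, s0) - fiber_mean nu G t| <= M + M.
Proof. by rewrite (le_trans (ler_normB _ _))// lerD// (fiber_mean_bounded nuP). Qed.

Let mind : measurable_fun setT (\1_A : borelR R -> R).
Proof. exact: measurable_indic. Qed.

Let ind1 t : `|\1_A t : R| <= 1.
Proof. by rewrite indicE; case: (_ \in _); rewrite ?normr1 ?normr0. Qed.

Let indi : mu.-integrable I01 (EFin \o (\1_A : R -> R)).
Proof. exact: (bounded_integrable_I01 mind ind1). Qed.

Let mak k : measurable_fun setT ((fun t => a k t * \1_A t) : borelR R -> R).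
Proof. exact: measurable_funM. Qed.

Let aki k : mu.-integrable I01 (EFin \o (fun t => a k t * (\1_A t : R))).
Proof.
have := integrableMl measurable_I01 (ai k) (measurable_funTS mind).
apply; exists 1; split; rewrite ?num_real// => y y1 t _.
exact: le_trans (ind1 t) (ltW y1).
Qed.

Let wFi k : gamma.-integrable setT (EFin \o (fun p : borelR2 R =>
  a k p.1 * \1_A p.1 * (F k s0 - fiber_mean nu (fun p => F k p.2) p.1))).
Proof.
apply: (integrable_mul_bounded (M := M + M) (integrable_marginal1 gammaP (@mak k) (@aki k))).
  exact: measurableT_comp (@mF' k) _.
by move=> p; exact: FM'.
Qed.

Let wGi : gamma.-integrable setT (EFin \o (fun p : borelR2 R =>
  \1_A p.1 * (G (p.1, s0) - fiber_mean nu G p.1))).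
Proof.
apply: (integrable_mul_bounded (M := M + M) (integrable_marginal1 gammaP mind indi)).
  exact: measurableT_comp mG' _.
by move=> p; exact: GM'.
Qed.

Let excessE (p : R * R) : \1_A p.1 * (reward p.1 s0 - mean_reward p.1) =
  \sum_k a k p.1 * \1_A p.1 * (F k s0 - fiber_mean nu (fun p => F k p.2) p.1)
  - \1_A p.1 * (G (p.1, s0) - fiber_mean nu G p.1).
Proof.
rewrite /reward /mean_reward.
have -> : \sum_k a k p.1 * \1_A p.1 * (F k s0 - fiber_mean nu (fun p => F k p.2) p.1) =
    \1_A p.1 * (\sum_k a k p.1 * F k s0 - \sum_k a k p.1 * fiber_mean nu (fun p => F k p.2) p.1).
  by rewrite -sumrB mulr_sumr; apply: eq_bigr => k _; ring.
ring.
Qed.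

Lemma integrable_excess : gamma.-integrable setT (EFin \o
  (fun p : borelR2 R => \1_A p.1 * (reward p.1 s0 - mean_reward p.1))).
Proof.
have := integrableB measurableT (integrable_sumR (index_enum 'I_d) wFi) wGi.
by apply: eq_integrable => // p _; rewrite /comp excessE.
Qed.

Lemma excess_le0 :
  \sum_k \int[gamma]_p (a k p.1 * (F k (needle A s0 p).2 - F k p.2)) <=
    \int[gamma]_p (G (needle A s0 p) - G p) ->
  \int[gamma]_p (\1_A p.1 * (reward p.1 s0 - mean_reward p.1)) <= 0.
Proof.
move=> var; under eq_Rintegral do rewrite excessE.
rewrite RintegralB//; last exact: (integrable_sumR (index_enum 'I_d) wFi).
rewrite Rintegral_sum// subr_le0; apply: le_trans (le_trans var _).
  apply: ler_sum => k _; rewrite le_eqVlt; apply/orP; left; apply/eqP.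
  transitivity (\int[gamma]_p (a k p.1 * \1_A p.1 * (F k s0 - F k p.2))).
    rewrite (Rintegral_disintegration1_mul gammaP nuP (M := M + M)
      (phi := fun p => F k s0 - F k p.2) (@mak k) (@aki k)).
    - apply: eq_Rintegral => p _; congr (_ * _).
      by rewrite (fiber_mean_cstB (fun=> F k s0) (B := M)).
    - by move=> p; apply: cvgB; [exact: cvg_cst|exact: cF2].
    - by move=> p; rewrite (le_trans (ler_normB _ _))// lerD.
  apply: eq_Rintegral => p _.
  by rewrite (needleE A s0 (fun p => F k p.2)) /= addrAC subrr add0r mulrA.
rewrite le_eqVlt; apply/orP; left; apply/eqP; transitivity (\int[gamma]_p (\1_A p.1 * (G (p.1, s0) - G p))).
  by apply: eq_Rintegral => p _; rewrite (needleE A s0 G) addrAC subrr add0r.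
rewrite (Rintegral_disintegration1_mul gammaP nuP (M := M + M)
  (phi := fun p => G (p.1, s0) - G p) mind indi).
- apply: eq_Rintegral => p _; congr (_ * _).
  by rewrite (fiber_mean_cstB (fun t => G (t, s0)) (B := M)).
- move=> p; apply: cvgB; last exact: cG.
  by apply: (@continuous_comp _ _ _ fst (fun t => G (t, s0))); [exact: cvg_fst|exact: cGs].
- by move=> p; rewrite (le_trans (ler_normB _ _))// lerD.
Qed.

End Threshold.

Hypothesis variation : forall (A : set (borelR R)) s0, measurable A ->
  (forall t, A t -> s0 <= t) -> I01 s0 ->
  \sum_k \int[gamma]_p (a k p.1 * (F k (needle A s0 p).2 - F k p.2)) <=
    \int[gamma]_p (G (needle A s0 p) - G p).

Lemma reward_le_mean s0 : I01 s0 ->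
  {ae mu, forall t, t \in I01 -> s0 <= t -> reward t s0 <= mean_reward t}.
Proof.
move=> s0I; pose psi t := reward t s0 - mean_reward t.
pose A : set (borelR R) := `[s0, 1]%classic `&` (psi @^-1` `]0, +oo[%classic).
have mA : measurable A.
  apply: measurableI; first exact: measurable_itv.
  rewrite -[X in measurable X]setTI; apply: (@mreward s0 measurableT).
  exact: measurable_itv.
have As0 t : A t -> s0 <= t by case; rewrite /= in_itv/= => /andP[].
have Apos t : A t -> 0 < psi t by case=> _; rewrite /= in_itv/= andbT.
have := ae_eq0_of_Rintegral_le0 (integrable_excess s0 mA) _
  (excess_le0 mA (variation mA As0 s0I)).
have w0 (p : borelR2 R) : 0 <= \1_A p.1 * (reward p.1 s0 - mean_reward p.1).
  rewrite indicE; case: (boolP (p.1 \in A)) => [/set_mem/Apos/ltW|_]; rewrite ?mul0r//.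
  by rewrite mul1r.
move=> /(_ w0) [N [mN N0 wN]].
have AI : A `&` @I01 R = A.
  apply/setIidPl => t [+ _]; move: s0I; rewrite /I01/= !in_itv/= => /andP[s00 _] /andP[st ->].
  by rewrite andbT (le_trans s00 st).
exists A; split => //.
  have := gammaP.2 A mA; rewrite /mrestr AI => <-.
  apply/eqP; rewrite eq_le measure_ge0 andbT.
  have mAf : measurable [set p : borelR2 R | A p.1] by exact: measurable_preimage_fst.
  have : (gamma [set p : borelR2 R | A p.1] <= gamma N)%E.
    apply: le_measure; rewrite ?inE// => p /= Ap; apply: wN => /=.
    rewrite indicE mem_set// mul1r => /eqP; rewrite gt_eqF//; exact: Apos.
  by rewrite N0.
move=> t /= nt; apply: contrapT => nAt; apply: nt => /set_mem It st.
rewrite leNgt; apply/negP => lt; apply: nAt; split => /=.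
  by rewrite in_itv/= st; move: It; rewrite /I01/= in_itv/= => /andP[].
by rewrite in_itv/= andbT /psi subr_gt0.
Qed.

Lemma reward_le_mean_rat : {ae mu, forall t, t \in I01 -> forall r : rat,
  (0 : R) <= ratr r <= t -> reward t (ratr r) <= mean_reward t}.
Proof.
have : {ae mu, forall t, forall n, t \in I01 -> forall r : rat, unpickle n = Some r ->
    (0 : R) <= ratr r <= t -> reward t (ratr r) <= mean_reward t}.
  apply/ae_foralln => n; case: (unpickle n : option rat) => [r|]; last first.
    by apply: aeW => t _ r.
  have [rI|rI] := pselect (I01 (ratr r : R)).
    apply: ae_imp (reward_le_mean rI) => t ht It _ [<-] /andP[_ rt]; exact: ht.
  apply: aeW => t /set_mem It _ [<-] /andP[r0 rt]; exfalso; apply: rI.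
  move: It; rewrite /I01/= !in_itv/= => /andP[_ t1].
  by rewrite r0 (le_trans rt t1).
by apply: ae_imp => t ht It r; apply: (ht (pickle r) It); rewrite pickleK.
Qed.

Let creward t : continuous (reward t).
Proof.
move=> s; apply: cvgB; last exact: cGt.
apply: (@continuous_sum _ _ _ (fun k s => a k t * F k s)) => k {}s.
by apply: cvgM; [exact: cvg_cst|exact: cF].
Qed.

Let reward_le t : t \in I01 -> 0 < t -> (forall r : rat,
  (0 : R) <= ratr r <= t -> reward t (ratr r) <= mean_reward t) ->
  forall s : R, 0 <= s <= t -> reward t s <= mean_reward t.
Proof.
move=> It t0 rat_le s /andP[s0 st]; rewrite leNgt; apply/negP => lt.
have [e /= e0 he] : \forall z \near s, mean_reward t < reward t z.
  exact: cvgr_gt (@creward t s) _ lt.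
have /rat_in_itvoo[r] : Num.max 0 (s - e) < Num.min t (s + e).
  rewrite gt_max !lt_min; apply/andP; split; apply/andP; split; lra.
rewrite in_itv/= gt_max !lt_min => h.
case/andP: h => [/andP[r0 r1] /andP[r2 r3]].
have := rat_le r; rewrite (ltW r0) (ltW r2) => /(_ isT); rewrite leNgt he//.
by rewrite /ball_/= ltr_distlC; lra.
Qed.

Let mean_rewardE t : I01 t -> \int[nu t]_s (mean_reward t - reward t s) = 0.
Proof.
move=> It; rewrite /mean_reward /reward !(fiber_meanE nuP)//.
have Fi k : (nu t).-integrable setT (EFin \o F k).
  exact: (@bounded_integrable _ _ _ (nu t) (F k) M (continuous_measurable_fun (@cF k)) (FM k)).
have aFi k : (nu t).-integrable setT (EFin \o (fun s => a k t * F k s)).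
  by have := integrableZl measurableT (a k t) (Fi k); apply: eq_integrable.
have Gi : (nu t).-integrable setT (EFin \o (fun s => G (t, s))).
  exact: (@bounded_integrable _ _ _ (nu t) (fun s => G (t, s)) M (continuous_measurable_fun (@cGt t)) (fun s => GM (t, s))).
have rE : \int[nu t]_s (\sum_k a k t * F k s - G (t, s)) =
    \sum_k a k t * fiber_mean nu (fun p => F k p.2) t - \int[nu t]_s G (t, s).
  rewrite RintegralB//; last exact: integrable_sumR.
  rewrite Rintegral_sum//; congr (_ - _); apply: eq_bigr => k _.
  by rewrite RintegralZl// (fiber_meanE nuP).
rewrite RintegralB//.
- by rewrite rE Rintegral_probability_cst subrr.
- exact: finite_measure_integrable_cst.
- by have := integrableB measurableT (integrable_sumR (index_enum 'I_d) aFi) Gi; apply: eq_integrable.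
Qed.

Lemma spt_argmax_reward : {ae mu, forall t, t \in I01 ->
  spt (nu t) `<=` argmax_on `[0, t] (reward t)}.
Proof.
have n0 : {ae mu, forall t, t != 0}.
  exists [set 0 : R]; split; [exact: measurable_set1|exact: lebesgue_measure_set1|].
  by move=> t /= /negP; rewrite negbK => /eqP.
apply: ae_imp2 n0 reward_le_mean_rat => t tn0 rat_le tI s s_spt.
have It : I01 t by exact: set_mem.
have t0 : 0 < t by move: It; rewrite /I01/= in_itv/= lt_neqAle eq_sym tn0 => /andP[].
have le := reward_le tI t0 (rat_le tI).
have [_ /(_ t tI) nut _] := nuP.
have m0t : measurable (`[0, t]%classic : set (borelR R)) by exact: measurable_itv.
have st : `[0, t]%classic s.
  apply: contrapT => ns; have := s_spt (~` `[0, t]%classic) _ ns.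
  rewrite probability_setC// nut subee// ltxx; move=> h.
  suff : false by []. apply: h; rewrite openC; exact: interval_closed.
split => // r rt.
suff -> : reward t s = mean_reward t by apply: le; move: rt; rewrite /= in_itv.
apply/eqP; rewrite eq_le le ?andTb; last by move: st; rewrite /= in_itv.
rewrite leNgt; apply/negP => lt.
pose phi z := mean_reward t - reward t z.
have cphi : continuous phi by move=> z; apply: cvgB; [exact: cvg_cst|exact: creward].
have mphi := continuous_measurable_fun cphi.
pose w := (phi \_ `[0, t]) : R -> R.
have w0 z : 0 <= w z.
  rewrite /w patchE; case: ifPn => // /set_mem; rewrite /= in_itv/= => zt.
  by rewrite subr_ge0 le.
have mw : measurable_fun setT (w : borelR R -> R).
  by apply/(measurable_restrictT _ m0t); exact: measurable_funTS.
have wphi : {ae nu t, forall z, w z = phi z}.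
  by apply: ae_imp (ae_full m0t nut) => z zt; rewrite /w patchE mem_set.
have phii : (nu t).-integrable setT (EFin \o phi).
  have B z : `|reward t z| <= \sum_k `|a k t| * M + M.
    rewrite /reward (le_trans (ler_normB _ _))// lerD// (le_trans (ler_norm_sum _ _ _))//.
    by apply: ler_sum => k _; rewrite normrM ler_wpM2l.
  apply: (@bounded_integrable _ _ _ (nu t) phi (`|mean_reward t| + (\sum_k `|a k t| * M + M)) mphi) => z.
  by rewrite (le_trans (ler_normB _ _))// lerD.
have wi : (nu t).-integrable setT (EFin \o w).
  apply: integrable_le_norm mw phii _ => z.
  by rewrite /w patchE; case: ifP => // _; rewrite normr0.
have w_le0 : \int[nu t]_z w z <= 0.
  by rewrite (ae_eq_Rintegral mw mphi wphi) mean_rewardE.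
have ae0 : {ae nu t, forall z, phi z = 0}.
  apply: (ae_imp2 _ wphi (ae_eq0_of_Rintegral_le0 wi w0 w_le0)) => z.
  by move=> <-.
have [N [mN N0 phiN]] := ae0.
have oU : open (phi @^-1` [set z | 0 < z]).
  by apply: open_comp; [move=> z _; exact: cphi|exact: open_gt].
have := s_spt _ oU; rewrite /= /phi subr_gt0 => /(_ lt).
rewrite ltNge => /negP; apply; rewrite -N0; apply: le_measure; rewrite ?inE//.
- by rewrite -[X in measurable X]setTI; apply: mphi => //; apply: open_measurable; exact: open_gt.
- move=> z /= z0; apply: phiN => /= /eqP; rewrite gt_eqF//.
Qed.

End Maximality.

Theorem theorem4p3 (R : realType) (d : nat) (hd : (0 < d)%N)
    (x0 : 'rV[R]_d) (f : R -> 'rV[R]_d -> 'rV[R]_d)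
    (j : R -> 'rV[R]_d -> R) (h : 'rV[R]_d -> R) (g : R -> R -> R)
    (f_cont : {within I01 `*` setT,
       continuous (fun p : R * 'rV[R]_d => f p.1 p.2)})
    (f_lip : exists2 k : R, 0 <= k & forall (t : R) (x y : 'rV[R]_d),
       t \in I01 -> enorm (f t x - f t y) <= k * enorm (x - y))
    (j_cont : {within I01 `*` setT,
       continuous (fun p : R * 'rV[R]_d => j p.1 p.2)})
    (h_cont : continuous h)
    (g_cont : {within triangle, continuous (fun p : R * R => g p.1 p.2)})
    (h_diff : forall x, differentiable h x)
    (h_C1 : continuous (grad h))
    (j_diff : forall t x, t \in I01 -> differentiable (j t) x)
    (f_diff : forall t x, t \in I01 -> differentiable (f t) x)
    (j_C1 : {within I01 `*` setT,
       continuous (fun p : R * 'rV[R]_d => grad (j p.1) p.2)})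
    (f_C1 : {within I01 `*` setT,
       continuous (fun p : R * 'rV[R]_d => 'J (f p.1) p.2)})
    (gamma : probability (borelR2 R) R) (gammaP : Gamma gamma)
    (gamma_min : forall gamma', Gamma gamma' ->
       cost f x0 j h g gamma <= cost f x0 j h g gamma')
    (nu nus : R -> probability (borelR R) R)
    (nuP : disintegration1 gamma nu) (nusP : disintegration2 gamma nus)
    (x : R -> 'rV[R]_d) (xP : x = trajectory f x0 gamma)
    (q : R -> 'rV[R]_d) (qP : is_adjoint f j h gamma nus x q) :
  {ae (@lebesgue_measure R), forall t, t \in I01 ->
     spt (nu t) `<=`
       argmax_on `[0, t] (fun s => dotp (q t) (f s (x s)) - g t s)}.

Proof.
have [k k0 kP] := f_lip; pose L := k * Num.sqrt d%:R + 1.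
have L0 : 0 < L by rewrite ltr_wpDl// mulr_ge0// sqrtr_ge0.
have lip t y z : I01 t -> `|f t y - f t z| <= L * `|y - z|.
  move=> It; apply: (le_trans (ler_norm_enorm _)).
  apply: (le_trans (kP t y z (mem_set It))).
  rewrite /L mulrDl mul1r -mulrA; apply: le_trans (ler_wpM2l k0 (enorm_le _)) _.
  by rewrite lerDl.
have jd t y : I01 t -> differentiable (j t) y by move=> It; apply: j_diff; exact: mem_set.
have fd t y : I01 t -> differentiable (f t) y by move=> It; apply: f_diff; exact: mem_set.
rewrite xP in qP *; set y := trajectory f x0 gamma in qP *.
have [cy _] := trajectoryP x0 f_cont L0 lip gammaP (ex_intro _ nu nuP).
have [MF MF0 FM] := field_bounded f_cont cy.
have [MG MG0 GM] := gext_bounded g_cont.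
have := @spt_argmax_reward R d gamma gammaP nu nuP (adjoint_coord q)
  (fun k s => field f y s 0 k) (gext g) (MF + MG) (measurable_adjoint_coord qP)
  (integrable_adjoint_coord qP) _ _ (continuous_gext g_cont) _ _.
move=> /(_ (continuous_coord (continuous_field f_cont cy))).
have FM' i s : `|field f y s 0 i| <= MF + MG.
  by rewrite (le_trans (ler_coord_norm _ _))// (le_trans (FM s))// lerDl.
have GM' p : `|gext g p| <= MF + MG by rewrite (le_trans (GM p))// lerDr.
move=> /(_ FM' GM').
have var (A : set (borelR R)) s0 (mA : measurable A) (A_s0 : forall t, A t -> s0 <= t) (sI : I01 s0) :=
  first_variation f_cont L0 lip j_cont g_cont h_diff jd fd j_C1 f_C1 gammaP gamma_min
    nuP nusP qP mA A_s0 sI.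
move=> /(_ var); apply: ae_imp => t spt_t tI s /(spt_t tI) [st smax].
have It : I01 t by exact: set_mem.
have E r : `[0, t]%classic r -> dotp (q t) (f r (y r)) - g t r =
    reward (adjoint_coord q) (fun k s => field f y s 0 k) (gext g) t r.
  move=> rt; have Tr : triangle (t, r).
    move: It rt; rewrite /triangle /sq01 /I01/= !in_itv/= => /andP[t0 t1] /andP[r0 rt].
    by rewrite t0 t1 r0 (le_trans rt t1).
  have Ir : I01 r by case: Tr => [[]].
  rewrite /reward /gext (clamp2_id Tr) /dotp; congr (_ - _); apply: eq_bigr => i _.
  by rewrite /adjoint_coord /field !clamp_id.
by split => // r rt; rewrite !E//; exact: smax.
Qed.
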